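(* Let $\mathbf{Z},\mathbf{Z}_1,\mathbf{Z}_2,\dots$ be i.i.d. $\mathbb{R}^d$-valued random vectors with $\mathbf{Z}\in\mathrm{RV}(\alpha,\mu)$ for some $\alpha>1$ and $\mathrm{E}(\mathbf{Z})=\mathbf{0}$, and let $\mathbf{S}_n=\mathbf{Z}_1+\cdots+\mathbf{Z}_n$. Let $\mathbf{c}\in\mathbb{R}^d$, $\mathbf{c}\ne\mathbf{0}$, and let $\delta>0$ be such that the set $K_{\mathbf{c}}^\delta=\{\mathbf{x}\in\mathbb{R}^d:\ |\mathbf{x}/|\mathbf{x}|+\mathbf{c}/|\mathbf{c}||<\delta\}$ satisfies $\mu((\partial K_{\mathbf{c}}^\delta)\setminus\{\mathbf{0}\})=0$. For $u>0$ put $$\psi_u(A)=\mathrm{P}(\mathbf{S}_n-\mathbf{c}n\in uA\text{ for some }n\ge1).$$ Then for any set $A\in\mathcal{B}(\mathbb{R}^d\setminus K_{\mathbf{c}}^\delta)$ bounded away from $\mathbf{0}$, $$\mu^*(A^\circ)\le\liminf_{u\to\infty}\frac{\psi_u(A)}{u\mathrm{P}(|\mathbf{Z}|>u)}\le\limsup_{u\to\infty}\frac{\psi_u(A)}{u\mathrm{P}(|\mathbf{Z}|>u)}\le\mu^*(\overline{A}),$$ where $A^\circ$ and $\overline{A}$ are the interior and closure of $A$ and, for any set $B\in\mathcal{B}(\mathbb{R}^d\setminus K_{\mathbf{c}}^\delta)$, $$\mu^*(B)=\int_0^\infty\mu(\mathbf{c}v+B_{\mathbf{c}})\,dv,\qquad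 B_{\mathbf{c}}=\{\mathbf{x}+\mathbf{c}t:\ \mathbf{x}\in B,\ t\ge0\}.$$
   Context: $|\cdot|$ is the (Euclidean) norm on $\mathbb{R}^d$ and $\overline{\mathbb{R}}=\mathbb{R}\cup\{-\infty,\infty\}$. A set $A\subset\mathbb{R}^d$ is bounded away from $\mathbf{0}$ if $\mathbf{0}\notin\overline{A}$. In the definition of $K_{\mathbf{c}}^\delta$ only $\mathbf{x}\neq\mathbf{0}$ is considered. The sets $B_{\mathbf{c}}$ are universally measurable, so $\mu(\mathbf{c}v+B_{\mathbf{c}})$ is understood via the completion of $\mu$. Vague convergence. The space $\overline{\mathbb{R}}^d\setminus\{\mathbf{0}\}$ is topologized so that its Borel sets coincide with those of $\mathbb{R}^d$ on $\mathbb{R}^d\setminus\{\mathbf{0}\}$ and so that a Borel set $B$ is relatively compact iff $B\cap\mathbb{R}^d$ is bounded away from $\mathbf{0}$. Vague convergence $\mu_n\xrightarrow{v}\mu$ of Radon measures on it means $\mu_n(B)\to\mu(B)$ for every relatively compact Borel $B$ with $\mu(\partial B)=0$. Regular variation. $\mathbf{Z}\in\mathrm{RV}(\alpha,\mu)$ means: $\mu$ is a nonnull Radon measure on $\mathcal{B}(\overline{\mathbb{R}}^d\setminus\{\mathbf{0}\})$ with $\mu(\overline{\mathbb{R}}^d\setminus\mathbb{R}^d)=0$; there is a sequence $0<a_n\uparrow\infty$, chosen so that $n\mathrm{P}(|\mathbf{Z}|>a_n)\to1$, with $n\mathrm{P}(a_n^{-1}\mathbf{Z}\in\cdot)\xrightarrow{v}\mu(\cdot)$;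 and $\mu(uB)=u^{-\alpha}\mu(B)$ for all $u>0$ and Borel $B$. With this normalization, $\mathrm{P}(\mathbf{Z}\in u\,\cdot)/\mathrm{P}(|\mathbf{Z}|>u)\xrightarrow{v}\mu(\cdot)$ as $u\to\infty$. *)

(* Defs.v *)
From HB Require Import structures.
From mathcomp Require Import all_boot all_order all_algebra.
From mathcomp Require Import all_classical all_reals all_analysis.

Set Implicit Arguments.
Unset Strict Implicit.
Unset Printing Implicit Defensive.

Import Order.TTheory GRing.Theory Num.Theory.
Import numFieldNormedType.Exports.

Local Open Scope classical_set_scope.
Local Open Scope ring_scope.

Notation Borel T := (g_sigma_algebraType (@open T)).

Definition boundary (T : topologicalType) (B : set T) : set T :=
  closure B `\` interior B.

(* The library norm on row vectors is the sup norm; it induces the same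
   topology as the Euclidean norm, which is the one needed here. *)
Definition enorm (R : realType) (d : nat) (x : 'rV[R]_d) : R :=
  Num.sqrt (\sum_(i < d) x ord0 i ^+ 2).

Definition bounded_away (R : realType) (d : nat) (A : set 'rV[R]_d) : Prop :=
  ~ closure A 0.

Definition embed (R : realType) (d : nat) (x : 'rV[R]_d) : 'rV[\bar R]_d :=
  map_mx EFin x.

Definition escale (R : realType) (d : nat) (u : R) (x : 'rV[\bar R]_d)
    : 'rV[\bar R]_d :=
  map_mx (fun y : \bar R => (u%:E * y)%E) x.

(* Relative compactness in the punctured space, i.e. the (compact) product
   space \bar R^d without the origin: the finite points are a neighbourhood of
   the origin, so only the finite part of B matters. *)
Definition relatively_compact (R : realType) (d : nat)
    (B : set 'rV[\bar R]_d) : Prop :=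
  bounded_away (@embed R d @^-1` B).

(* A measure on the Borel sets of the punctured space is encoded as a Borel
   measure on \bar R^d that does not charge the origin. *)
Definition radon (R : realType) (d : nat)
    (mu : {measure set (Borel 'rV[\bar R]_d) -> \bar R}) : Prop :=
  mu [set embed 0] = 0%E /\
  forall B : set (Borel 'rV[\bar R]_d),
    measurable B -> relatively_compact B -> (mu B < +oo)%E.

(* In the next definition, B is bounded away from the origin, so its boundary
   is the same in \bar R^d and in the punctured space. *)
Definition vague_cvg (R : realType) (d : nat)
    (mun : nat -> set (Borel 'rV[\bar R]_d) -> \bar R)
    (mu : {measure set (Borel 'rV[\bar R]_d) -> \bar R}) : Prop :=
  forall B : set (Borel 'rV[\bar R]_d),
    measurable B -> relatively_compact B ->
    mu (boundary (B : set 'rV[\bar R]_d)) = 0%E ->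
    mun n B @[n --> \oo] --> mu B.

Definition regularly_varying (R : realType) (d : nat)
    (dT : measure_display) (T : measurableType dT) (P : probability T R)
    (X : {RV P >-> Borel 'rV[R]_d}) (alpha : R)
    (mu : {measure set (Borel 'rV[\bar R]_d) -> \bar R}) : Prop :=
  [/\ radon mu,
      mu [set: Borel 'rV[\bar R]_d] != 0%E,
      mu (~` range (@embed R d)) = 0%E,
      exists a : nat -> R,
        [/\ (forall n, 0 < a n),
            {homo a : m n / (m <= n)%N >-> m <= n},
            a n @[n --> \oo] --> +oo,
            (n%:R%:E * P [set w | (a n < enorm (X w))%R])%E @[n --> \oo] --> 1%E
          & vague_cvg
              (fun n B => (n%:R%:E * P [set w | B (embed ((a n)^-1 *: X w))])%E)
              mu]
    & forall (u : R) (B : set (Borel 'rV[\bar R]_d)),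
        0 < u -> measurable B ->
        mu (@escale R d u @` B) = ((u `^ (- alpha))%:E * mu B)%E].

Definition independent_family (R : realType) (dT dE : measure_display)
    (T : measurableType dT) (E : measurableType dE) (P : probability T R)
    (Z : nat -> {RV P >-> E}) : Prop :=
  forall (s : seq nat) (B : nat -> set E),
    uniq s -> (forall i, measurable (B i)) ->
    P (\bigcap_(i in [set` s]) (Z i @^-1` B i))
      = (\prod_(i <- s) P (Z i @^-1` B i))%E.

Definition identically_distributed (R : realType) (dT dE : measure_display)
    (T : measurableType dT) (E : measurableType dE) (P : probability T R)
    (Z : nat -> {RV P >-> E}) : Prop :=
  forall (i j : nat) (B : set E),
    measurable B -> P (Z i @^-1` B) = P (Z j @^-1` B).

Definition iid (R : realType) (dT dE : measure_display)
    (T : measurableType dT) (E : measurableType dE) (P : probability T R)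
    (Z : nat -> {RV P >-> E}) : Prop :=
  independent_family Z /\ identically_distributed Z.

(* The sequence Z_0, Z_1, Z_2, ... stands for Z, Z_1, Z_2, ...: the generic
   copy Z_0 does not enter the random walk. *)
Definition walk (R : realType) (d : nat)
    (dT : measure_display) (T : measurableType dT) (P : probability T R)
    (Z : nat -> {RV P >-> Borel 'rV[R]_d}) (n : nat) (w : T) : 'rV[R]_d :=
  \sum_(1 <= i < n.+1) (Z i w : 'rV[R]_d).

Definition psi (R : realType) (d : nat)
    (dT : measure_display) (T : measurableType dT) (P : probability T R)
    (Z : nat -> {RV P >-> Borel 'rV[R]_d}) (c : 'rV[R]_d)
    (A : set 'rV[R]_d) (u : R) : \bar R :=
  P [set w | exists2 n : nat, (1 <= n)%N &
       [set u *: x | x in A] (walk Z n w - n%:R *: c)].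

Definition Kcone (R : realType) (d : nat) (c : 'rV[R]_d) (delta : R)
    : set 'rV[R]_d :=
  [set x | x != 0 /\
     enorm ((enorm x)^-1 *: x + (enorm c)^-1 *: c) < delta].

Definition ray_sum (R : realType) (d : nat) (c : 'rV[R]_d) (B : set 'rV[R]_d)
    : set 'rV[R]_d :=
  [set y | exists x t, [/\ B x, 0 <= t & y = x + t *: c]].

(* The shifted sets need not be Borel, only universally measurable:
   completed_measure_extension mu is the outer measure of mu, whose restriction
   to the Caratheodory-measurable sets is the completion of the (sigma-finite)
   measure mu. *)
Definition mustar (R : realType) (d : nat)
    (mu : {measure set (Borel 'rV[\bar R]_d) -> \bar R}) (c : 'rV[R]_d)
    (B : set 'rV[R]_d) : \bar R :=
  (\int[lebesgue_measure]_(v in `[0%R, +oo[)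
     @completed_measure_extension _ _ _ mu
       (@embed R d @` [set ((v : R) *: c + y)%R | y in ray_sum c B]))%E.

(* Main.v *)
(* Write V(u) = P(|Z| > u) and D = A + c [0, oo).  Since A avoids the cone
   around -c, there is kap > 0 with |x + t c| >= kap (|x| + t) for x in A and
   t >= 0: the walk has to travel a distance of order max(u, n) to hit the
   target at time n, and D is closed when A is.

   Steps truncated at th u, with th small, cannot do this: by Chernoff's bound
   their sums exceed kap u with probability o(V(u) / u).  Hence, up to
   o(u V(u)), the target is hit because of one step Z_k of order u, all other
   steps contributing o(u) at time n, and hitting at some n >= k then means that
   Z_k / u lies in (k / u) c + D.  Times n > M u contribute O(u V(u)) times a
   factor vanishing with M, by summation over dyadic blocks.  Grouping the k's
   in blocks of length u h, the sum of P(Z_k in u ((k / u) c + D)) is compared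
   with u V(u) times a Riemann sum of the monotone function
   v |-> mu(c v + D), whose integral is mu^*. *)

Require Import Defs.
From HB Require Import structures.
From mathcomp Require Import all_boot all_order all_algebra.
From mathcomp Require Import all_classical all_reals all_analysis.
From mathcomp Require Import measurable_realfun ring lra.
From mathcomp Require finmap.

Set Implicit Arguments.
Unset Strict Implicit.
Unset Printing Implicit Defensive.

Import Order.TTheory GRing.Theory Num.Theory.
Import numFieldNormedType.Exports.

Local Open Scope classical_set_scope.
Local Open Scope ring_scope.

(** * Borel sets of the extended space *)

(** Vague convergence speaks only of the scales [a n] and of sets with null boundary, while the
    estimates need arbitrary closed and open targets at every large u. One device bridges both gaps:
    a closed set is surrounded by sublevel sets of the continuous function [reldist], all but
    countably many of which have null boundary, and their margin absorbs both the ratio of u to a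
    nearby [a n] and the displacement caused by the small steps. Only upper bounds for closed sets
    are proved this way; lower bounds for open sets follow by complementation.

    The number of candidate steps is of order u, so an error of o(1) for each would be useless: it
    has to be small relative to the probability of the jump itself. This is why the deviation
    estimates carry an event on a further step [Z k], whose probability factors out by independence.

    The order of choices matters: the length and number of the blocks, then margins common to these
    finitely many blocks, then the truncation level, and u last. *)

Section borel.
Context {T : ptopologicalType}.
Lemma open_borel (U : set T) : open U -> measurable (U : set (Borel T)).
Proof. by move=> oU; exact: sub_sigma_algebra. Qed.

Lemma closed_borel (U : set T) : closed U -> measurable (U : set (Borel T)).
Proof.
move=> cU; rewrite -(setCK U); apply: measurableC.
by apply: open_borel; rewrite openC.
Qed.
End borel.

Section embed.
Context {R : realType} {d : nat}.
Implicit Types (B : set 'rV[R]_d).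
Local Notation E := (@embed R d).

Lemma embed_inj : injective E.
Proof.
move=> x y /rowP xy; apply/rowP => i.
by have := xy i; rewrite !mxE => -[].
Qed.

Lemma open_embed B : open B -> open (E @` B).
Proof.
move=> oB; rewrite openE => _ [x Bx <-].
have /nbhs_ballP[e /= e0 xeB] : nbhs x B by exact: open_nbhs_nbhs.
(* A neighbourhood of a matrix contains a product of neighbourhoods of its entries; these factors
   consist of finite points only, so every point of the product lifts to a real row. *)
exists (fun i j => EFin @` (ball (x i j) e)).
  move=> i j; rewrite mxE.
  have oe : open (EFin @` ball (x i j) e).
    rewrite openE => _ [r re <-]; rewrite /interior /=.
    have : nbhs r (ball (x i j) e).
      by apply: open_nbhs_nbhs; split => //; exact: ball_open.
    by apply: filterS => s se; exists s.
  apply: open_nbhs_nbhs; split => //.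
  by exists (x i j) => //; exact: ballxx.
move=> y /= ye.
have /choice[f fP] : forall i, exists r, ball (x ord0 i) e r /\ r%:E = y ord0 i.
  by move=> i; have [r re ry] := ye ord0 i; exists r.
exists (\row_i f i).
  apply: xeB; split => // i j; rewrite mxE.
  by rewrite (ord1 i); exact: (fP j).1.
by apply/rowP => i; rewrite !mxE; have [] := fP i.
Qed.

(** The sets with Borel image form a sigma-algebra: [E] is injective and its range is open, which
    handles complements. *)
Lemma measurable_embed B : measurable (B : set (Borel 'rV[R]_d)) ->
  measurable (E @` B : set (Borel 'rV[\bar R]_d)).
Proof.
have mE : measurable (range E : set (Borel 'rV[\bar R]_d)).
  by apply: open_borel; apply: open_embed; exact: openT.
move=> mB.
pose G := [set C : set 'rV[R]_d |
  measurable (E @` C : set (Borel 'rV[\bar R]_d))].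
have sG : sigma_algebra setT G.
  split.
  - by rewrite /G /= image_set0.
  - move=> C GC; rewrite /G /=.
    have -> : E @` (setT `\` C) = range E `\` E @` C.
      apply/seteqP; split => [_ [x [_ nCx] <-]|_ [[x _ <-] nC]].
        by split; [exists x|move=> [y Cy /embed_inj yx]; apply: nCx;
          rewrite -yx].
      by exists x => //; split => // Cx; apply: nC; exists x.
    exact: measurableD.
  - move=> F GF; rewrite /G /= image_bigcup.
    exact: bigcupT_measurable.
have : <<s @open 'rV[R]_d >> `<=` G.
  apply: smallest_sub => // U oU; apply: open_borel; exact: open_embed.
by apply; exact: mB.
Qed.

(** An unbounded set may acquire boundary points at infinity; the limit measure does not charge
    them. *)
Lemma boundary_embed B :
  boundary (E @` B) `<=` E @` (boundary B) `|` ~` range E.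
Proof.
move=> y [cy ny].
have [[x _ xy]|] := pselect (range E y); last by right.
left; exists x => //; split.
  apply: contrapT => ncx.
  have := cy (E @` (~` closure B)); case.
    apply: open_nbhs_nbhs; split.
      by apply: open_embed; rewrite openC; exact: closed_closure.
    by exists x.
  move=> _ [[z Bz <-] [t ct /embed_inj tz]]; apply: ct; rewrite tz.
  exact: subset_closure.
move=> ix; apply: ny; rewrite /interior -xy.
suff : nbhs (E x) (E @` (B°)).
  apply: filterS; apply: image_subset; exact: interior_subset.
apply: open_nbhs_nbhs; split; last by exists x.
by apply: open_embed; exact: open_interior.
Qed.

Lemma preimage_embed_image B : E @^-1` (E @` B) = B.
Proof.
apply/seteqP; split => [x [y By /embed_inj <-]//|x Bx].
by exists x.
Qed.

Lemma escale_embed (u : R) B :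
  @escale R d u @` (E @` B) = E @` [set u *: x | x in B].
Proof.
apply/seteqP; split => [_ [_ [x Bx <-] <-]|_ [_ [x Bx <-] <-]].
  by exists (u *: x); [exists x|apply/rowP => i; rewrite !mxE -EFinM].
exists (E x); first by exists x.
by apply/rowP => i; rewrite !mxE -EFinM.
Qed.

End embed.

Section borel_rV.
Context {R : realType} {d : nat}.

Lemma measurable_coord (i : 'I_d) :
  measurable_fun setT (fun x : Borel 'rV[R]_d => (x : 'rV[R]_d) ord0 i).
Proof.
apply: (measurability _ (RGenOpens.measurableE R)) => _ [_ [a [b ->]] <-];
  rewrite setTI; apply: open_borel.
by apply: open_comp => [x _|]; [exact: coord_continuous|exact: interval_open].
Qed.

Lemma continuous_borel (f : 'rV[R]_d -> R) : continuous f ->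
  measurable_fun setT (f : Borel 'rV[R]_d -> R).
Proof.
move=> cf; apply: (measurability _ (RGenOpens.measurableE R)) =>
  _ [_ [a [b ->]] <-]; rewrite setTI; apply: open_borel.
by apply: open_comp => [x _|]; [exact: cf|exact: interval_open].
Qed.

(** An open set is a countable union of sup-norm balls with rational centre and radius 1/(n+1), and
    such a ball is a box, so coordinates decide measurability. *)
Lemma measurable_fun_rV dT (T : measurableType dT) (f : T -> 'rV[R]_d) :
  (forall i, measurable_fun setT (fun w => f w ord0 i)) ->
  measurable_fun setT (f : T -> Borel 'rV[R]_d).
Proof.
move=> mf; apply: (@measurability _ _ T (Borel 'rV[R]_d) setT f
  (@open 'rV[R]_d)) => //.
move=> _ [U oU <-]; rewrite setTI.
pose D := ('rV[rat]_d * nat)%type.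
pose q (k : D) : 'rV[R]_d := map_mx ratr k.1.
pose bx (k : D) := ball (q k) (k.2.+1%:R^-1).
(* Balls that leave [U] are replaced by the empty set, which keeps the countable index type [D]. *)
pose F (k : D) := if pselect (bx k `<=` U) then f @^-1` bx k else set0.
have -> : f @^-1` U = \bigcup_k F k.
  apply/seteqP; split => [w Uw|w [k _]]; last first.
    by rewrite /F; case: pselect => // kU; exact: kU.
  have /nbhs_ballP[e /= e0 feU] : nbhs (f w) U by exact: open_nbhs_nbhs.
  have [n ne] : exists n : nat, n.+1%:R^-1 < e / 2.
    have [n] := ltr_add_invr (y := 0) (x := e / 2) ltac:(by rewrite divr_gt0).
    by rewrite add0r => ?; exists n.
  have n0 : 0 < n.+1%:R^-1 :> R by rewrite invr_gt0.
  have /choice[g gP] : forall i, exists r : rat,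
      ball (f w ord0 i) n.+1%:R^-1 (ratr r : R).
    move=> i; have [] := @dense_rat R (ball (f w ord0 i) n.+1%:R^-1).
      by exists (f w ord0 i); exact: ballxx.
      exact: ball_open.
    by move=> x [xb [r _ rx]]; exists r; rewrite rx.
  pose k : D := (\row_i g i, n).
  have kw : ball (q k) (n.+1%:R^-1) (f w).
    split => // i j; rewrite /q/= !mxE ord1; apply: ball_sym; exact: gP.
  have kU : bx k `<=` U.
    move=> y ky; apply: feU; rewrite (splitr e).
    apply: ball_triangle; last exact: (le_ball (ltW ne) ky).
    by apply/ball_sym/(le_ball (ltW ne)).
  by exists k => //; rewrite /F; case: pselect.
apply: countable_bigcupT_measurable => [|k]; first exact: countableP.
rewrite /F; case: (pselect _) => [Hk|Hk]; last exact: measurable0.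
have -> : f @^-1` bx k =
    \bigcap_(i in [set: 'I_d]) (fun w =>
      f w ord0 i) @^-1` ball (q k ord0 i) k.2.+1%:R^-1.
  apply/seteqP; split => [w [_ wk] i _|w wk]; first exact: wk.
  by split => // i j; rewrite ord1; exact: wk.
apply: fin_bigcap_measurable => // i _.
rewrite -[X in measurable X]setTI; apply: mf => //.
exact: measurable_ball.
Qed.

End borel_rV.

(** * Null level sets *)

Lemma le_mu {d} {X : measurableType d} {R : realType}
    (mu : {measure set X -> \bar R}) (A B : set X) :
  measurable A -> measurable B -> A `<=` B -> (mu A <= mu B)%E.
Proof. by move=> mA mB; apply: le_measure; exact/mem_set. Qed.

Lemma muU2 {d} {X : measurableType d} {R : realType}
    (mu : {measure set X -> \bar R}) (A B : set X) :
  measurable A -> measurable B -> (mu (A `|` B) <= mu A + mu B)%E.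
Proof. exact: measureU2. Qed.

(** Within a set of finite mass only finitely many disjoint sets have mass above 1/(n+1), so only
    countably many levels are charged. *)
Lemma disjoint_null_level {R : realType} {dX} {X : measurableType dX}
    (mu : {measure set X -> \bar R}) (F : R -> set X) (D : set X) (a b : R) :
  a < b -> measurable D -> (mu D < +oo)%E ->
  (forall e, measurable (F e)) -> (forall e, a < e < b -> F e `<=` D) ->
  trivIset setT F ->
  exists2 e, a < e < b & mu (F e) = 0%E.
Proof.
move=> ab mD Doo mF FD tF.
pose S n := [set e | a < e < b /\ (n.+1%:R^-1%:E < mu (F e))%E].
have finS n : finite_set (S n).
  apply: contrapT => infS.
  pose t := fine (mu D).
  have t0 : 0 <= t by exact: fine_ge0.
  have muD : mu D = t%:E by rewrite fineK// ge0_fin_numE.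
  (* N disjoint sets of mass above 1/(n+1) outweigh [D]. *)
  pose N := (Num.trunc (t * n.+1%:R)).+1.
  have [B BS NB] := infinite_set_fset N infS.
  pose s := finmap.enum_fset B.
  have sS e : e \in s -> S n e by exact: BS.
  have us : uniq s by exact: finmap.fset_uniq.
  have ts : trivIset [set` s] F by apply: sub_trivIset tF.
  have := measure_fin_bigcup mu (finite_seq s) ts (fun e _ => mF e).
  have le1 : (mu (\bigcup_(i in [set` s]) F i) <= t%:E)%E.
    rewrite -muD; apply: le_mu => //; first exact: fin_bigcup_measurable.
    by apply: bigcup_sub => e es; apply: FD; have [] := sS e es.
  have le2 : ((N%:R * n.+1%:R^-1)%:E <= \sum_(i \in [set` s]) mu (F i))%E.
    rewrite -fsbig_seq//.
    apply: (@le_trans _ _ (\sum_(i <- s) n.+1%:R^-1%:E)%E).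
      rewrite sumEFin lee_fin big_const_seq count_predT iter_addr addr0.
      by rewrite mulr_natl ler_wpMn2l ?invr_ge0.
    rewrite big_seq [leRHS]big_seq; apply: lee_sum => e es.
    by have [_ /ltW] := sS _ es.
  move=> eqB; move: le1; rewrite eqB => /(le_trans le2).
  rewrite lee_fin ler_pdivrMr// leNgt => /negP; apply.
  by rewrite /N; exact: truncnS_gt.
have cS : countable (\bigcup_n S n).
  by apply: bigcup_countable => // n _; exact: finite_set_countable.
apply: contrapT => nex.
(* Without a null level the whole interval would be countable, hence Lebesgue null. *)
have abS : `]a, b[%classic `<=` \bigcup_n S n.
  move=> e; rewrite /= in_itv/= => eab.
  have Fe0 : (0 < mu (F e))%E.
    rewrite lt_neqAle measure_ge0 andbT; apply/negP => /eqP Fe0.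
    by apply: nex; exists e.
  have Feoo : (mu (F e) < +oo)%E.
    by apply: le_lt_trans Doo; apply: le_mu => //; exact: FD.
  have muF : mu (F e) = (fine (mu (F e)))%:E by rewrite fineK// ge0_fin_numE.
  have [n] := ltr_add_invr (y := 0) (x := fine (mu (F e))) ltac:(by
    rewrite -lte_fin -muF).
  by rewrite add0r => nF; exists n => //; split => //; rewrite muF lte_fin.
have := countable_lebesgue_measure0 (sub_countable (subset_card_le abS) cS).
rewrite lebesgue_measure_itv/= lte_fin ab => /eqP.
by rewrite -EFinB eqe subr_eq0 gt_eqF.
Qed.

(** * Norms and distances *)

Section enorm.
Context {R : realType} {d : nat}.
Implicit Types x y : 'rV[R]_d.

Lemma norm_coord x i : `|x ord0 i| <= `|x|.
Proof.
by rewrite [leRHS]/Num.norm/= mx_normrE; apply/bigmax_geP; right => /=;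
  exists (ord0, i).
Qed.

Lemma norm_rV_le x (b : R) : 0 <= b -> (forall i, `|x ord0 i| <= b) -> `|x| <=
  b.
Proof.
move=> b0 xb; rewrite [leLHS]/Num.norm/= mx_normrE; apply/bigmax_leP; split =>
  // -[i j] _ /=.
by rewrite (ord1 i).
Qed.

Lemma norm_le_enorm x : `|x| <= enorm x.
Proof.
apply: norm_rV_le => [|i]; first exact: sqrtr_ge0.
rewrite -sqrtr_sqr ler_wsqrtr// (bigD1 i)//= lerDl sumr_ge0// => j _.
exact: sqr_ge0.
Qed.

Lemma enorm_le_norm x : enorm x <= Num.sqrt d%:R * `|x|.
Proof.
rewrite -[X in _ * X]normr_id -sqrtr_sqr -sqrtrM// ler_wsqrtr// mulr_natl.
rewrite -[X in _ *+ X]card_ord -sumr_const ler_sum// => i _.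
by rewrite -real_normK ?num_real// lerXn2r ?nnegrE// norm_coord.
Qed.

Lemma enormZ (a : R) x : enorm (a *: x) = `|a| * enorm x.
Proof.
rewrite /enorm -sqrtr_sqr -sqrtrM ?sqr_ge0// mulr_sumr.
by congr Num.sqrt; apply: eq_bigr => i _; rewrite mxE exprMn.
Qed.

Lemma enorm_ge0 x : 0 <= enorm x. Proof. exact: sqrtr_ge0. Qed.

Lemma enorm0 : enorm (0 : 'rV[R]_d) = 0.
Proof. by rewrite -(scale0r 0) enormZ normr0 mul0r. Qed.

Lemma enorm_gt0 x : x != 0 -> 0 < enorm x.
Proof. by rewrite -normr_gt0 => /lt_le_trans; apply; exact: norm_le_enorm. Qed.

Lemma continuous_enorm : continuous (@enorm R d).
Proof.
have cs (x : 'rV[R]_d) :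
    \sum_(i < d) y ord0 i ^+ 2 @[y --> x] --> \sum_(i < d) x ord0 i ^+ 2.
  elim: (index_enum _) => [|i s IH].
    by rewrite big_nil; under eq_fun do rewrite big_nil; exact: cvg_cst.
  rewrite big_cons; under eq_fun do rewrite big_cons.
  apply: cvgD => //; rewrite expr2; under eq_fun do rewrite expr2.
  by apply: cvgM; exact: coord_continuous.
by move=> x; apply: continuous_comp; [exact: cs|exact: sqrt_continuous].
Qed.

End enorm.

Section sublevel.
Context {R : realType} {T : topologicalType} (phi : T -> R).

Lemma open_sublevel e : continuous phi -> open [set x | phi x < e].
Proof. by move=> /continuousP/(_ _ (@open_lt R e)). Qed.

Lemma closed_sublevel e : continuous phi -> closed [set x | phi x <= e].
Proof.
by move=> cphi; apply: (@preimage_closed _ _ phi [set y | y <= e]);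
  [move=> x _; exact: cphi|exact: closed_le].
Qed.

Lemma closed_level e : continuous phi -> closed [set x | phi x = e].
Proof.
by move=> cphi; apply: (@preimage_closed _ _ phi [set y | y = e]);
  [move=> x _; exact: cphi|exact: closed_eq].
Qed.

Lemma boundary_sublevel e : continuous phi ->
  boundary [set x | phi x < e] `<=` [set x | phi x = e].
Proof.
move=> cphi x [cx ix]; apply/eqP; rewrite eq_le; apply/andP; split.
  have : closure [set x | phi x <= e] x.
    by move: cx; apply: closure_subset => y /= /ltW.
  by rewrite -(closure_id _).1//; exact: closed_sublevel.
rewrite leNgt; apply/negP => xe; apply: ix.
by apply: open_nbhs_nbhs; split => //; exact: open_sublevel.
Qed.

Lemma sublevel_away e x0 : continuous phi -> e < phi x0 ->
  ~ closure [set x | phi x <= e] x0.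
Proof.
move=> cphi e0; rewrite -(closure_id _).1; last exact: closed_sublevel.
by rewrite /= leNgt e0.
Qed.

End sublevel.

Section pseudo_distance.
Context {R : realType} {V : normedModType R}.
Implicit Types (B : set V) (x y : V).

(* Distance from B measured relatively to 1 + |y|: its sublevel sets absorb
   both small translations and dilations close to 1, for unbounded B too. *)
Definition reldist B x : R := inf [set `|x - y| / (1 + `|y|) | y in B].

Let lbd B x : lbound [set `|x - y| / (1 + `|y|) | y in B] 0.
Proof. by move=> _ [y _ <-]; rewrite divr_ge0// addr_ge0. Qed.

Lemma reldist_le B x y : B y -> reldist B x <= `|x - y| / (1 + `|y|).
Proof. by move=> By; apply: ge_inf; [exists 0; exact: lbd|exists y]. Qed.

Lemma reldist_ge B x (b : R) : B !=set0 ->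
  (forall y, B y -> b * (1 + `|y|) <= `|x - y|) -> b <= reldist B x.
Proof.
move=> [y0 By0] bB; apply: lb_le_inf; first by exists (`|x - y0| / (1 + `|y0|)),
  y0.
by move=> _ [y By <-]; rewrite ler_pdivlMr ?bB// ltr_pwDl.
Qed.

Lemma reldist_lip B x y : B !=set0 -> reldist B x <= reldist B y + `|x - y|.
Proof.
move=> B0; rewrite -lerBlDr; apply: reldist_ge => // z Bz.
rewrite mulrBl lerBlDr.
have p0 : 0 < 1 + `|z| by rewrite ltr_pwDl.
have := reldist_le x Bz; rewrite ler_pdivlMr// => /le_trans; apply.
apply: (@le_trans _ _ (`|y - z| + `|x - y|)).
  by rewrite [leRHS]addrC ler_distD.
by rewrite lerD2l ler_peMr// lerDl.
Qed.

Lemma reldist_continuous B : B !=set0 -> continuous (reldist B).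
Proof.
move=> B0 x; apply/cvgrPdist_lt => e e0; near=> y.
apply: (@le_lt_trans _ _ `|x - y|).
  rewrite ler_norml; apply/andP; split.
    by rewrite lerBrDl lerBlDr distrC reldist_lip.
  by rewrite lerBlDl reldist_lip.
by near: y; exact: cvgr_dist_lt.
Unshelve. all: by end_near. Qed.

Lemma reldist_gt0 B x : B !=set0 -> closed B -> ~ B x -> 0 < reldist B x.
Proof.
move=> B0 cB nBx.
have /nbhs_ballP[r /= r0 rB] : nbhs x (~` B).
  by apply: open_nbhs_nbhs; split => //; exact: closed_openC.
have p0 : 0 < 1 + `|x| + r by rewrite ltr_wpDl// addr_ge0.
(* The quotient is at least q / (1 + |x| + q) with q = |x - y|, which increases in q, and q is at
   least r. Points y far away are thus covered too. *)
apply: (@lt_le_trans _ _ (r / (1 + `|x| + r))); first exact: divr_gt0.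
apply: reldist_ge => // y By; rewrite mulrAC ler_pdivrMr//.
have rxy : r <= `|x - y|.
  by rewrite leNgt; apply/negP => xy; apply: (rB y) By; rewrite -ball_normE.
have yx : `|y| <= `|x| + `|x - y|.
  by rewrite -lerBlDl (le_trans (lerB_dist _ _))// distrC.
apply: (@le_trans _ _ (r * (1 + (`|x| + `|x - y|)))).
  by rewrite ler_wpM2l ?(ltW r0)// lerD2l.
have := normr_ge0 x; move: `|x| `|x - y| rxy => p q rq p0'.
by nra.
Qed.

End pseudo_distance.

(** * Convergence along the norming sequence *)

Section real_probability.
Context {R : realType} {dT} {T : measurableType dT} (P : probability T R).
Implicit Types A B : set T.

Definition pr A : R := fine (P A).

Lemma prE A : measurable A -> P A = (pr A)%:E.
Proof. by move=> mA; rewrite fineK// fin_num_measure. Qed.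

Lemma pr_ge0 A : 0 <= pr A.
Proof. exact: fine_ge0. Qed.

Lemma pr0 : pr set0 = 0.
Proof. by rewrite /pr measure0. Qed.

Lemma prT : pr setT = 1.
Proof. by rewrite /pr probability_setT. Qed.

Lemma le_pr A B : measurable A -> measurable B -> A `<=` B -> pr A <= pr B.
Proof. by move=> mA mB AB; rewrite -lee_fin -!prE//; exact: le_mu. Qed.

Lemma prU_le A B : measurable A -> measurable B -> pr (A `|` B) <= pr A + pr B.
Proof.
move=> mA mB; rewrite -lee_fin EFinD -!prE//; last exact: measurableU.
exact: measureU2.
Qed.

Lemma prD A B : measurable A -> measurable B -> pr (A `\` B) =
  pr A - pr (A `&` B).
Proof.
move=> mA mB; rewrite /pr measureD ?fineB ?fin_num_measure//.
- exact: measurableI.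
- by rewrite (le_lt_trans (probability_le1 _ mA)) ?ltry.
Qed.

Let ex_nil (I : eqType) (F : I -> set T) :
  [set w | exists2 i, i \in [::] & F i w] = set0.
Proof. by apply/seteqP; split => // w []. Qed.

Let ex_cons (I : eqType) (i : I) (s : seq I) (F : I -> set T) :
  [set w | exists2 j, j \in i :: s & F j w] =
  F i `|` [set w | exists2 j, j \in s & F j w].
Proof.
apply/seteqP; split => w.
  by move=> [j]; rewrite inE => /orP[/eqP->|js] Fj; [left|right; exists j].
move=> [Fi|[j js Fj]]; first by exists i; rewrite // mem_head.
by exists j => //; rewrite inE js orbT.
Qed.

Lemma measurable_ex_seq (I : eqType) (s : seq I) (F : I -> set T) :
  (forall i, measurable (F i)) -> measurable [set w | exists2 i,
    i \in s & F i w].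
Proof.
by move=> mF; elim: s => [|i s IH]; rewrite ?ex_nil// ex_cons;
  exact: measurableU.
Qed.

Lemma pr_bigcup_le (I : eqType) (s : seq I) (F : I -> set T) :
  (forall i, measurable (F i)) ->
  pr [set w | exists2 i, i \in s & F i w] <= \sum_(i <- s) pr (F i).
Proof.
move=> mF; elim: s => [|i s IH]; first by rewrite ex_nil big_nil pr0.
rewrite ex_cons big_cons (le_trans (prU_le _ _))// ?lerD2l//.
exact: measurable_ex_seq.
Qed.

End real_probability.

(** * Scaled laws, tails and the limit measure *)

Section regular_variation.
Context {R : realType} {d : nat} {dT} {T : measurableType dT}
  {P : probability T R} (X : {RV P >-> Borel 'rV[R]_d})
  (mu : {measure set (Borel 'rV[\bar R]_d) -> \bar R}).
Local Notation E := (@embed R d).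
Local Notation BX := (Borel 'rV[R]_d).

Lemma measurable_scaled (a : R) (c : 'rV[R]_d) (Y : T -> 'rV[R]_d) :
  measurable_fun setT (Y : T -> BX) ->
  measurable_fun setT (fun w => a *: Y w + c : BX).
Proof.
move=> mY; apply: measurable_fun_rV => i.
under eq_fun do rewrite mxE mxE.
apply: measurable_funD => //; apply: measurable_funM => //.
by apply: (measurableT_comp (measurable_coord i)).
Qed.

Lemma measurable_event (Y : T -> 'rV[R]_d) (B : set 'rV[R]_d) :
  measurable_fun setT (Y : T -> BX) -> measurable (B : set BX) ->
  measurable [set w | B (Y w)].
Proof. by move=> mY mB; rewrite -[X in measurable X]setTI; exact: mY. Qed.

Lemma measurable_scaled_event (u : R) (B : set 'rV[R]_d) :
  measurable (B : set BX) -> measurable [set w | B (u^-1 *: (X w : 'rV[R]_d))].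
Proof.
move=> mB; apply: measurable_event mB.
under eq_fun do rewrite -[_ *: _]addr0.
by apply: measurable_scaled.
Qed.

Lemma open_enorm_gt u : open [set x : 'rV[R]_d | u < enorm x].
Proof.
have /continuousP := @continuous_enorm R d.
by move/(_ _ (@open_gt R u)).
Qed.

Lemma closed_enorm_ge u : closed [set x : 'rV[R]_d | u <= enorm x].
Proof.
by apply: (@preimage_closed _ _ (@enorm R d) [set y | u <= y]);
  [move=> x _; exact: continuous_enorm|exact: closed_ge].
Qed.

Definition scaled_prob (u : R) (B : set 'rV[R]_d) : R :=
  pr P [set w | B (u^-1 *: (X w : 'rV[R]_d))].

Definition tail (u : R) : R := pr P [set w | u < enorm (X w)].

Definition limit_mass (B : set 'rV[R]_d) : R := fine (mu (E @` B)).

Lemma tailE u s : 0 < u -> scaled_prob u [set x | s < enorm x] = tail (s * u).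
Proof.
move=> u0; congr pr; apply/seteqP; split => w /=;
by rewrite enormZ gtr0_norm ?invr_gt0// [_^-1 * _]mulrC ltr_pdivlMr.
Qed.

Lemma measurable_tail u : measurable [set w | u < enorm (X w)].
Proof.
apply: (@measurable_event X [set x | u < enorm x]) => //.
by apply: open_borel; exact: open_enorm_gt.
Qed.

Lemma tail_ge0 u : 0 <= tail u. Proof. exact: pr_ge0. Qed.

Lemma tail_le u v : u <= v -> tail v <= tail u.
Proof.
by move=> uv; apply: le_pr; try exact: measurable_tail; move=> w;
  exact: le_lt_trans.
Qed.

Lemma le_scaled_prob u A B : measurable (A : set BX) ->
  measurable (B : set BX) ->
  A `<=` B -> scaled_prob u A <= scaled_prob u B.
Proof.
by move=> mA mB AB; apply: le_pr; try exact: measurable_scaled_event;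
  move=> w /AB.
Qed.

End regular_variation.

Lemma near_pinfty_gt {R : realType} (M : R) : \forall u \near +oo, M < u.
Proof. by apply: nbhs_pinfty_gt; exact: num_real. Qed.

Section limit_measure.
Context {R : realType} {d : nat} {dT} {T : measurableType dT}
  {P : probability T R} {X : {RV P >-> Borel 'rV[R]_d}} {alpha : R}
  {mu : {measure set (Borel 'rV[\bar R]_d) -> \bar R}}.
Hypothesis XRV : regularly_varying X alpha mu.
Local Notation E := (@embed R d).
Local Notation BX := (Borel 'rV[R]_d).
Local Notation q := (scaled_prob X).
Local Notation V := (tail X).
Local Notation nu := (limit_mass mu).

Lemma mu_fin (B : set 'rV[R]_d) : measurable (B : set BX) -> bounded_away B ->
  (mu (E @` B) < +oo)%E.
Proof.
have [[mu0 muoo] _ _ _ _] := XRV => mB aB; apply: muoo;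
  first exact: measurable_embed.
by rewrite /relatively_compact preimage_embed_image.
Qed.

Lemma nuE (B : set 'rV[R]_d) : measurable (B : set BX) -> bounded_away B ->
  mu (E @` B) = (nu B)%:E.
Proof. by move=> mB aB; rewrite fineK// ge0_fin_numE// mu_fin. Qed.

Lemma nu_ge0 B : 0 <= nu B. Proof. exact: fine_ge0. Qed.

Lemma bounded_away_sub (A B : set 'rV[R]_d) : A `<=` B -> bounded_away B ->
  bounded_away A.
Proof. by move=> AB aB cA; apply: aB; exact: closure_subset cA. Qed.

Lemma le_nu (A B : set 'rV[R]_d) : measurable (A : set BX) ->
  measurable (B : set BX) ->
  bounded_away B -> A `<=` B -> nu A <= nu B.
Proof.
move=> mA mB aB AB; have aA := bounded_away_sub AB aB.
rewrite -lee_fin -!nuE//; apply: le_mu; try exact: measurable_embed.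
exact: image_subset.
Qed.

Lemma nuD (A B : set 'rV[R]_d) : measurable (A : set BX) ->
  measurable (B : set BX) ->
  bounded_away B -> A `<=` B -> nu (B `\` A) = nu B - nu A.
Proof.
move=> mA mB aB AB; have aA := bounded_away_sub AB aB.
have E_inj : E @` (B `\` A) = E @` B `\` E @` A.
  apply/seteqP; split => [_ [x [Bx nAx] <-]|_ [[x Bx <-] nA]].
    by split; [exists x|move=> [y Ay /embed_inj yx]; apply: nAx; rewrite -yx].
  by exists x => //; split => // Ax; apply: nA; exists x.
have AEB : E @` B `&` E @` A = E @` A by apply/setIidr; exact: image_subset.
rewrite {1}/limit_mass E_inj measureD; try exact: measurable_embed;
  last exact: mu_fin.
by rewrite AEB fineB// ge0_fin_numE//; exact: mu_fin.
Qed.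

Lemma mu_homog (u : R) B : 0 < u -> measurable (B : set BX) ->
  mu (E @` [set u *: x | x in B]) = ((u `^ (- alpha))%:E * mu (E @` B))%E.
Proof.
have [_ _ _ _ muZ] := XRV => u0 mB.
by rewrite -escale_embed muZ//; exact: measurable_embed.
Qed.

Lemma mu_boundary_sublevel (phi : 'rV[R]_d -> R) e : continuous phi ->
  mu (E @` [set x | phi x = e]) = 0%E ->
  mu (boundary (E @` [set x | phi x < e] : set 'rV[\bar R]_d)) = 0%E.
Proof.
have [_ _ muE _ _] := XRV => cphi mue.
have mr : measurable (range E : set (Borel 'rV[\bar R]_d)).
  by apply: open_borel; apply: open_embed; exact: openT.
have ml : measurable (E @` [set x | phi x = e] : set (Borel 'rV[\bar R]_d)).
  by apply: measurable_embed; apply: closed_borel;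
    exact: (@closed_level _ _ phi).
apply/eqP; rewrite eq_le measure_ge0 andbT.
apply: (@le_trans _ _ (mu (E @` [set x | phi x = e] `|` ~` range E))).
  apply: le_mu.
  - apply: measurableD; first by apply: closed_borel; exact: closed_closure.
    by apply: open_borel; exact: open_interior.
  - by apply: measurableU => //; exact: measurableC.
  - apply: (subset_trans (@boundary_embed _ _ _)); apply: setSU.
    by apply: image_subset; exact: (@boundary_sublevel _ _ phi).
apply: (le_trans (muU2 _ _ _)) => //; first exact: measurableC.
by rewrite mue muE adde0.
Qed.

(** The condition at 0 keeps the sublevel set away from the origin, hence of finite mass. *)
Lemma null_level (phi : 'rV[R]_d -> R) a b : continuous phi -> a < b ->
  b < phi 0 ->
  exists2 e, a < e < b & mu (E @` [set x | phi x = e]) = 0%E.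
Proof.
move=> cphi ab b0.
have mb : measurable ([set x | phi x <= b] : set BX).
  by apply: closed_borel; exact: (@closed_sublevel _ _ phi).
apply: (@disjoint_null_level _ _ _ mu (fun e => E @` [set x | phi x = e])
  (E @` [set x | phi x <= b])) => //.
- exact: measurable_embed.
- by apply: mu_fin => //; exact: (@sublevel_away _ _ phi).
- by move=> e; apply: measurable_embed; apply: closed_borel;
  exact: (@closed_level _ _ phi).
- by move=> e /andP[_ eb]; apply: image_subset => x /= ->; exact: ltW.
- by move=> e f _ _ [_ [[x /= <- <-] [y /= <- /embed_inj ->]]].
Qed.

(* By homogeneity, the spheres are all null as soon as one of them is. *)
Lemma sphere_null s : 0 < s -> mu (E @` [set x | enorm x = s]) = 0%E.
Proof.
(* [- enorm] rather than [enorm]: the sublevel sets must avoid the origin. *)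
move=> s0; have [] := @null_level (fun x => - enorm x) (-2) (-1).
- by move=> x; apply: continuousN; exact: continuous_enorm.
- by rewrite ltrN2 ltr1n.
- by rewrite enorm0 oppr0 oppr_lt0.
move=> e /andP[_ e1] mue.
have e0 : 0 < - e by rewrite oppr_gt0 (lt_trans e1)// oppr_lt0.
have -> : [set x : 'rV[R]_d | enorm x = s] =
   [set (s / - e) *: x | x in [set x | - enorm x = e]].
  have se : 0 < s / - e by exact: divr_gt0.
  apply/seteqP; split => [x /= xs|_ [x /= xe <-]].
    exists ((s / - e)^-1 *: x); last by rewrite scalerA divff ?gt_eqF// scale1r.
    rewrite /= enormZ gtr0_norm ?invr_gt0//
      xs invfM invrK mulrAC mulVf ?gt_eqF//.
    by rewrite mul1r opprK.
  rewrite /= enormZ gtr0_norm// -[enorm x]opprK xe -mulrA mulVf ?mulr1//.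
  by rewrite gt_eqF.
rewrite mu_homog ?divr_gt0//; first by rewrite mue mule0.
apply: closed_borel; apply: (@closed_level _ _ (fun x => - enorm x)).
by move=> x; apply: continuousN; exact: continuous_enorm.
Qed.

Lemma bounded_away_ge s : 0 < s -> bounded_away [set x : 'rV[R]_d | s <=
  enorm x].
Proof.
move=> s0; rewrite /bounded_away -(closure_id _).1; last exact: closed_enorm_ge.
by rewrite /= enorm0 leNgt s0.
Qed.

Lemma bounded_away_gt s : 0 < s -> bounded_away
  [set x : 'rV[R]_d | s < enorm x].
Proof. by move=> s0; apply: bounded_away_sub (bounded_away_ge s0) => x /=
  /ltW. Qed.

Lemma measurable_gt s : measurable ([set x : 'rV[R]_d | s < enorm x] : set BX).
Proof. by apply: open_borel; exact: open_enorm_gt. Qed.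

Lemma measurable_ge s : measurable ([set x : 'rV[R]_d | s <= enorm x] : set BX).
Proof. by apply: closed_borel; exact: closed_enorm_ge. Qed.

Lemma vague_sublevel (a : nat -> R) (phi : 'rV[R]_d -> R) e :
  vague_cvg (fun n B => (n%:R%:E * P [set w | B (embed ((a n)^-1 *: X w))])%E)
    mu ->
  continuous phi -> e < phi 0 ->
  mu (E @` [set x | phi x = e]) = 0%E ->
  n%:R * q (a n) [set x | phi x < e] @[n --> \oo] --> nu [set x | phi x < e].
Proof.
move=> vague cphi e0 mue.
have mphi : measurable ([set x | phi x < e] : set BX).
  by apply: open_borel; exact: (@open_sublevel _ _ phi).
have aphi : bounded_away [set x | phi x < e].
  by apply: bounded_away_sub (@sublevel_away _ _ phi _ _ cphi e0) => x /= /ltW.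
have := vague (E @` [set x | phi x < e]).
rewrite nuE// => /(_ (measurable_embed mphi)).
rewrite /relatively_compact preimage_embed_image =>
  /(_ aphi (mu_boundary_sublevel cphi mue)).
have -> : (fun n => (n%:R%:E * P [set w | (E @` [set x | (phi x < e)%R])
  (E ((a n)^-1 *: X w))])%E) =
   (fun n => (n%:R * q (a n) [set x | phi x < e])%:E).
  apply/funext => n; rewrite EFinM; congr (_ * _)%E.
  rewrite -prE; last exact: measurable_scaled_event.
  congr (P _); apply/seteqP; split => w /=; first by move=> [x] ? /embed_inj <-.
  by exists ((a n)^-1 *: X w).
by move/fine_cvgP => -[].
Qed.

End limit_measure.

(** * From the norming sequence to all large scales *)

Section scaling.
Context {R : realType} {d : nat} {dT} {T : measurableType dT}
  {P : probability T R} {X : {RV P >-> Borel 'rV[R]_d}} {alpha : R}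
  {mu : {measure set (Borel 'rV[\bar R]_d) -> \bar R}}.
Hypothesis alpha_gt0 : 0 < alpha.
Hypothesis XRV : regularly_varying X alpha mu.
Local Notation E := (@embed R d).
Local Notation BX := (Borel 'rV[R]_d).
Local Notation q := (scaled_prob X).
Local Notation V := (tail X).
Local Notation nu := (limit_mass mu).
Context {a : nat -> R}.
Hypothesis a_gt0 : forall n, 0 < a n.
Hypothesis a_homo : {homo a : m n / (m <= n)%N >-> m <= n}.
Hypothesis a_oo : a n @[n --> \oo] --> +oo.
Hypothesis nVa : n%:R * V (a n) @[n --> \oo] --> (1 : R).
Hypothesis vague : vague_cvg
  (fun n B => (n%:R%:E * P [set w | B (embed ((a n)^-1 *: X w))])%E) mu.

Lemma vague_tail s : 0 < s ->
  n%:R * V (s * a n) @[n --> \oo] --> nu [set x | s < enorm x].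
Proof.
move=> s0; have cN : continuous (fun x : 'rV[R]_d => - enorm x).
  by move=> x; apply: continuousN; exact: continuous_enorm.
have sN : [set x : 'rV[R]_d | - enorm x < - s] = [set x | s < enorm x].
  by apply/seteqP; split => x /=; rewrite ltrN2.
have := @vague_sublevel _ _ _ _ _ _ _ _ XRV a (fun x =>
  - enorm x) (- s) vague cN.
rewrite sN enorm0 oppr0 oppr_lt0 s0 => /(_ isT).
have -> : [set x : 'rV[R]_d | - enorm x = - s] = [set x | enorm x = s].
  by apply/seteqP; split => x /=; [move/oppr_inj|move=> ->].
rewrite (sphere_null XRV)// => /(_ erefl).
by under eq_fun do rewrite tailE//.
Qed.

(** The normalization n P(|X| > a n) -> 1 fixes the mass outside the unit ball; homogeneity does the
    rest. *)
Lemma nu_gt s : 0 < s -> nu [set x | s < enorm x] = s `^ (- alpha).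
Proof.
have nu1 : nu [set x | 1 < enorm x] = 1.
  have := vague_tail ltr01; under eq_fun do rewrite mul1r.
  by move/cvg_unique; apply => //; exact: Rhausdorff.
move=> s0.
have -> : [set x : 'rV[R]_d | s < enorm x] =
  [set s *: x | x in [set x | 1 < enorm x]].
  apply/seteqP; split => [x /= sx|_ [x /= x1 <-]].
    exists (s^-1 *: x); last by rewrite scalerA divff ?gt_eqF// scale1r.
    by rewrite /= enormZ gtr0_norm ?invr_gt0// mulrC ltr_pdivlMr// mul1r.
  by rewrite enormZ gtr0_norm// ltr_pMr.
rewrite /limit_mass (mu_homog XRV)//; last exact: measurable_gt.
rewrite (nuE XRV) ?nu1 ?mule1//; first exact: measurable_gt.
exact: bounded_away_gt.
Qed.

Lemma nu_ge s : 0 < s -> nu [set x | s <= enorm x] = s `^ (- alpha).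
Proof.
move=> s0; rewrite -nu_gt//; apply/eqP; rewrite eq_le; apply/andP; split;
  last first.
  apply: (le_nu XRV); [exact: measurable_gt|exact: measurable_ge|exact:
    bounded_away_ge|].
  by move=> x /= /ltW.
have mge := measurable_ge (d := d) s; have mgt := measurable_gt (d := d) s.
have age := bounded_away_ge (d := d) s0; have agt :=
  bounded_away_gt (d := d) s0.
have ml : measurable ([set x | enorm x = s] : set BX).
  by apply: closed_borel; apply: (@closed_level _ _ (@enorm R d));
    exact: continuous_enorm.
rewrite -lee_fin -!(nuE XRV)//.
rewrite -[leRHS]adde0 -(sphere_null XRV s0).
apply: (le_trans _ (muU2 _ _ _)); try exact: measurable_embed.
apply: le_mu.
- exact: measurable_embed.
- by apply: measurableU; exact: measurable_embed.
- rewrite -image_setU; apply: image_subset => x /=.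
  by rewrite le_eqVlt => /orP[/eqP ->|]; [right|left].
Qed.

Lemma near_tail_lt s m : 0 < s -> s `^ (- alpha) < m ->
  \forall n \near \oo, n%:R * V (s * a n) < m.
Proof. by move=> s0 sm; have := vague_tail s0; rewrite nu_gt// => /cvgr_lt;
  apply. Qed.

Lemma near_tail_gt s m : 0 < s -> m < s `^ (- alpha) ->
  \forall n \near \oo, m < n%:R * V (s * a n).
Proof. by move=> s0 sm; have := vague_tail s0; rewrite nu_gt// => /cvgr_gt;
  apply. Qed.

Lemma powRN_lt1 s : 1 < s -> s `^ (- alpha) < 1.
Proof.
move=> s1; rewrite powRN invf_lt1 ?powR_gt0 ?(lt_trans ltr01)//.
have := @gt0_ltr_powR R alpha alpha_gt0 1 s.
by rewrite !nnegrE powR1; apply => //; rewrite (le_trans ler01)// ltW.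
Qed.

(* If a n.+1 > s * a n with s > 1, then n * P(|X| > a n.+1) would be close to at
   most s ^ (- alpha) < 1, against the choice of the norming sequence. *)
Lemma ratio_a s : 1 < s -> \forall n \near \oo, a n.+1 <= s * a n.
Proof.
move=> s1; have s0 : 0 < s by exact: lt_trans s1.
have sl1 := powRN_lt1 s1; set p := s `^ (- alpha) in sl1.
have p0 : 0 < p by rewrite powR_gt0.
(* Two values with p < m < m' < 1: for large n the factor (n + 1) / n is at most m' / m. *)
pose m := (p + 1) / 2; pose m' := (m + 1) / 2.
have pm : p < m by rewrite /m; lra.
have mm' : m < m' by rewrite /m' /m; lra.
have m'1 : m' < 1 by rewrite /m' /m; lra.
have m0 : 0 < m by exact: lt_trans pm.
have nVaS : \forall n \near \oo, m' < n.+1%:R * V (a n.+1).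
  have [N _ HN] : \forall n \near \oo, m' < n%:R * V (a n).
    by have /cvgr_gt := nVa; apply.
  by exists N => // k Nk; apply: HN => /=; exact: leqW.
near=> n; rewrite leNgt; apply/negP => an.
have n0 : (0 < n)%N by near: n; exists 1%N.
have h1 : n%:R * V (s * a n) < m by near: n; exact: near_tail_lt.
have h2 : m' < n.+1%:R * V (a n.+1) by near: n.
have h3 : n.+1%:R * m <= m' * n%:R.
  have : m / (m' - m) <= n%:R by near: n; exact: nbhs_infty_ger.
  rewrite ler_pdivrMr ?subr_gt0// -natr1 => h; nra.
have h4 : n.+1%:R * V (a n.+1) <= n.+1%:R * V (s * a n).
  by rewrite ler_wpM2l// tail_le// ltW.
have nR : 0 < n%:R :> R by rewrite ltr0n.
have h5 : n.+1%:R * (n%:R * V (s * a n)) <= n.+1%:R * m by rewrite ler_wpM2l//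
  ltW.
have : n%:R * (n.+1%:R * V (s * a n)) <= n%:R * m'.
  by rewrite mulrCA [leRHS]mulrC (le_trans h5).
rewrite ler_pM2l// => h6.
by have := lt_le_trans h2 (le_trans h4 h6); rewrite ltxx.
Unshelve. all: by end_near. Qed.

(** The predecessor of the first index k with u < a k serves as n, because consecutive terms
    eventually have ratio at most s. *)
Lemma near_a (Q : nat -> Prop) s : 1 < s -> (\forall n \near \oo, Q n) ->
  \forall u \near +oo, exists n, [/\ Q n, a n <= u & u <= s * a n].
Proof.
move=> s1 nQ.
have [N _ HN] : \forall n \near \oo, Q n /\ a n.+1 <= s * a n.
  by apply: filterI => //; exact: ratio_a.
near=> u.
have uN : a N <= u by near: u; apply: nbhs_pinfty_ge; exact: num_real.
have exk : exists k, u < a k.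
  have /cvgryPgt/(_ u)[K _ HK] := a_oo.
  by exists K; apply: HK => /=.
case: (ex_minnP exk) => k uk kmin.
have Nk : (N < k)%N.
  by rewrite ltnNge; apply/negP => /a_homo ak; have :=
    le_lt_trans (le_trans ak uN) uk; rewrite ltxx.
case: k => // k in uk kmin Nk *.
have [Qk ak] := HN k Nk; exists k; split => //.
  by rewrite leNgt; apply/negP => /kmin; rewrite ltnn.
exact: le_trans (ltW uk) ak.
Unshelve. all: by end_near. Qed.

Definition thicken (B : set 'rV[R]_d) (e : R) : set 'rV[R]_d :=
  [set x | exists2 y, B y & `|x - y| < e].

Lemma open_thicken B e : open (thicken B e).
Proof.
have -> : thicken B e = \bigcup_(y in B) ball y e.
  by apply/seteqP; split => [x [y By xy]|x [y By xy]]; exists y => //;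
    move: xy; rewrite -ball_normE/= distrC.
by apply: bigcup_open => y By; exact: ball_open.
Qed.

Lemma thicken_empty e : thicken set0 e = set0.
Proof. by apply/seteqP; split => [x [y]|x]. Qed.

Lemma scaled_prob0 u : q u set0 = 0.
Proof. by rewrite /scaled_prob (_ : [set w | _] = set0) ?pr0//;
  apply/seteqP. Qed.

(** As b decreases to 0 the sets {reldist B <= b} decrease to the closed set B, and continuity from
    above applies because they have finite mass. *)
Lemma nu_reldist (B : set 'rV[R]_d) m : closed B -> ~ B 0 -> B !=set0 ->
  nu B < m ->
  exists b, [/\ 0 < b, b < reldist B 0 & nu [set x | reldist B x <= b] < m].
Proof.
move=> cB nB0 B0 Bm.
have phi0 : 0 < reldist B 0 by exact: reldist_gt0.
have cphi := reldist_continuous B0.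
have [K] := ltr_add_invr (y := 0) (x := reldist B 0) phi0; rewrite add0r => HK.
(* The shift by K makes every term of the sequence smaller than [reldist B 0]. *)
pose b k : R := (k + K).+1%:R^-1.
pose F k := [set x | reldist B x <= b k].
have bphi k : b k < reldist B 0.
  apply: le_lt_trans HK; rewrite lef_pV2 ?posrE ?ltr0n// ler_nat ltnS.
  exact: leq_addl.
have mF k : measurable (F k : set BX).
  by apply: closed_borel; exact: (@closed_sublevel _ _ (reldist B)).
have aF k : bounded_away (F k) by exact: (@sublevel_away _ _ (reldist B)).
have capF : \bigcap_k (E @` F k) = E @` B.
  apply/seteqP; split => [y Fy|_ [x Bx <-] k _].
    have [x Fx xy] := Fy 0%N I; exists x => //; apply: contrapT => nBx.
    have := reldist_gt0 B0 cB nBx.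
    move=> /(ltr_add_invr (y := 0)) [k]; rewrite add0r => Hk.
    have [x' Fx' xy'] := Fy k I.
    move: Fx'; rewrite (embed_inj (etrans xy' (esym xy))) /F/= leNgt => /negP;
      apply.
    apply: le_lt_trans Hk; rewrite lef_pV2 ?posrE ?ltr0n// ler_nat ltnS.
    exact: leq_addr.
  exists x => //; rewrite /F/=; apply: (le_trans (reldist_le x Bx)).
  by rewrite subrr normr0 mul0r invr_ge0.
have aB : bounded_away B by rewrite /bounded_away -(closure_id B).1.
have mB : measurable (B : set BX) by exact: closed_borel.
have : (mu \o (fun k => E @` F k)) k @[k --> \oo] --> mu (\bigcap_k (E @` F k)).
  apply: nonincreasing_cvg_mu.
  - exact: (mu_fin XRV).
  - by move=> k; exact: measurable_embed.
  - by rewrite capF; exact: measurable_embed.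
  - move=> i j ij; apply/subsetPset; apply: image_subset => x; rewrite /F/=.
    move=> /le_trans; apply; rewrite lef_pV2 ?posrE ?ltr0n// ler_nat ltnS.
    by rewrite leq_add2r.
rewrite capF (nuE XRV)// => /fine_cvgP[_] /cvgr_lt/(_ m Bm)[k _ /(_ k)] H.
exists (b k); split => //; first by rewrite invr_gt0.
by apply: H => /=.
Qed.

(** With a n <= u <= s * a n, the event at scale u lies in {reldist B < e} at scale a n, of
    probability about nu / n, while V u is at least V (s * a n), about s^(- alpha) / n. For s close
    to 1 the quotient stays below m. *)
Lemma norming_thicken_le (B : set 'rV[R]_d) m : closed B -> ~ B 0 -> nu B < m ->
  exists2 e, 0 < e & \forall u \near +oo, q u (thicken B e) <= m * V u.
Proof.
move=> cB nB0 Bm.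
have m0 : 0 < m by apply: le_lt_trans Bm; exact: nu_ge0.
have [B0|] := pselect (B !=set0); last first.
  move=> /set0P/negP/negPn/eqP ->; exists 1 => //; near=> u.
  by rewrite thicken_empty scaled_prob0 mulr_ge0 ?tail_ge0 ?ltW.
have [b [b0 bphi bm]] := nu_reldist cB nB0 B0 Bm.
have cphi := reldist_continuous B0.
have [|||e /andP[be eb] mue] := @null_level _ _ _ _ _ _ _ _ XRV (reldist B)
  (b / 2) b => //.
  by rewrite ltr_pdivrMr// mulr2n mulrDr mulr1 ltrDl.
have e0 : 0 < e by apply: lt_trans be; rewrite divr_gt0.
have ephi : e < reldist B 0 by exact: lt_trans bphi.
have mphi : measurable ([set x | reldist B x < e] : set BX).
  by apply: open_borel; exact: (@open_sublevel _ _ (reldist B)).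
have nue : nu [set x | reldist B x < e] < m.
  apply: le_lt_trans bm; apply: (le_nu XRV) => //.
  - by apply: closed_borel; exact: (@closed_sublevel _ _ (reldist B)).
  - exact: (@sublevel_away _ _ (reldist B)).
  - by move=> x /= /ltW /le_trans; apply; exact: ltW.
set l := nu _ in nue.
(* The gap between l and m is shared: m' pays for the vague convergence, m'' for the factor
   s^alpha. *)
pose m' := (l + m) / 2; pose m'' := (m' + m) / 2.
have l0 : 0 <= l by exact: nu_ge0.
have lm' : l < m' by rewrite /m'; lra.
have m'm'' : m' < m'' by rewrite /m'' /m'; lra.
have m''m : m'' < m by rewrite /m'' /m'; lra.
have m''0 : 0 < m'' by rewrite /m'' /m'; lra.
have near1 : \forall n \near \oo, n%:R * q (a n) [set x | reldist B x < e] < m'.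
  have /cvgr_lt := vague_sublevel XRV vague cphi ephi mue.
  exact.
(* The first bound gives s^alpha <= m / m''. The other two give, for r = u / a n <= s, |r x - y| <=
   (e / 4) |y| + 2 (e / 4), which is below e (1 + |y|). *)
pose s := Num.min ((m / m'') `^ alpha^-1) (Num.min (1 + e / 4) 2).
have s1 : 1 < s.
  rewrite !lt_min ltrDl divr_gt0// ltr1n /= andbT.
  have := @gt0_ltr_powR R alpha^-1; rewrite invr_gt0 =>
    /(_ alpha_gt0 1 (m / m'')).
  rewrite !nnegrE powR1; apply => //; first by rewrite divr_ge0 ?ltW.
  by rewrite ltr_pdivlMr// mul1r.
have s0 : 0 < s by exact: lt_trans s1.
have sal : m' / m < s `^ (- alpha).
  apply: (@lt_le_trans _ _ (m'' / m)); first by rewrite ltr_pM2r ?invr_gt0.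
  have : s `^ alpha <= m / m''.
    have h : s <= (m / m'') `^ alpha^-1 by rewrite /s ge_min lexx.
    apply: (@le_trans _ _ (((m / m'') `^ alpha^-1) `^ alpha)).
      by apply: ge0_ler_powR; rewrite ?nnegrE ?powR_ge0 ?(ltW alpha_gt0)
        ?(ltW s0).
    rewrite -powRrM mulVf ?gt_eqF// powRr1// divr_ge0// ltW//.
  rewrite powRN -[m'' / m]invf_div => h; rewrite lef_pV2 ?posrE//;
    last exact: powR_gt0.
  by rewrite divr_gt0.
have near2 := near_tail_gt s0 sal.
exists (e / 4); first by rewrite divr_gt0.
have near0 : \forall n \near \oo, (0 < n)%N by exists 1%N.
apply: filterS (near_a s1 (filterI near0 (filterI near1 near2))).
move=> u [n [[n0 [H1 H2]] anu usn]].
have nR : 0 < n%:R :> R by rewrite ltr0n.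
have u0 : 0 < u by exact: lt_le_trans anu.
have sub : q u (thicken B (e / 4)) <= q (a n) [set x | reldist B x < e].
  apply: le_pr.
  - by apply: measurable_scaled_event; apply: open_borel; exact: open_thicken.
  - exact: measurable_scaled_event.
  - move=> w /=; set x := u^-1 *: _ => -[y By xy].
    have -> : (a n)^-1 *: (X w : 'rV[R]_d) = (u / a n) *: x.
      by rewrite /x scalerA mulrAC divff ?gt_eqF// mul1r.
    set r := u / a n.
    have r1 : 1 <= r by rewrite ler_pdivlMr// mul1r.
    have rs : r <= s by rewrite ler_pdivrMr.
    clearbody r.
    have s4 : s <= 1 + e / 4 by rewrite /s !ge_min lexx orbT.
    have s2 : s <= 2 by rewrite /s !ge_min lexx !orbT.
    apply: (le_lt_trans (reldist_le _ By)).
    rewrite ltr_pdivrMr ?ltr_pwDl//.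
    have -> : r *: x - y = (r - 1) *: y + r *: (x - y).
      by apply/rowP => i; rewrite !mxE; ring.
    apply: (le_lt_trans (ler_normD _ _)); rewrite !normrZ.
    rewrite !ger0_norm ?subr_ge0 ?(le_trans ler01)//.
    have y0 := normr_ge0 y.
    have xy0 := normr_ge0 (x - y).
    have k1 : (r - 1) * `|y| <= e / 4 * `|y| by rewrite ler_wpM2r//; lra.
    have k2 : r * `|x - y| <= 2 * (e / 4).
      apply: ler_pM => //; [exact: le_trans ler01 r1|exact: le_trans rs
        s2|exact: ltW].
    have k3 : 0 <= e * `|y| by rewrite mulr_ge0// ltW.
    by lra.
have h1 : n%:R * q u (thicken B (e / 4)) <= m'.
  by apply: le_trans (ltW H1); rewrite ler_pM2l.
have h2 : m' / m <= n%:R * V u.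
  by apply: (le_trans (ltW H2)); rewrite ler_pM2l// tail_le.
rewrite -(ler_pM2l nR) (le_trans h1)// mulrCA.
by rewrite mulrC -ler_pdivrMr.
Unshelve. all: by end_near. Qed.

End scaling.

(** * Regular variation in the continuous parameter *)

Section tails.
Context {R : realType} {d : nat} {dT} {T : measurableType dT}
  {P : probability T R} {X : {RV P >-> Borel 'rV[R]_d}} {alpha : R}
  {mu : {measure set (Borel 'rV[\bar R]_d) -> \bar R}}.
Hypothesis alpha_gt0 : 0 < alpha.
Hypothesis XRV : regularly_varying X alpha mu.
Local Notation E := (@embed R d).
Local Notation BX := (Borel 'rV[R]_d).
Local Notation q := (scaled_prob X).
Local Notation V := (tail X).
Local Notation nu := (limit_mass mu).

Let norming : exists a : nat -> R, [/\ (forall n, 0 < a n),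
  {homo a : m n / (m <= n)%N >-> m <= n}, a n @[n --> \oo] --> +oo,
  n%:R * V (a n) @[n --> \oo] --> (1 : R) &
  vague_cvg (fun n B => (n%:R%:E * P [set w | B (embed ((a n)^-1 *: X w))])%E)
    mu].
Proof.
have [_ _ _ [a [a0 ah aoo aV av]] _] := XRV; exists a; split => //.
have : (n%:R * V (a n))%:E @[n --> \oo] --> 1%:E.
  rewrite (_ : (fun n => _) = (fun n =>
      (n%:R%:E * P [set w | (a n < enorm (X w))%R])%E))//.
  apply/funext => n; rewrite EFinM; congr (_ * _)%E.
  by rewrite prE//; exact: measurable_tail.
by move/fine_cvgP => -[].
Qed.

Lemma scaled_prob_thicken_le (B : set 'rV[R]_d) m : closed B -> ~ B 0 ->
  nu B < m ->
  exists2 e, 0 < e & \forall u \near +oo, q u (thicken B e) <= m * V u.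
Proof.
by have [a [a0 ah aoo aV av]] := norming;
  exact: (norming_thicken_le alpha_gt0 XRV a0 ah aoo aV av).
Qed.

Lemma nu_enorm_ge s : 0 < s -> nu [set x | s <= enorm x] = s `^ (- alpha).
Proof. by have [a [a0 ah aoo aV av]] := norming;
  exact: (nu_ge XRV a0 aV av). Qed.

Lemma sub_thicken (B : set 'rV[R]_d) e : 0 < e -> B `<=` thicken B e.
Proof. by move=> e0 x Bx; exists x => //; rewrite subrr normr0. Qed.

Lemma scaled_prob_closed_le (B : set 'rV[R]_d) m : closed B -> ~ B 0 ->
  nu B < m ->
  \forall u \near +oo, q u B <= m * V u.
Proof.
move=> cB B0 Bm; have [e e0] := scaled_prob_thicken_le cB B0 Bm.
apply: filterS => u; apply: le_trans; apply: le_scaled_prob.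
- exact: closed_borel.
- by apply: open_borel; exact: open_thicken.
- exact: sub_thicken.
Qed.

Lemma tail_limsup r m : 0 < r -> r `^ (- alpha) < m ->
  \forall u \near +oo, V (r * u) <= m * V u.
Proof.
move=> r0 rm; have B0 : ~ [set x : 'rV[R]_d | r <= enorm x] 0.
  by rewrite /= enorm0 leNgt r0.
have := scaled_prob_closed_le (@closed_enorm_ge R d r) B0.
rewrite nu_enorm_ge// => /(_ m rm) H; near=> u.
have u0 : 0 < u by near: u; exact: near_pinfty_gt.
rewrite -tailE//; apply: (@le_trans _ _ (q u [set x | r <= enorm x])).
  apply: le_scaled_prob; [exact: measurable_gt|exact: measurable_ge|].
  by move=> x /= /ltW.
by near: u.
Unshelve. all: by end_near. Qed.

Lemma near_pinftyM (Q : R -> Prop) r : 0 < r ->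
  (\forall u \near +oo, Q u) -> \forall u \near +oo, Q (r * u).
Proof.
move=> r0 [M [_ HM]]; near=> u; apply: HM; rewrite mulrC -ltr_pdivrMr//.
by near: u; exact: near_pinfty_gt.
Unshelve. all: by end_near. Qed.

(** This is the upper bound for the ratio 1 / r, read at the scale r u. *)
Lemma tail_liminf r m : 0 < r -> m < r `^ (- alpha) ->
  \forall u \near +oo, m * V u <= V (r * u).
Proof.
move=> r0 mr; have [m0|m0] := leP m 0.
  near=> u; apply: (@le_trans _ _ 0); last exact: tail_ge0.
  by rewrite mulr_le0_ge0// tail_ge0.
have r1 : (r^-1) `^ (- alpha) < m^-1.
  rewrite -powR_inv1 ?(ltW r0)// -powRrM mulN1r powRN ltf_pV2 ?posrE//.
  by rewrite powR_gt0.
have := near_pinftyM r0 (tail_limsup (r := r^-1) ltac:(by rewrite invr_gt0) r1).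
apply: filterS => u; rewrite mulKf ?gt_eqF//.
by rewrite mulrC ler_pdivlMr// mulrC.
Unshelve. all: by end_near. Qed.

(** The convergence n V(a n) -> 1 makes V positive at arbitrarily large arguments, and V is
    nonincreasing. *)
Lemma tail_gt0 u : 0 < V u.
Proof.
have [a [a0 ah aoo aV av]] := norming.
have /cvgr_gt/(_ 0 ltr01) aV0 := aV.
have /cvgryPgt/(_ u) au := aoo.
near \oo => n.
have : 0 < n%:R * V (a n) by near: n.
rewrite lt_neqAle => /andP[]; rewrite eq_sym mulf_eq0 negb_or => /andP[_ Vn0] _.
apply: (@lt_le_trans _ _ (V (a n))).
  by rewrite lt_neqAle eq_sym Vn0 tail_ge0.
by apply: tail_le; apply: ltW; near: n.
Unshelve. all: by end_near. Qed.

Lemma bounded_away_enorm (B : set 'rV[R]_d) : bounded_away B ->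
  exists2 r, 0 < r & B `<=` [set x | r <= `|x|].
Proof.
move=> aB; have /nbhs_ballP[r /= r0 rB] : nbhs (0 : 'rV[R]_d) (~` closure B).
  by apply: open_nbhs_nbhs; split => //; rewrite openC; exact: closed_closure.
exists r => // x Bx /=; rewrite leNgt; apply/negP => xr.
apply: (rB x); last exact: subset_closure.
by rewrite -ball_normE/= sub0r normrN.
Qed.

(* If r <= |x| on G, then {r <= |x|} minus G is closed, and the upper bound for
   it turns into a lower bound for G. *)
Lemma scaled_prob_open_ge (G : set 'rV[R]_d) m : open G -> bounded_away G ->
  m < nu G ->
  \forall u \near +oo, m * V u <= q u G.
Proof.
move=> oG aG mG.
have [r r0 Gr'] := bounded_away_enorm aG.
have Gr : G `<=` [set x | r <= enorm x].
  by move=> x /Gr' /= /le_trans; apply; exact: norm_le_enorm.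
pose B := [set x | r <= enorm x] `\` G.
have mge := measurable_ge (d := d) r; have mG' := open_borel oG.
have age := bounded_away_ge (d := d) r0.
have cB : closed B.
  by rewrite /B setDE; apply: closedI; [exact: closed_enorm_ge|rewrite closedC].
have mB := closed_borel cB.
have nB0 : ~ B 0 by move=> [/=]; rewrite enorm0 leNgt r0.
have nuB : nu B = r `^ (- alpha) - nu G by rewrite (nuD XRV)// nu_enorm_ge.
pose e := (nu G - m) / 2.
have e0 : 0 < e by rewrite divr_gt0// subr_gt0.
have h1 := scaled_prob_closed_le cB nB0 (m := nu B + e) ltac:(by rewrite ltrDl).
have h2 := tail_liminf r0 (m := r `^ (- alpha) - e) ltac:(by
  rewrite ltrBlDr ltrDl).
near=> u.
have u0 : 0 < u by near: u; exact: near_pinfty_gt.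
have k1 : q u B <= (nu B + e) * V u by near: u.
have k2 : (r `^ (- alpha) - e) * V u <= V (r * u) by near: u.
have k3 : V (r * u) <= q u G + q u B.
  rewrite -tailE//; apply: le_trans (prU_le P _ _);
    try exact: measurable_scaled_event.
  apply: le_pr.
  - exact: measurable_scaled_event (measurable_gt _).
  - by apply: measurableU; exact: measurable_scaled_event.
  - move=> w /= /ltW h; have [Gw|nGw] := pselect (G (u^-1 *: (X w : 'rV[R]_d))).
      by left.
    by right; split.
have -> : m * V u = (r `^ (- alpha) - e) * V u - (nu B + e) * V u.
  by rewrite nuB /e; lra.
lra.
Unshelve. all: by end_near. Qed.

End tails.

(** * Independence *)

Import HBSimple HBNNSimple.

Section factor_integral.
Context {R : realType} {dT} {T : measurableType dT} (P : probability T R)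
  {dE} {E : measurableType dE}.
Variables (Y : T -> E) (W : T -> R).
Hypotheses (mY : measurable_fun setT Y) (mW : measurable_fun setT W)
  (W0 : forall w, 0 <= W w).
Hypothesis Woo : (\int[P]_w (W w)%:E < +oo)%E.
Hypothesis indicW : forall B : set E, measurable B ->
  (\int[P]_w (\1_(Y @^-1` B) w * W w)%:E =
    P (Y @^-1` B) * \int[P]_w (W w)%:E)%E.

Let intW0 : (0 <= \int[P]_w (W w)%:E)%E.
Proof. by apply: integral_ge0 => w _; rewrite lee_fin. Qed.

Lemma factor_nnsfun (h : {nnsfun E >-> R}) :
  (\int[P]_w (h (Y w) * W w)%:E = \int[P]_w (h (Y w))%:E * \int[P]_w
    (W w)%:E)%E.
Proof.
pose B y := Y @^-1` (h @^-1` [set y]).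
have mh y : measurable (h @^-1` [set y]) by exact: measurable_sfunP.
have mB y : measurable (B y) by rewrite /B -[X in measurable X]setTI; exact: mY.
have y0 y : y \in range h -> 0 <= y.
  by rewrite inE => -[x _ <-]; exact: fun_ge0.
have hE w : h (Y w) = \sum_(y \in range h) (y * \1_(B y) w).
  by rewrite fimfunE; apply: eq_fsbigr => y _.
transitivity (\int[P]_w (\sum_(y \in range h) (y * (\1_(B y) w * W w))%:E))%E.
  apply: eq_integral => w _; rewrite hE fsumEFin//; congr EFin.
  by rewrite mulrC mulr_fsumr//; apply: eq_fsbigr => y _; rewrite mulrC mulrA.
transitivity (\sum_(y \in range h) (y%:E * (P (B y) * \int[P]_w (W w)%:E)))%E.
  (* Exchanging sum and integral requires nonnegative summands for every y, also outside the range
     of [h]; negative y get the value 0. *)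
  pose f y : T -> \bar R :=
    if 0 <= y then (fun w => (y * (\1_(B y) w * W w))%:E) else cst 0%E.
  rewrite (eq_integral (fun w => \sum_(y \in range h) f y w)%E); last first.
    by move=> w _; apply: eq_fsbigr => y /y0 y00; rewrite /f y00.
  have mf y : measurable_fun setT (f y).
    rewrite /f; case: ifP => // _; apply/measurable_EFinP.
    by do 2 apply: measurable_funM => //; exact: measurable_indic.
  have f0 y w : setT w -> (0 <= f y w)%E.
    rewrite /f; case: ifP => // yy.
    by rewrite lee_fin mulr_ge0// mulr_ge0// indicE ler0n.
  rewrite (ge0_integral_fsum P measurableT mf f0)//.
  apply: eq_fsbigr => y /y0 y00; rewrite /f y00 -indicW//.
  under eq_integral do rewrite EFinM.
  rewrite ge0_integralZl_EFin//.
  - by move=> w _; rewrite lee_fin mulr_ge0// indicE ler0n.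
  - by apply/measurable_EFinP; apply: measurable_funM.
transitivity ((\sum_(y \in range h) (y%:E * P (B y))) * \int[P]_w (W w)%:E)%E.
  rewrite ge0_mule_fsuml//; first by apply: eq_fsbigr => y _; rewrite muleA.
  move=> y; have [->|/set0P[w Bw]] := eqVneq (B y) set0;
    first by rewrite measure0 mule0.
  rewrite mule_ge0// lee_fin y0// inE; exists (Y w) => //.
congr (_ * _)%E.
transitivity (\int[P]_w (\sum_(y \in range h) (y * \1_(B y) w)%:E))%E;
  last first.
  by apply: eq_integral => w _; rewrite fsumEFin// -hE.
pose f y : T -> \bar R :=
  if 0 <= y then (fun w => (y * \1_(B y) w)%:E) else cst 0%E.
rewrite [RHS](eq_integral (fun w => \sum_(y \in range h) f y w)%E); last first.
  by move=> w _; apply: eq_fsbigr => y /y0 y00; rewrite /f y00.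
have mf y : measurable_fun setT (f y).
  rewrite /f; case: ifP => // _; apply/measurable_EFinP.
  by apply: measurable_funM => //; exact: measurable_indic.
have f0 y w : setT w -> (0 <= f y w)%E.
  rewrite /f; case: ifP => // yy.
  by rewrite lee_fin mulr_ge0// indicE ler0n.
rewrite (ge0_integral_fsum P measurableT mf f0)//.
apply: eq_fsbigr => y /y0 y00; rewrite /f y00.
under eq_integral do rewrite EFinM.
rewrite ge0_integralZl_EFin//.
- by rewrite integral_indic// setIT.
- by apply/measurable_EFinP; exact: measurable_indic.
Qed.

Lemma factor_integral (g : E -> R) : measurable_fun setT g ->
  (forall x, 0 <= g x) ->
  (\int[P]_w (g (Y w) * W w)%:E = \int[P]_w (g (Y w))%:E * \int[P]_w
    (W w)%:E)%E.
Proof.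
move=> mg g0; pose gE x := (g x)%:E.
have mgE : measurable_fun setT gE by exact/measurable_EFinP.
pose h := nnsfun_approx measurableT mgE.
have hcvg x : (h n x)%:E @[n --> \oo] --> gE x.
  by apply: cvg_nnsfun_approx => // y _; rewrite lee_fin.
have nd x : {homo (fun n => h n x) : n m / (n <= m)%N >-> n <= m}.
  by move=> n m nm; have /lefP := nd_nnsfun_approx measurableT mgE nm; apply.
have mhY n : measurable_fun setT (fun w => h n (Y w)).
  by apply: (measurableT_comp _ mY).
have c1 : (\int[P]_w (h n (Y w) * W w)%:E)%E @[n --> \oo] -->
    (\int[P]_w (g (Y w) * W w)%:E)%E.
  rewrite [X in _ --> X](_ : _ = \int[P]_w limn (fun n =>
    (h n (Y w) * W w)%:E))%E.
    apply: cvg_monotone_convergence => //.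
    - by move=> n; apply/measurable_EFinP; exact: measurable_funM.
    - by move=> n w _; rewrite lee_fin mulr_ge0.
    - by move=> w _ n m nm; rewrite lee_fin ler_wpM2r// nd.
  apply: eq_integral => w _; apply/esym/cvg_lim => //.
  under eq_fun do rewrite EFinM muleC.
  by rewrite mulrC EFinM; apply: cvgeZl.
have c2 : (\int[P]_w (h n (Y w))%:E)%E @[n --> \oo] -->
  (\int[P]_w (g (Y w))%:E)%E.
  rewrite [X in _ --> X](_ : _ = \int[P]_w limn (fun n => (h n (Y w))%:E))%E.
    apply: cvg_monotone_convergence => //.
    - by move=> n; apply/measurable_EFinP.
    - by move=> n w _; rewrite lee_fin.
    - by move=> w _ n m nm; rewrite lee_fin nd.
  by apply: eq_integral => w _; apply/esym/cvg_lim => //; exact: hcvg.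
(* Finiteness makes multiplication by this constant continuous on the extended reals. *)
have Wfin : (\int[P]_w (W w)%:E)%E \is a fin_num by rewrite ge0_fin_numE.
have c3 : (\int[P]_w (h n (Y w) * W w)%:E)%E @[n --> \oo] -->
    (\int[P]_w (g (Y w))%:E * \int[P]_w (W w)%:E)%E.
  under eq_fun do rewrite factor_nnsfun.
  exact: cvgeZr.
by apply: cvg_unique c1 c3; exact: ereal_hausdorff.
Qed.

End factor_integral.

Section independent_products.
Context {R : realType} {dT} {T : measurableType dT} {P : probability T R}
  {dE} {E : measurableType dE} {Z : nat -> {RV P >-> E}}.
Hypothesis indZ : independent_family Z.

Lemma measurable_prod_comp (s : seq nat) (f : nat -> E -> R) :
  (forall i, measurable_fun setT (f i)) ->
  measurable_fun setT (fun w => \prod_(i <- s) f i (Z i w)).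
Proof.
move=> mf; elim: s => [|i s IH]; first by under eq_fun do rewrite big_nil;
  exact: measurable_cst.
under eq_fun do rewrite big_cons.
apply: measurable_funM => //.
by apply: (measurableT_comp (mf i)).
Qed.

Lemma prod_indic_preimage (s : seq nat) (B : nat -> set E) w :
  \prod_(i <- s) \1_(B i) (Z i w) = \1_(\bigcap_(i in [set` s]) (Z i @^-1` B i))
    w :> R.
Proof.
rewrite indicE; case: (boolP (w \in _)) => [|nw].
  rewrite inE => sw; rewrite big_seq big1// => i si.
  by rewrite indicE mem_set//; exact: sw.
suff [i si nBi] : exists2 i, i \in s & ~ B i (Z i w).
  by rewrite (big_rem i)//= indicE memNset// mul0r.
apply: contrapT => h; move: nw; rewrite notin_setE; apply => i /= si.
by apply: contrapT => nB; apply: h; exists i.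
Qed.

Lemma measurable_bigcap_preimage (s : seq nat) (B : nat -> set E) :
  (forall i, measurable (B i)) ->
  measurable (\bigcap_(i in [set` s]) (Z i @^-1` B i)).
Proof.
move=> mB; apply: fin_bigcap_measurable => [|i _]; first exact: finite_seq.
by rewrite -[X in measurable X]setTI; exact: measurable_funP.
Qed.

(** Independence is the case where all factors are indicators. Induction on [t] frees the factors
    from this restriction one by one: [factor_integral] passes from indicators to a general f i, and
    its hypothesis on indicators is the induction hypothesis with i moved from [t] to [s]. *)
Let prod_integral_aux (t s : seq nat) (f : nat -> E -> R) :
  uniq (t ++ s) -> (forall i, measurable_fun setT (f i)) ->
  (forall i x, 0 <= f i x) ->
  (forall i, i \in t ++ s -> (\int[P]_w (f i (Z i w))%:E < +oo)%E) ->
  (forall i, i \in s -> exists2 B, measurable B & f i = \1_B) ->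
  (\int[P]_w (\prod_(i <- t ++ s) f i (Z i w))%:E =
    \prod_(i <- t ++ s) \int[P]_w (f i (Z i w))%:E)%E.
Proof.
have int_indic i (B : set E) : measurable B ->
    (\int[P]_w (\1_B (Z i w))%:E = P (Z i @^-1` B))%E.
  move=> mB; have mZB : measurable (Z i @^-1` B).
    by rewrite -[X in measurable X]setTI; exact: measurable_funP.
  transitivity (\int[P]_w (\1_(Z i @^-1` B) w)%:E)%E; first exact: eq_integral.
  by rewrite integral_indic// setIT.
elim: t s f => [|i t IH] s f; rewrite /=.
  move=> us mf f0 foo fs.
  have /choice[B HB] : forall i, exists B, measurable B /\
    (i \in s -> f i = \1_B).
    move=> i; have [/fs[B mB fB]|_] := boolP (i \in s); first by exists B.
    by exists set0.
  have mB i : measurable (B i) by have [] := HB i.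
  transitivity (\int[P]_w (\1_(\bigcap_(i in [set` s]) (Z i @^-1` B i))
    w)%:E)%E.
    apply: eq_integral => w _; rewrite -prod_indic_preimage; congr EFin.
    by apply: eq_big_seq => i si; have [_ ->] := HB i.
  transitivity (P (\bigcap_(i in [set` s]) (Z i @^-1` B i))).
    by rewrite integral_indic// ?setIT//; exact: measurable_bigcap_preimage.
  rewrite indZ//; apply: eq_big_seq => i si.
  by rewrite -int_indic//; apply: eq_integral => w _; have [_ ->] := HB i.
move=> /andP[nits uts] mf f0 foo fs.
have IHs : (\int[P]_w (\prod_(i <- t ++ s) f i (Z i w))%:E =
    \prod_(i <- t ++ s) \int[P]_w (f i (Z i w))%:E)%E.
  by apply: IH => // j jts; apply: foo; rewrite inE jts orbT.
rewrite big_cons -IHs; under eq_integral do rewrite big_cons.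
apply: (@factor_integral _ _ _ P _ _ (Z i) (fun w =>
  \prod_(i <- t ++ s) f i (Z i w))).
- exact: measurable_funP.
- exact: measurable_prod_comp.
- by move=> w; apply: prodr_ge0.
- rewrite IHs -ge0_fin_numE; last first.
    by apply: prode_ge0 => j _; apply: integral_ge0 => w _; rewrite lee_fin.
  rewrite big_seq; elim/big_ind : _ => //; first exact: fin_numM.
  move=> j jts; rewrite ge0_fin_numE; first by apply: foo; rewrite inE jts orbT.
  by apply: integral_ge0 => w _; rewrite lee_fin.
- move=> B mB.
  (* The family in which i has joined the indicator part; it agrees with f elsewhere because i
     occurs only once. *)
  pose f' j := if j == i then \1_B else f j.
  have f'E j : j \in t ++ s -> f' j = f j.
    by move=> jts; rewrite /f'; case: eqP => // ji; rewrite -ji jts in nits.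
  have f'i : f' i = \1_B by rewrite /f' eqxx.
  have perm : perm_eq (t ++ i :: s) (i :: t ++ s).
    by rewrite -cat1s perm_catCA.
  have := IH (i :: s) f'.
  rewrite !(perm_big _ perm) (perm_uniq perm)/= nits uts => /(_ isT).
  rewrite big_cons f'i int_indic//.
  have prodE : (\prod_(j <- t ++ s) \int[P]_w (f' j (Z j w))%:E =
      \prod_(j <- t ++ s) \int[P]_w (f j (Z j w))%:E)%E.
    by apply: eq_big_seq => j /f'E ->.
  rewrite prodE -IHs => <-.
  + apply: eq_integral => w _; rewrite (perm_big _ perm) big_cons f'i.
    by congr EFin; congr (_ * _); apply: eq_big_seq => j jts; rewrite f'E.
  + by move=> j; rewrite /f'; case: eqP => // _; exact: measurable_indic.
  + by move=> j x; rewrite /f'; case: eqP => // _; rewrite indicE ler0n.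
  + move=> j; rewrite (perm_mem perm) inE => /orP[/eqP ->|jts].
      rewrite f'i int_indic// (le_lt_trans (probability_le1 _ _)) ?ltry//.
      by rewrite -[X in measurable X]setTI; exact: measurable_funP.
    by rewrite f'E//; apply: foo; rewrite inE jts orbT.
  + move=> j; rewrite inE => /orP[/eqP ->|js]; first by exists B.
    by rewrite f'E; [exact: fs|rewrite mem_cat js orbT].
- exact: mf.
- exact: f0.
Qed.

Lemma prod_integral (s : seq nat) (f : nat -> E -> R) :
  uniq s -> (forall i, measurable_fun setT (f i)) ->
  (forall i x, 0 <= f i x) ->
  (forall i, i \in s -> (\int[P]_w (f i (Z i w))%:E < +oo)%E) ->
  (\int[P]_w (\prod_(i <- s) f i (Z i w))%:E =
    \prod_(i <- s) \int[P]_w (f i (Z i w))%:E)%E.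
Proof.
move=> us mf f0 foo; have := @prod_integral_aux s [::] f.
by rewrite cats0; apply.
Qed.

End independent_products.

(** * Tail bounds and moments *)

Lemma nneseries_geometric_le {R : realType} (u : nat -> \bar R) (C z : R) :
  0 <= C -> 0 < z < 1 -> (forall j, (0 <= u j)%E) ->
  (forall j, (u j <= (C * z ^+ j)%:E)%E) ->
  (\sum_(0 <= j <oo) u j <= (C / (1 - z))%:E)%E.
Proof.
move=> C0 /andP[z0 z1] u0 uz.
apply: lime_le; first by apply: is_cvg_nneseries => n _ _; exact: u0.
near=> n; apply: (@le_trans _ _ (\sum_(0 <= j < n) (C * z ^+ j)%:E)%E).
  exact: lee_sum.
rewrite sumEFin lee_fin; apply: geometric_le_lim => //.
by rewrite ger0_norm// ltW.
Unshelve. all: by end_near. Qed.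

Section tail_iteration.
Context {R : realType} (V : R -> R) (u0 : R).
Hypothesis u00 : 0 < u0.

Lemma iter_upper z : 0 <= z -> (forall u, u0 <= u -> V (2 * u) <= z * V u) ->
  forall j u, u0 <= u -> V (2 ^+ j * u) <= z ^+ j * V u.
Proof.
move=> z0 Vz; elim=> [|j IH] u uu; first by rewrite !expr0 !mul1r.
rewrite exprS -mulrA (le_trans (Vz _ _))//.
  rewrite (le_trans uu)// ler_peMl//; first by rewrite (le_trans (ltW u00)).
  by rewrite exprn_ege1// ler1n.
by rewrite [in leRHS]exprS -mulrA ler_wpM2l// IH.
Qed.

Lemma iter_lower z : 0 <= z -> (forall u, u0 <= u -> z * V u <= V (2 * u)) ->
  forall j u, u0 <= u -> z ^+ j * V u <= V (2 ^+ j * u).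
Proof.
move=> z0 Vz; elim=> [|j IH] u uu; first by rewrite !expr0 !mul1r.
rewrite [in leRHS]exprS -[in leRHS]mulrA (le_trans _ (Vz _ _))//; last first.
  rewrite (le_trans uu)// ler_peMl//; first by rewrite (le_trans (ltW u00)).
  by rewrite exprn_ege1// ler1n.
by rewrite exprS -mulrA ler_wpM2l// IH.
Qed.

End tail_iteration.

Lemma dyadic_bracket {R : realType} (u0 u : R) : 0 < u0 -> u0 < u ->
  exists j, 2 ^+ j * u0 < u <= 2 ^+ j.+1 * u0.
Proof.
move=> u00 uu.
have exj : exists j, u <= 2 ^+ j * u0.
  exists (Num.trunc (u / u0)).+1; rewrite -ler_pdivrMr//.
  apply: (le_trans (ltW (truncnS_gt _))).
  by rewrite -natrX ler_nat ltnW// ltn_expl.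
case: (ex_minnP exj) => -[|j] uj jmin; first by move: uj;
  rewrite expr0 mul1r leNgt uu.
exists j; rewrite uj andbT ltNge; apply/negP => /jmin; by rewrite ltnn.
Qed.

Lemma powR_exprn {R : realType} (x p : R) j : 0 <= x -> (x ^+ j) `^ p =
  (x `^ p) ^+ j.
Proof. by move=> x0; rewrite -(powR_mulrn j x0) -powRrM mulrC powRrM powR_mulrn
  ?powR_ge0. Qed.

Section moments.
Context {R : realType} {d : nat} {dT} {T : measurableType dT}
  {P : probability T R} {X : {RV P >-> Borel 'rV[R]_d}} {alpha : R}
  {mu : {measure set (Borel 'rV[\bar R]_d) -> \bar R}}.
Hypothesis alpha_gt0 : 0 < alpha.
Hypothesis XRV : regularly_varying X alpha mu.
Local Notation BX := (Borel 'rV[R]_d).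
Local Notation V := (tail X).

Lemma near_pinfty_threshold (Q : R -> Prop) : (\forall u \near +oo, Q u) ->
  exists2 u0, 0 < u0 & forall u, u0 <= u -> Q u.
Proof.
move=> [M [_ HM]]; exists (Num.max M 0 + 1).
  by rewrite ltr_pwDr// le_max lexx orbT.
move=> u; rewrite -lerBrDr ge_max => /andP[Mu _]; apply: HM.
by rewrite (le_lt_trans Mu)// ltrBlDr ltrDl.
Qed.

(** Iterated along powers of 2, this bound and its counterpart act as Potter bounds: an exponent
    strictly on one side of alpha leaves room for the error at each doubling. *)
Lemma tail_double_le p : p < alpha ->
  \forall u \near +oo, V (2 * u) <= 2 `^ (- p) * V u.
Proof.
move=> pa; apply: (tail_limsup alpha_gt0 XRV) => //.
by rewrite /powR (gt_eqF (ltr0Sn _ 1)) ltr_expR ltr_pM2r ?ltrN2// ln_gt0//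
  ltr1n.
Qed.

Lemma tail_double_ge p : alpha < p ->
  \forall u \near +oo, 2 `^ (- p) * V u <= V (2 * u).
Proof.
move=> pa; apply: (tail_liminf alpha_gt0 XRV) => //.
by rewrite /powR (gt_eqF (ltr0Sn _ 1)) ltr_expR ltr_pM2r ?ltrN2// ln_gt0//
  ltr1n.
Qed.

Lemma tail_lower_bound p : alpha < p ->
  exists2 C, 0 < C & \forall u \near +oo, C * u `^ (- p) <= V u.
Proof.
move=> pa; have [u0 u00 Hu] := near_pinfty_threshold (tail_double_ge pa).
(* If 2^j u0 < u <= 2^(j+1) u0, then 2^(j+1) < 2 u / u0, so j + 1 doublings from u0 lose at most the
   factor (2 u / u0)^(- p). *)
exists ((2 / u0) `^ (- p) * V u0).
  by rewrite mulr_gt0 ?powR_gt0 ?divr_gt0//; exact: (tail_gt0 XRV).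
near=> u; have uu0 : u0 < u by near: u; exact: near_pinfty_gt.
have u_gt0 : 0 < u by exact: lt_trans uu0.
have [j /andP[j1 j2]] := dyadic_bracket u00 uu0.
apply: (@le_trans _ _ (V (2 ^+ j.+1 * u0))); last exact: tail_le.
have z0 : 0 <= 2 `^ (- p) :> R by exact: powR_ge0.
apply: le_trans (iter_lower u00 z0 Hu j.+1 (lexx _)).
rewrite mulrAC ler_wpM2r ?tail_ge0//.
rewrite -powRM ?divr_ge0 ?(ltW u00) ?(ltW u_gt0)//.
rewrite -powR_exprn// !powRN lef_pV2 ?posrE ?powR_gt0 ?mulr_gt0 ?divr_gt0
  ?exprn_gt0//.
apply: ge0_ler_powR; rewrite ?nnegrE ?mulr_ge0 ?divr_ge0 ?exprn_ge0 ?ltW//.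
- exact: lt_trans pa.
- by rewrite invr_gt0.
- by rewrite exprS -!mulrA ltr_pM2l// mulrC ltr_pdivlMr.
- by rewrite invr_gt0.
Unshelve. all: by end_near. Qed.

Lemma measurable_enorm_powR p :
  measurable_fun setT (fun w => enorm (X w) `^ p).
Proof.
apply: (@measurableT_comp _ _ _ _ _ _ (fun r : R => r `^ p));
  first exact: measurable_powR.
apply: (@measurableT_comp _ _ _ _ _ _ (@enorm R d : BX -> R)) => //.
by apply: continuous_borel; exact: continuous_enorm.
Qed.

(** Summation over dyadic shells: shell j contributes at most (2^(j+1) u0)^p V(2^j u0), which for p
    < p' < alpha decays geometrically with ratio 2^(p - p'). *)
Lemma moment_lty p : 0 < p < alpha ->
  (\int[P]_w (enorm (X w) `^ p)%:E < +oo)%E.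
Proof.
move=> /andP[p0 pa].
pose p' := (p + alpha) / 2.
have pp' : p < p' by rewrite /p'; lra.
have p'a : p' < alpha by rewrite /p'; lra.
have [u0 u00 Hu] := near_pinfty_threshold (tail_double_le p'a).
pose z : R := 2 `^ (- p'); pose b : R := 2 `^ p.
have z0 : 0 < z by exact: powR_gt0.
have b0 : 0 < b by exact: powR_gt0.
have bz : b * z < 1.
  rewrite /b /z -powRD; last by apply/implyP => _; rewrite pnatr_eq0.
  by rewrite /powR pnatr_eq0/= -[ltRHS]expR0 ltr_expR pmulr_llt0 ?ln_gt0
    ?ltr1n//; lra.
pose g j (w : T) : \bar R :=
  (((2 ^+ j.+1 * u0) `^ p) * \1_[set w | 2 ^+ j * u0 < enorm (X w)] w)%:E.
have mg j : measurable_fun setT (g j).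
  apply/measurable_EFinP; apply: measurable_funM => //.
  by apply: measurable_indic; exact: measurable_tail.
have g0 j w : setT w -> (0 <= g j w)%E.
  by move=> _; rewrite lee_fin mulr_ge0// ?powR_ge0// indicE ler0n.
have le1 w : ((enorm (X w) `^ p)%:E <= (u0 `^ p)%:E +
  \sum_(0 <= j <oo) g j w)%E.
  have [le|gt] := leP (enorm (X w)) u0.
    rewrite -[leLHS]adde0 leeD//; last by apply: nneseries_ge0 => n _ _;
      exact: g0.
    by rewrite lee_fin ge0_ler_powR ?nnegrE ?enorm_ge0// ltW.
  have [j /andP[j1 j2]] := dyadic_bracket u00 gt.
  rewrite -[leLHS]add0e leeD// ?lee_fin ?powR_ge0//.
  apply: (le_trans _ (nneseries_lim_ge j.+1 _)); last by move=> n _ _;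
    exact: g0.
  rewrite big_nat_recr//= -[leLHS]add0e leeD//.
    by apply: sume_ge0 => i _; exact: g0.
  rewrite lee_fin indicE mem_set// mulr1 ge0_ler_powR ?nnegrE ?enorm_ge0//
    ?(ltW p0)//.
  by rewrite mulr_ge0// ltW.
have mser : measurable_fun setT (fun w => \sum_(0 <= j <oo) g j w)%E.
  by apply: ge0_emeasurable_sum => // j w _ _; exact: g0.
apply: (@le_lt_trans _ _ (\int[P]_w ((u0 `^ p)%:E +
  \sum_(0 <= j <oo) g j w))%E).
  apply: ge0_le_integral => //.
  - by move=> w _; rewrite lee_fin powR_ge0.
  - by apply/measurable_EFinP; exact: measurable_enorm_powR.
  - by apply: emeasurable_funD.
rewrite ge0_integralD//; last 2 first.
- by move=> w _; rewrite lee_fin powR_ge0.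
- by move=> w _; apply: nneseries_ge0 => n _ _; exact: g0.
rewrite integral_cst//= probability_setT mule1 integral_nneseries//.
apply: (@le_lt_trans _ _ ((u0 `^ p)%:E +
  ((2 * u0) `^ p * V u0 / (1 - b * z))%:E)%E);
  last by rewrite -EFinD ltry.
rewrite leeD2l//; apply: nneseries_geometric_le.
- by rewrite mulr_ge0 ?powR_ge0 ?tail_ge0.
- by rewrite bz mulr_gt0.
- by move=> j; apply: integral_ge0 => w _; exact: g0.
- move=> j; rewrite /g; under eq_integral do rewrite EFinM.
  have mt : measurable_fun setT
      (fun w => (\1_[set w | 2 ^+ j * u0 < enorm (X w)] w : R)%:E).
    by apply/measurable_EFinP; apply: measurable_indic; exact: measurable_tail.
  have t0 w : setT w -> (0 <= (\1_[set w | 2 ^+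
    j * u0 < enorm (X w)] w : R)%:E)%E.
    by rewrite lee_fin indicE ler0n.
  rewrite (ge0_integralZl_EFin P measurableT t0 mt) ?powR_ge0//.
  have -> : (\int[P]_w (\1_[set w | (2 ^+ j * u0 < enorm (X w))%R] w)%:E
      = (V (2 ^+ j * u0))%:E)%E.
    rewrite integral_indic//; last exact: measurable_tail.
    by rewrite setIT; apply: prE; exact: measurable_tail.
  rewrite -EFinM lee_fin.
  apply: (@le_trans _ _ ((2 ^+ j.+1 * u0) `^ p * (z ^+ j * V u0))).
    rewrite ler_wpM2l ?powR_ge0//.
    exact: (iter_upper u00 (ltW z0) Hu j (lexx _)).
  have -> : (2 ^+ j.+1 * u0) `^ p = b ^+ j * (2 * u0) `^ p.
    by rewrite exprSr -mulrA powRM ?exprn_ge0 ?mulr_ge0 ?(ltW u00)// powR_exprn.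
  rewrite exprMn.
  by rewrite le_eqVlt; apply/orP; left; apply/eqP; ring.
Qed.

End moments.

(** * Sums of truncated steps *)

Section exponential_inequalities.
Context {R : realType}.
Implicit Types x y n v p l : R.

(** From exp(- x) >= 1 - x comes exp x <= 1 + x exp x. For x >= 0 this bound is inserted into
    itself; for x < 0 the last exponential is replaced using exp x >= 1 + x. *)
Lemma expR_le_quadratic x : expR x <= 1 + x + x ^+ 2 * expR `|x|.
Proof.
have e1 : expR x <= 1 + x * expR x.
  have := expR_ge1Dx (- x); rewrite -(ler_pM2r (expR_gt0 x)) -expRD addNr expR0.
  by rewrite mulrBl mul1r lerBlDr.
have [x0|x0] := leP 0 x.
  have : x * expR x <= x * (1 + x * expR x) by rewrite ler_wpM2l.
  by rewrite ger0_norm// expr2; lra.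
have : x * expR x <= x * (1 + x) by rewrite ler_nM2l// expR_ge1Dx.
have : 1 <= expR `|x| by rewrite -[leLHS]expR0 ler_expR.
by have := sqr_ge0 x; nra.
Qed.

(** Only moments of order below alpha are known to be finite, and alpha may be less than 2: the
    missing power of n is paid by the truncation level v. *)
Lemma powR_interp n v p : 0 <= n <= v -> 0 < p <= 2 -> n ^+ 2 <=
  n `^ p * v `^ (2 - p).
Proof.
move=> /andP[n0 nv] /andP[p0 p2]; have [->|nn0] := eqVneq n 0.
  by rewrite expr2 mul0r mulr_ge0// powR_ge0.
have -> : n ^+ 2 = n `^ p * n `^ (2 - p).
  by rewrite -powR_mulrn// -powRD ?nn0 ?implybT// addrC subrK.
rewrite ler_wpM2l ?powR_ge0// ge0_ler_powR ?nnegrE ?subr_ge0//.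
exact: le_trans nv.
Qed.

Lemma powR_tail_interp n v p : 0 < v < n -> 1 <= p -> n <=
  n `^ p * v `^ (1 - p).
Proof.
move=> /andP[v0 vn] p1; have n0 := lt_trans v0 vn.
have {1}-> : n = n `^ p * n `^ (1 - p).
  by rewrite -powRD ?(gt_eqF n0) ?implybT// addrC subrK powRr1// ltW.
rewrite ler_wpM2l ?powR_ge0// -opprB !powRN lef_pV2 ?posrE ?powR_gt0//.
by apply: ge0_ler_powR; rewrite ?nnegrE ?subr_ge0// ltW.
Qed.

(** The linear term is kept exactly, since its mean will vanish. For n <= v the remainder is
    quadratic; for n > v the left side is 1 and l y may be as low as - l n. Both errors are
    expressed through n^p, whose mean is finite for p < alpha. *)
Lemma expR_truncated_le l v n y p : 0 <= l -> 0 < v -> 1 <= p <= 2 -> `|y| <=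
  n ->
  (if n <= v then expR (l * y) else 1) <=
  1 + l * y + (l * v `^ (1 - p) + l ^+ 2 * v `^ (2 - p) * expR (l * v)) * n `^
    p.
Proof.
move=> l0 v0 /andP[p1 p2] yn.
have n0 : 0 <= n by exact: le_trans yn.
have a1 : 0 <= l * v `^ (1 - p) * n `^ p by rewrite !mulr_ge0// powR_ge0.
have a2 : 0 <= l ^+ 2 * v `^ (2 - p) * expR (l * v) * n `^ p.
  by rewrite !mulr_ge0 ?powR_ge0 ?sqr_ge0 ?expR_ge0.
rewrite mulrDl; case: ifPn => [nv|]; last first.
  rewrite -ltNge => vn.
  have h := powR_tail_interp (p := p) (introT andP (conj v0 vn)) p1.
  have h1 : l * n <= l * (n `^ p * v `^ (1 - p)) by rewrite ler_wpM2l.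
  have h2 : - (l * n) <= l * y.
    by rewrite -mulrN ler_wpM2l//; move: yn; rewrite ler_norml => /andP[].
  have h3 : l * (n `^ p * v `^ (1 - p)) = l * v `^ (1 - p) * n `^ p by ring.
  by lra.
apply: (le_trans (expR_le_quadratic _)).
rewrite -addrA -[leRHS]addrA lerD2l lerD2l.
apply: (@le_trans _ _ (l ^+ 2 * v `^ (2 - p) * expR (l * v) * n `^ p));
  last first.
  by rewrite lerDr.
have h : n ^+ 2 <= n `^ p * v `^ (2 - p).
  by rewrite powR_interp// ?n0 ?p2 ?andbT// (lt_le_trans _ p1).
have -> : l ^+ 2 * v `^ (2 - p) * expR (l * v) * n `^ p =
  (l ^+ 2 * (n `^ p * v `^ (2 - p))) * expR (l * v) by ring.
apply: ler_pM; rewrite ?expR_ge0 ?sqr_ge0//.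
  rewrite exprMn ler_wpM2l ?sqr_ge0// (le_trans _ h)//.
  by rewrite -real_normK ?num_real// lerXn2r ?nnegrE.
by rewrite ler_expR normrM ger0_norm// ler_wpM2l// (le_trans yn).
Qed.

Lemma near_powRN_le (C e a : R) : 0 < a -> 0 < e -> 0 <= C ->
  \forall u \near +oo, C * u `^ (- a) <= e.
Proof.
move=> a0 e0 C0; near=> u.
have u0 : 0 < u by near: u; exact: near_pinfty_gt.
rewrite powRN ler_pdivrMr ?powR_gt0// mulrC -ler_pdivrMr//.
have -> : C / e = ((C / e) `^ a^-1) `^ a.
  by rewrite -powRrM mulVf ?gt_eqF// powRr1// divr_ge0// ltW.
apply: ge0_ler_powR; rewrite ?nnegrE ?powR_ge0 ?(ltW a0) ?(ltW u0)//.
Unshelve. all: by end_near. Qed.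

Lemma ln_le_powR (e u : R) : 0 < e -> 0 < u -> ln u <= e^-1 * u `^ e.
Proof.
move=> e0 u0; rewrite mulrC ler_pdivlMr// mulrC -ln_powR.
have := @le_ln1Dx R (u `^ e - 1); rewrite [1 + _]addrC subrK => /(_ _)/le_trans;
  apply.
  by rewrite ltrBDl subrr powR_gt0.
by rewrite gerBl.
Qed.

End exponential_inequalities.

(** * Exponential moments of truncated steps *)

Section truncated_exponential.
Context {R : realType} {d : nat}.
Local Notation BX := (Borel 'rV[R]_d).

(** The exponential of l times coordinate i of the step, the step being replaced by 0 beyond v. *)
Definition truncexp (l v : R) (i : 'I_d) (x : 'rV[R]_d) : R :=
  if `|x| <= v then expR (l * x ord0 i) else 1.

Lemma truncexp_ge0 l v i x : 0 <= truncexp l v i x.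
Proof. by rewrite /truncexp; case: ifP => // _; exact: expR_ge0. Qed.

Lemma truncexp_le (l v p : R) i x : 0 < v -> 1 <= p <= 2 ->
  truncexp l v i x <= 1 + l * x ord0 i +
    (`|l| * v `^ (1 - p) + `|l| ^+ 2 * v `^ (2 - p) * expR (`|l| * v)) *
      enorm x `^ p.
Proof.
move=> v0 p12.
(* The sign of l is moved to the coordinate, so that the scalar inequality is used with |l|. *)
have := @expR_truncated_le R `|l| v `|x| (Num.sg l * x ord0 i) p (normr_ge0 l)
  v0 p12.
rewrite mulrA [_ * Num.sg l]mulrC -numEsg => H.
have h : `|Num.sg l * x ord0 i| <= `|x|.
  rewrite normrM normr_sg; case: (l != 0); rewrite ?mul1r ?mul0r// norm_coord//.
apply: (le_trans (H h)); rewrite lerD2l ler_wpM2l//.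
  by rewrite addr_ge0// !mulr_ge0 ?powR_ge0 ?expR_ge0 ?sqr_ge0.
case/andP: p12 => p1 _; apply: ge0_ler_powR; rewrite ?nnegrE ?enorm_ge0//.
  exact: le_trans ler01 p1.
exact: norm_le_enorm.
Qed.

Lemma measurable_norm : measurable_fun setT (fun x : BX => `|x : 'rV[R]_d|).
Proof. by apply: continuous_borel => x; exact: norm_continuous. Qed.

Lemma measurable_truncexp l v i : measurable_fun setT (truncexp l v i : BX ->
  R).
Proof.
apply: measurable_fun_ifT => //.
- by apply: measurable_fun_ler => //; exact: measurable_norm.
- apply: measurableT_comp => //; apply: measurable_funM => //.
  exact: measurable_coord.
Qed.

Lemma prod_truncexp (l v : R) i (s : seq nat) (x : nat -> 'rV[R]_d) :
  (forall j, j \in s -> `|x j| <= v) ->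
  \prod_(j <- s) truncexp l v i (x j) = expR (l * (\sum_(j <- s) x j) ord0 i).
Proof.
move=> xs; rewrite summxE mulr_sumr expR_sum.
by apply: eq_big_seq => j js; rewrite /truncexp xs.
Qed.

End truncated_exponential.

Section iid_process.
Context {R : realType} {d : nat} {dT} {T : measurableType dT}
  {P : probability T R} {Z : nat -> {RV P >-> Borel 'rV[R]_d}} {alpha : R}
  {mu : {measure set (Borel 'rV[\bar R]_d) -> \bar R}}.
Hypothesis Z_iid : iid Z.
Hypothesis alpha_gt1 : 1 < alpha.
Hypothesis Z_RV : regularly_varying (Z 0%N) alpha mu.
Hypothesis Z_mean0 : forall i : 'I_d,
  ('E_P[fun w => (Z 0%N w : 'rV[R]_d) ord0 i] = 0)%E.
Local Notation BX := (Borel 'rV[R]_d).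
Local Notation V := (tail (Z 0%N)).

Let alpha_gt0 : 0 < alpha. Proof. exact: lt_trans alpha_gt1. Qed.

Lemma iid_integral (f : BX -> R) j : measurable_fun setT f ->
  (forall x, 0 <= f x) ->
  (\int[P]_w (f (Z j w))%:E = \int[P]_w (f (Z 0%N w))%:E)%E.
Proof.
move=> mf f0.
have pf k : (\int[P]_w (f (Z k w))%:E = \int[pushforward P (Z k)]_x (f x)%:E)%E.
  rewrite ge0_integral_pushforward//.
  - exact/measurable_EFinP.
  - by move=> x _; rewrite lee_fin.
rewrite !pf; apply: eq_measure_integral => B mB _.
by have [_ idZ] := Z_iid; exact: idZ.
Qed.

Lemma pr_iid j (B : set 'rV[R]_d) : measurable (B : set BX) ->
  pr P [set w | B (Z j w)] = pr P [set w | B (Z 0%N w)].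
Proof. by move=> mB; rewrite /pr; congr fine; have [_ idZ] := Z_iid;
  exact: idZ. Qed.

Definition enorm_moment (p : R) : R := fine
  (\int[P]_w (enorm (Z 0%N w) `^ p)%:E).

Lemma enorm_momentE p : 0 < p < alpha ->
  (\int[P]_w (enorm (Z 0%N w) `^ p)%:E = (enorm_moment p)%:E)%E.
Proof.
move=> pa; rewrite fineK// ge0_fin_numE;
  first exact: (moment_lty alpha_gt0 Z_RV).
by apply: integral_ge0 => w _; rewrite lee_fin powR_ge0.
Qed.

Lemma enorm_moment_ge0 p : 0 <= enorm_moment p.
Proof. by apply: fine_ge0; apply: integral_ge0 => w _;
  rewrite lee_fin powR_ge0. Qed.

(** The linear term of [truncexp_le] integrates to 0 since the steps are centred. *)
Lemma truncexp_moment (l v p : R) i j : 0 < v -> 1 < p < alpha -> p <= 2 ->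
  (\int[P]_w (truncexp l v i (Z j w))%:E <=
   (1 + (`|l| * v `^ (1 - p) + `|l| ^+ 2 * v `^ (2 - p) * expR (`|l| * v))
     * enorm_moment p)%:E)%E.
Proof.
move=> v0 /andP[p1 pa] p2; have p0 : 0 < p by exact: lt_trans p1.
rewrite iid_integral; [|exact: measurable_truncexp|exact: truncexp_ge0].
set D := (X in 1 + X * _).
have D0 : 0 <= D.
  by rewrite /D addr_ge0// !mulr_ge0 ?powR_ge0 ?expR_ge0 ?sqr_ge0.
pose y w : R := (Z 0%N w : 'rV[R]_d) ord0 i.
pose N w : R := enorm (Z 0%N w) `^ p.
have my : measurable_fun setT y.
  by apply: (@measurableT_comp _ _ _ _ _ _ (fun x : BX =>
    (x : 'rV[R]_d) ord0 i));
    [exact: measurable_coord|exact: measurable_funP].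
have mN : measurable_fun setT N by exact: measurable_enorm_powR.
have N0 w : 0 <= N w by exact: powR_ge0.
have yN w : `|y w| <= 1 + N w.
  apply: (le_trans (norm_coord _ _)); apply: (le_trans (norm_le_enorm _)).
  have [e1|e1] := leP (enorm (Z 0%N w)) 1; first by rewrite ler_wpDr.
  apply: ler_wpDl => //; rewrite /N -[leLHS]powRr1 ?enorm_ge0//.
  by rewrite ler_powR ?ltW.
have intN : P.-integrable setT (EFin \o N).
  apply/integrableP; split; first exact/measurable_EFinP.
  rewrite (eq_integral (EFin \o N)); last by move=> w _; rewrite /= ger0_norm.
  by apply: (moment_lty alpha_gt0 Z_RV); rewrite p0.
have int1 (c : R) : P.-integrable setT (EFin \o cst c).
  exact: finite_measure_integrable_cst.
have inty : P.-integrable setT (EFin \o y).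
  apply: (le_integrable measurableT _ _ (integrableD measurableT (int1 1)
    intN)).
    exact/measurable_EFinP.
  move=> w _ /=; rewrite lee_fin (le_trans (yN w))//.
  by rewrite ger0_norm// addr_ge0.
have intly : P.-integrable setT (fun w => (l * y w)%:E).
  by under eq_fun do rewrite EFinM; exact: integrableZl.
have intDN : P.-integrable setT (fun w => (D * N w)%:E).
  by under eq_fun do rewrite EFinM; exact: integrableZl.
have int1ly := integrableD measurableT (int1 1) intly.
apply: (@le_trans _ _ (\int[P]_w ((1 + l * y w)%:E + (D * N w)%:E))%E).
  apply: ge0_le_integral => //.
  - by move=> w _; rewrite lee_fin truncexp_ge0.
  - apply/measurable_EFinP; apply: (@measurableT_comp _ _ _ _ _ _
    (truncexp l v i : BX -> R)).
      exact: measurable_truncexp.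
    exact: measurable_funP.
  - apply: emeasurable_funD; first by apply: measurable_int int1ly.
    exact: measurable_int intDN.
  - move=> w _; rewrite -EFinD lee_fin; apply: truncexp_le => //.
    by rewrite (ltW p1) p2.
rewrite integralD//.
under eq_integral do rewrite EFinD.
rewrite integralD//; last exact: int1.
rewrite integral_cst//= probability_setT mule1.
rewrite (_ : \int[P]_w (l * y w)%:E = 0)%E; last first.
  under eq_integral do rewrite EFinM.
  rewrite integralZl//; have := Z_mean0 i; rewrite unlock => ->.
  by rewrite mule0.
under eq_integral do rewrite EFinM.
rewrite integralZl// enorm_momentE ?p0//.
by rewrite adde0 -EFinM -EFinD.
Qed.

End iid_process.

Lemma prode_le_expR {R : realType} (s : seq nat) (a : nat -> \bar R) (y : R) :
  (forall i, (0 <= a i)%E) -> (forall i, i \in s -> (a i <= (expR y)%:E)%E) ->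
  (\prod_(i <- s) a i <= (expR ((size s)%:R * y))%:E)%E.
Proof.
move=> a0; elim: s => [|i s IH] as_; first by rewrite big_nil mul0r expR0.
rewrite big_cons /= -natr1 mulrDl mul1r expRD mulrC EFinM lee_pmul//.
- by apply: prode_ge0.
- by apply: as_; rewrite mem_head.
- by apply: IH => j js; apply: as_; rewrite inE js orbT.
Qed.

(** * Chernoff's bound in the presence of a further step *)

Section chernoff.
Context {R : realType} {d : nat} {dT} {T : measurableType dT}
  {P : probability T R} {Z : nat -> {RV P >-> Borel 'rV[R]_d}} {alpha : R}
  {mu : {measure set (Borel 'rV[\bar R]_d) -> \bar R}}.
Hypothesis Z_iid : iid Z.
Hypothesis alpha_gt1 : 1 < alpha.
Hypothesis Z_RV : regularly_varying (Z 0%N) alpha mu.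
Hypothesis Z_mean0 : forall i : 'I_d,
  ('E_P[fun w => (Z 0%N w : 'rV[R]_d) ord0 i] = 0)%E.
Local Notation BX := (Borel 'rV[R]_d).
Local Notation V := (tail (Z 0%N)).

Definition partial_sum (s : seq nat) (w : T) : 'rV[R]_d :=
  \sum_(i <- s) (Z i w : 'rV[R]_d).

Lemma measurable_partial_sum s : measurable_fun setT (partial_sum s : T -> BX).
Proof.
apply: measurable_fun_rV => j; rewrite /partial_sum.
under eq_fun do rewrite summxE.
apply: measurable_sum => i.
by apply: (@measurableT_comp _ _ _ _ _ _ (fun x : BX => (x : 'rV[R]_d) ord0 j));
  [exact: measurable_coord|exact: measurable_funP].
Qed.

Lemma measurable_norm_le (Y : T -> 'rV[R]_d) v : measurable_fun setT (Y : T ->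
  BX) ->
  measurable [set w | `|Y w| <= v].
Proof.
move=> mY; apply: (@measurable_event _ _ _ _ Y [set x | `|x| <= v]) => //.
by apply: closed_borel; apply: (@closed_sublevel _ _ (fun x : 'rV[R]_d => `|x|))
  => x;
  exact: norm_continuous.
Qed.

Lemma measurable_norm_gt (Y : T -> 'rV[R]_d) v : measurable_fun setT (Y : T ->
  BX) ->
  measurable [set w | v < `|Y w|].
Proof.
move=> mY; rewrite (_ : [set w | _] = ~` [set w | `|Y w| <= v]).
  by apply: measurableC; exact: measurable_norm_le.
by apply/seteqP; split => w /=; rewrite ltNge => /negP.
Qed.

Lemma measurable_all_small (s : seq nat) v :
  measurable [set w | forall i, i \in s -> `|Z i w : 'rV[R]_d| <= v].
Proof.
rewrite (_ : [set w | _] = \bigcap_(i in [set` s])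
  [set w | `|Z i w : 'rV[R]_d| <= v]).
  apply: fin_bigcap_measurable => [|i _]; first exact: finite_seq.
  exact: (@measurable_norm_le (Z i)).
by apply/seteqP; split => w h i; exact: h.
Qed.

Lemma measurable_chernoff_event (l v b : R) c k (s : seq nat) (B : set 'rV[R]_d)
  :
  measurable (B : set BX) ->
  measurable [set w | [/\ B (Z k w), forall i, i \in s -> `|Z i w : 'rV[R]_d| <=
    v &
                 b < l * partial_sum s w ord0 c]].
Proof.
move=> mB.
have mZB : measurable [set w | B (Z k w)].
  by apply: (@measurable_event _ _ _ _ (Z k)).
have ml : measurable [set w | b < l * partial_sum s w ord0 c].
  rewrite (_ : [set w | _] = (fun w => l * partial_sum s w ord0 c) @^-1` `]b,
    +oo[%classic).
    rewrite -[X in measurable X]setTI.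
    have : measurable_fun setT (fun w => l * partial_sum s w ord0 c).
      apply: measurable_funM => //.
      apply: (@measurableT_comp _ _ _ _ _ _ (fun x : BX =>
        (x : 'rV[R]_d) ord0 c));
      [exact: measurable_coord|exact: measurable_partial_sum].
    by apply.
  by apply/seteqP; split => w /=; rewrite in_itv/= andbT.
rewrite (_ : [set w | _] = [set w | B (Z k w)] `&`
   ([set w | forall i, i \in s -> `|Z i w : 'rV[R]_d| <= v] `&`
   [set w | b < l * partial_sum s w ord0 c])).
  by apply: measurableI => //; apply: measurableI => //;
    exact: measurable_all_small.
by apply/seteqP; split => w [] // ? [].
Qed.

Lemma measurable_deviation_event (v a : R) k (s : seq nat) (B : set 'rV[R]_d) :
  measurable (B : set BX) ->
  measurable [set w | [/\ B (Z k w), forall i, i \in s -> `|Z i w : 'rV[R]_d| <=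
    v &
                 a < `|partial_sum s w|]].
Proof.
move=> mB; rewrite (_ : [set w | _] = [set w | B (Z k w)] `&`
   ([set w | forall i, i \in s -> `|Z i w : 'rV[R]_d| <= v] `&`
   [set w | a < `|partial_sum s w|])).
  apply: measurableI; first by apply: (@measurable_event _ _ _ _ (Z k)).
  apply: measurableI; first exact: measurable_all_small.
  by apply: measurable_norm_gt; exact: measurable_partial_sum.
by apply/seteqP; split => w [] // ? [].
Qed.

(** Markov's inequality for the exponential of the sum, multiplied by the indicator of [B (Z k)]: as
    k is not in [s], the probability of B splits off as a factor. *)
Lemma chernoff_bound (l v p b : R) c k (s : seq nat) (B : set 'rV[R]_d) :
  0 < v -> 1 < p < alpha -> p <= 2 ->
  uniq s -> k \notin s -> measurable (B : set BX) ->
  pr P [set w | [/\ B (Z k w), forall i, i \in s -> `|Z i w : 'rV[R]_d| <= v &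
                 b < l * partial_sum s w ord0 c]] <=
  expR (- b + (size s)%:R * (`|l| * v `^ (1 - p) +
     `|l| ^+ 2 * v `^ (2 - p) * expR (`|l| * v)) * enorm_moment (Z := Z) p) *
   pr P [set w | B (Z 0%N w)].
Proof.
move=> v0 p1 p2 us ks mB.
set D := `|l| * v `^ (1 - p) + `|l| ^+ 2 * v `^ (2 - p) * expR (`|l| * v).
have D0 : 0 <= D.
  by rewrite /D addr_ge0// !mulr_ge0 ?powR_ge0 ?expR_ge0 ?sqr_ge0.
set F := [set w | _].
have mF : measurable F by exact: measurable_chernoff_event.
have mZB : measurable [set w | B (Z k w)].
  by apply: (@measurable_event _ _ _ _ (Z k)).
(* One family holds both the indicator, at k, and the exponentials, on [s], so a single product
   formula covers them. *)
pose f i : BX -> R := if i == k then \1_B else truncexp l v c.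
have mf i : measurable_fun setT (f i).
  by rewrite /f; case: ifP => _; [exact: measurable_indic|exact:
    measurable_truncexp].
have f0 i x : 0 <= f i x.
  by rewrite /f; case: ifP => _; [rewrite indicE ler0n|exact: truncexp_ge0].
have fk : f k = \1_B by rewrite /f eqxx.
have fs i : i \in s -> f i = truncexp l v c.
  by move=> si; rewrite /f; case: eqP => // ik; rewrite -ik si in ks.
have intk : (\int[P]_w (f k (Z k w))%:E)%E = (pr P [set w | B (Z 0%N w)])%:E.
  rewrite fk -(pr_iid Z_iid k mB) -prE//.
  transitivity (\int[P]_w (\1_[set w | B (Z k w)] w)%:E)%E;
    first exact: eq_integral.
  by rewrite integral_indic// setIT.
have ints i : i \in s -> (\int[P]_w (f i (Z i w))%:E <=
  (expR (D * enorm_moment (Z := Z) p))%:E)%E.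
  move=> si; rewrite fs//.
  apply: (le_trans (truncexp_moment Z_iid alpha_gt1 Z_RV Z_mean0 _ _ _ v0 p1
    p2)).
  by rewrite lee_fin expR_ge1Dx.
have prodf w : \prod_(i <- k :: s) f i (Z i w) =
    \1_B (Z k w) * \prod_(i <- s) truncexp l v c (Z i w).
  by rewrite big_cons fk; congr (_ * _); apply: eq_big_seq => i si; rewrite fs.
have int0 i : (0 <= \int[P]_w (f i (Z i w))%:E)%E.
  by apply: integral_ge0 => w _; rewrite lee_fin.
have intprod : (\int[P]_w (\prod_(i <- k :: s) f i (Z i w))%:E <=
   (pr P [set w | B (Z 0%N w)] * expR ((size s)%:R * D * enorm_moment (Z :=
     Z) p))%:E)%E.
  rewrite (prod_integral (proj1 Z_iid))//=; last 2 first.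
  - by rewrite ks.
  - move=> i; rewrite inE => /orP[/eqP->|si]; first by rewrite intk ltry.
    by rewrite (le_lt_trans (ints _ si))// ltry.
  rewrite big_cons intk EFinM lee_wpmul2l// ?lee_fin ?pr_ge0//.
  by rewrite -mulrA; apply: prode_le_expR.
rewrite -lee_fin -prE//.
have -> : P F = (\int[P]_w (\1_F w)%:E)%E by rewrite integral_indic// setIT.
apply: (@le_trans _ _ (\int[P]_w ((expR (- b))%:E *
  (\prod_(i <- k :: s) f i (Z i w))%:E))%E).
  apply: ge0_le_integral => //.
  - by apply/measurable_EFinP; exact: measurable_indic.
  - apply: emeasurable_funM => //; apply/measurable_EFinP.
    exact: measurable_prod_comp.
  - move=> w _; rewrite -EFinM lee_fin indicE; case: (boolP (w \in F)) => wF;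
    last first.
      by rewrite mulr_ge0 ?expR_ge0// prodr_ge0.
    move: wF; rewrite inE => -[Bw small bl].
    rewrite prodf indicE mem_set// mul1r prod_truncexp//
      -expRD -[leLHS]expR0 ler_expR.
    by rewrite addrC subr_ge0 ltW.
have mt : measurable_fun setT (fun w => (\prod_(i <- k :: s) f i (Z i w))%:E).
  by apply/measurable_EFinP; exact: measurable_prod_comp.
have t0 w : setT w -> (0 <= (\prod_(i <- k :: s) f i (Z i w))%:E)%E.
  by rewrite lee_fin prodr_ge0.
rewrite (ge0_integralZl_EFin P measurableT t0 mt) ?expR_ge0//.
rewrite expRD -mulrA EFinM lee_wpmul2l// ?lee_fin ?expR_ge0//.
by rewrite mulrC.
Qed.

End chernoff.

Section truncated_deviation.
Context {R : realType} {d : nat} {dT} {T : measurableType dT}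
  {P : probability T R} {Z : nat -> {RV P >-> Borel 'rV[R]_d}} {alpha : R}
  {mu : {measure set (Borel 'rV[\bar R]_d) -> \bar R}}.
Hypothesis Z_iid : iid Z.
Hypothesis alpha_gt1 : 1 < alpha.
Hypothesis Z_RV : regularly_varying (Z 0%N) alpha mu.
Hypothesis Z_mean0 : forall i : 'I_d,
  ('E_P[fun w => (Z 0%N w : 'rV[R]_d) ord0 i] = 0)%E.
Local Notation BX := (Borel 'rV[R]_d).
Local Notation V := (tail (Z 0%N)).
Local Notation S := (partial_sum (Z := Z)).

(** Here exp(l v) = u^(L th), so up to powers of ln u the two terms, once multiplied by u, have
    orders u^(1 - p) and u^(1 - p + L th); the bound on [L * th] keeps both exponents negative. *)
Lemma near_chernoff_exponent (L M th p K : R) : 0 < L -> 0 <= M -> 0 < th ->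
  0 <= K ->
  1 < p -> L * th <= (p - 1) / 4 ->
  \forall u \near +oo, let l := L * ln u / u in let v := th * u in
    M * u * (`|l| * v `^ (1 - p) + `|l| ^+
      2 * v `^ (2 - p) * expR (`|l| * v)) * K <= 1.
Proof.
move=> L0 M0 th0 K0 p1 Lth.
pose g := p - 1; have g0 : 0 < g by rewrite subr_gt0.
(* Each ln u costs u^e. The worse exponent is 2 e - g + L th <= g / 4 - g + g / 4 = - g / 2. *)
pose e := g / 8; have e0 : 0 < e by rewrite divr_gt0.
pose C1 := L * th `^ (1 - p) * e^-1.
pose C2 := L ^+ 2 * th `^ (2 - p) * e^-1 ^+ 2.
have C10 : 0 <= C1 by rewrite !mulr_ge0 ?powR_ge0 ?invr_ge0 ?ltW.
have C20 : 0 <= C2 by rewrite !mulr_ge0 ?powR_ge0 ?exprn_ge0 ?invr_ge0 ?ltW.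
near=> u; have u1 : 1 < u by near: u; exact: near_pinfty_gt.
have u0 : 0 < u by exact: lt_trans u1.
have lu0 : 0 < ln u by rewrite ln_gt0.
have lue : ln u <= e^-1 * u `^ e by exact: ln_le_powR.
have l0 : 0 <= L * ln u / u by rewrite !mulr_ge0 ?invr_ge0 ?ltW.
rewrite /= ger0_norm//.
have t1 : u * (L * ln u / u * (th * u) `^ (1 - p)) <= C1 * u `^ (- (g / 2)).
  rewrite powRM ?(ltW th0) ?(ltW u0)//.
  have -> : u * (L * ln u / u * (th `^ (1 - p) * u `^ (1 - p))) =
     L * th `^ (1 - p) * (ln u * u `^ (1 - p)).
    by field; rewrite gt_eqF.
  rewrite /C1 -[leRHS]mulrA ler_wpM2l ?mulr_ge0 ?powR_ge0 ?(ltW L0)//.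
  apply: (@le_trans _ _ (e^-1 * u `^ e * u `^ (1 - p))).
    by rewrite ler_wpM2r ?powR_ge0.
  rewrite -mulrA ler_wpM2l ?invr_ge0 ?(ltW e0)// -powRD;
    last by rewrite (gt_eqF u0) implybT.
  by rewrite ler_powR ?(ltW u1)// /e /g; lra.
have t2 : u * ((L * ln u / u) ^+ 2 * (th * u) `^ (2 - p) * expR
  (L * ln u / u * (th * u)))
    <= C2 * u `^ (- (g / 2)).
  have -> : expR (L * ln u / u * (th * u)) = u `^ (L * th).
    by rewrite /powR gt_eqF//; congr expR; field; rewrite gt_eqF.
  rewrite powRM ?(ltW th0) ?(ltW u0)//.
  have -> : u * ((L * ln u / u) ^+ 2 * (th `^ (2 - p) * u `^ (2 - p)) * u `^
    (L * th)) =
     L ^+ 2 * th `^ (2 - p) * (ln u ^+ 2 *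
       (u `^ (- 1) * u `^ (2 - p) * u `^ (L * th))).
    by rewrite powR_inv1 ?(ltW u0)//; field; rewrite gt_eqF.
  rewrite /C2 -[leRHS]mulrA ler_wpM2l ?mulr_ge0 ?powR_ge0 ?sqr_ge0 ?(ltW L0)//.
  rewrite -!powRD ?(gt_eqF u0) ?implybT//.
  apply: (@le_trans _ _ ((e^-1 * u `^ e) ^+ 2 * u `^ (-1 + (2 - p) + L * th))).
    rewrite ler_wpM2r ?powR_ge0// lerXn2r ?nnegrE ?mulr_ge0 ?powR_ge0 ?invr_ge0
      ?(ltW e0)//.
    exact: ltW.
  rewrite exprMn -[leLHS]mulrA ler_wpM2l ?sqr_ge0//
    expr2 -!powRD ?(gt_eqF u0) ?implybT//.
  by rewrite ler_powR ?(ltW u1)// /e /g; lra.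
rewrite [leLHS](_ : _ = M * K * (u * (L * ln u / u * (th * u) `^ (1 - p)) +
    u * ((L * ln u / u) ^+ 2 * (th * u) `^ (2 - p) * expR
      (L * ln u / u * (th * u))))); last by ring.
apply: (@le_trans _ _ (M * K * (C1 * u `^ (- (g / 2)) +
  C2 * u `^ (- (g / 2))))).
  by rewrite ler_wpM2l ?mulr_ge0// lerD.
rewrite -mulrDl mulrA; near: u; apply: near_powRN_le => //.
  by rewrite divr_gt0.
by apply: mulr_ge0; [exact: mulr_ge0|exact: addr_ge0].
Unshelve. all: by end_near. Qed.

(* Chernoff's bound with parameter l = L ln u / u: truncation at th * u makes
   the moment generating factors bounded, and expR (- l * kap * u) is the power
   u ^ (- L * kap), which is negligible for L large. *)
Lemma truncated_deviation (kap M : R) : 0 < kap -> 0 <= M ->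
  exists2 th0, 0 < th0 & forall th, 0 < th <= th0 ->
  \forall u \near +oo, forall k (s : seq nat) (B : set 'rV[R]_d),
    uniq s -> (size s)%:R <= M * u -> k \notin s -> measurable (B : set BX) ->
    pr P [set w | [/\ B (Z k w), forall i, i \in s -> `|Z i w : 'rV[R]_d| <=
      th * u &
                    kap * u < `|S s w|]] <=
    V u / u * pr P [set w | B (Z 0%N w)].
Proof.
move=> kap0 M0; have a1 := alpha_gt1.
(* Any exponent with 1 < p < alpha and p <= 2 would do. *)
pose p := Num.min ((1 + alpha) / 2) (3 / 2).
have p1 : 1 < p by rewrite lt_min; apply/andP; split; lra.
have pa : p < alpha by rewrite gt_min; apply/orP; left; lra.
have p2 : p <= 2 by rewrite ge_min; apply/orP; right; lra.
(* V u dominates a multiple of u^(- q0) since q0 > alpha. Of the two extra powers of 1 / u, one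
   produces V u / u and the other beats the constants. *)
pose q0 := alpha + 1; pose L := (q0 + 2) / kap.
have L0 : 0 < L by rewrite divr_gt0// /q0; lra.
exists ((p - 1) / 4 / L); first by rewrite divr_gt0// divr_gt0// subr_gt0.
move=> th /andP[th0 thth0].
have Lth : L * th <= (p - 1) / 4 by rewrite mulrC -ler_pdivlMr.
have K0 := enorm_moment_ge0 (Z := Z) p.
have [C C0 VC] := tail_lower_bound (lt_trans ltr01 alpha_gt1) Z_RV (p :=
  q0) ltac:(by rewrite ltrDl).
have near1 := near_chernoff_exponent L0 M0 th0 K0 p1 Lth.
near=> u => k s B us su ks mB.
have u1 : 1 < u by near: u; exact: near_pinfty_gt.
have u0 : 0 < u by exact: lt_trans u1.
have lu0 : 0 < ln u by rewrite ln_gt0.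
have l_gt0 : 0 < L * ln u / u by exact: divr_gt0 (mulr_gt0 L0 lu0) u0.
have l0 := ltW l_gt0.
set l := L * ln u / u in l0 l_gt0.
pose b := (q0 + 2) * ln u.
have lb : l * (kap * u) = b.
  by rewrite /l /b /L; field; rewrite !gt_eqF.
(* A large sup norm means that some coordinate is large with some sign: 2 d one-sided events. *)
pose F (ci : 'I_d * bool) := [set w | [/\ B (Z k w),
   forall i, i \in s -> `|Z i w : 'rV[R]_d| <= th * u &
   b < ((-1) ^+ ci.2 * l) * S s w ord0 ci.1]].
have mF ci : measurable (F ci) by exact: measurable_chernoff_event.
have Fle ci : pr P (F ci) <= expR 1 * u `^ (- (q0 + 2)) * pr P
  [set w | B (Z 0%N w)].
  have := @chernoff_bound _ _ _ _ _ _ _ _ Z_iid alpha_gt1 Z_RV Z_mean0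
    ((-1) ^+ ci.2 * l) (th * u) p b ci.1 k s B (mulr_gt0 th0 u0) _ p2 us ks mB.
  rewrite p1 pa => /(_ isT) /le_trans; apply.
  have -> : u `^ (- (q0 + 2)) = expR (- b) by rewrite /powR gt_eqF// mulNr.
  rewrite ler_wpM2r ?pr_ge0// -expRD ler_expR.
  rewrite normrM normrX normrN1 expr1n mul1r addrC.
  rewrite lerD2r; pose D := `|l| * (th * u) `^ (1 - p) +
    `|l| ^+ 2 * (th * u) `^ (2 - p) * expR (`|l| * (th * u)).
  have DK : M * u * D * enorm_moment (Z := Z) p <= 1 by rewrite /D /l; near: u.
  apply: le_trans DK; rewrite ler_wpM2r// ler_wpM2r//.
  by rewrite addr_ge0// !mulr_ge0 ?powR_ge0 ?expR_ge0.
have sub : [set w | [/\ B (Z k w), forall i, i \in s -> `|Z i w : 'rV[R]_d| <=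
  th * u &
       kap * u < `|S s w|]] `<=`
    [set w | exists2 ci, ci \in enum {: 'I_d * bool} & F ci w].
  move=> w [Bw small kS].
  have [i Si] : exists i, kap * u < `|S s w ord0 i|.
    apply: contrapT => nS; move: kS; rewrite ltNge => /negP; apply.
    apply: norm_rV_le => [|i]; first by rewrite mulr_ge0 ?ltW.
    by rewrite leNgt; apply/negP => h; apply: nS; exists i.
  exists (i, S s w ord0 i < 0); first by rewrite mem_enum.
  split => //=; rewrite -lb [_ * l]mulrC -[ltRHS]mulrA ltr_pM2l//.
  by rewrite -normrEsign.
have mS : measurable [set w | [/\ B (Z k w),
    forall i, i \in s -> `|Z i w : 'rV[R]_d| <= th * u & kap * u < `|S s w|]].
  exact: measurable_deviation_event.
apply: (le_trans (le_pr P mS (measurable_ex_seq _ mF) sub)).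
apply: (le_trans (pr_bigcup_le P _ mF)).
apply: (@le_trans _ _ (\sum_(ci <- enum {: 'I_d * bool})
    expR 1 * u `^ (- (q0 + 2)) * pr P [set w | B (Z 0%N w)])).
  exact: ler_sum.
rewrite big_const_seq count_predT iter_addr addr0.
set n := size _; rewrite -[leLHS]mulr_natl mulrA ler_wpM2r ?pr_ge0//.
have Vu : C * u `^ (- q0) <= V u by near: u.
rewrite ler_pdivlMr//; apply: le_trans Vu.
have -> : n%:R * (expR 1 * u `^ (- (q0 + 2))) * u =
  u `^ (- q0) * (n%:R * expR 1 * u `^ (- 1)).
  rewrite opprD powRD ?(gt_eqF u0) ?implybT// (_ : -2 = -1 + -1); last by ring.
  rewrite powRD ?(gt_eqF u0) ?implybT// powR_inv1 ?(ltW u0)//; field.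
  by rewrite gt_eqF.
rewrite [leRHS]mulrC ler_wpM2l ?powR_ge0//.
near: u; apply: near_powRN_le => //.
Unshelve. all: by end_near. Qed.

End truncated_deviation.

(** * The principle of one big jump *)

Section one_big_jump.
Context {R : realType} {d : nat} {dT} {T : measurableType dT}
  {P : probability T R} {Z : nat -> {RV P >-> Borel 'rV[R]_d}} {alpha : R}
  {mu : {measure set (Borel 'rV[\bar R]_d) -> \bar R}}.
Hypothesis Z_iid : iid Z.
Hypothesis alpha_gt1 : 1 < alpha.
Hypothesis Z_RV : regularly_varying (Z 0%N) alpha mu.
Hypothesis Z_mean0 : forall i : 'I_d,
  ('E_P[fun w => (Z 0%N w : 'rV[R]_d) ord0 i] = 0)%E.
Local Notation BX := (Borel 'rV[R]_d).
Local Notation V := (tail (Z 0%N)).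
Local Notation S := (partial_sum (Z := Z)).

Let alpha_gt0 : 0 < alpha. Proof. exact: lt_trans alpha_gt1. Qed.

Lemma tail_markov p u : 0 < p < alpha -> 0 < u ->
  V u <= enorm_moment (Z := Z) p * u `^ (- p).
Proof.
move=> /andP[p0 pa] u0; rewrite powRN -ler_pdivrMr ?invr_gt0 ?powR_gt0// invrK.
have mt := measurable_tail (Z 0%N) u.
rewrite -lee_fin -(enorm_momentE alpha_gt1 Z_RV) ?p0//.
have -> : (V u * u `^ p)%:E =
    (\int[P]_w ((u `^ p)%:E * (\1_[set w | (u < enorm (Z 0%N w))%R] w)%:E))%E.
  have m1 : measurable_fun setT
      (fun w => (\1_[set w | u < enorm (Z 0%N w)] w : R)%:E).
    by apply/measurable_EFinP; exact: measurable_indic.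
  have t0 w : setT w -> (0 <= (\1_[set w | u < enorm (Z 0%N w)] w : R)%:E)%E.
    by rewrite lee_fin indicE ler0n.
  rewrite (ge0_integralZl_EFin P measurableT t0 m1) ?powR_ge0// mulrC EFinM.
  congr (_ * _)%E; rewrite -prE//.
  by rewrite integral_indic// setIT.
apply: ge0_le_integral => //.
- by move=> w _; rewrite mule_ge0// lee_fin ?powR_ge0// indicE ler0n.
- apply: emeasurable_funM => //; apply/measurable_EFinP.
  exact: measurable_indic.
- by apply/measurable_EFinP; exact: measurable_enorm_powR.
- move=> w _; rewrite -EFinM lee_fin indicE; case: (boolP (w \in _)).
    rewrite inE/= => h; rewrite mulr1; apply: ge0_ler_powR;
      rewrite ?nnegrE ?enorm_ge0 ?(ltW u0) ?(ltW p0)//.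
    exact: ltW.
  by rewrite mulr0 powR_ge0.
Qed.

(** Since alpha > 1, a moment of some order p > 1 is finite and u V(u) = O(u^(1 - p)). *)
Lemma near_utail (e : R) : 0 < e -> \forall u \near +oo, u * V u <= e.
Proof.
move=> e0; pose p := (1 + alpha) / 2; have a1 := alpha_gt1.
have p1 : 1 < p by rewrite /p; lra.
have pa : p < alpha by rewrite /p; lra.
near=> u; have u0 : 0 < u by near: u; exact: near_pinfty_gt.
apply: (@le_trans _ _ (u * (enorm_moment (Z := Z) p * u `^ (- p)))).
  by rewrite ler_wpM2l ?(ltW u0)// tail_markov// pa (lt_trans ltr01 p1).
rewrite mulrCA -{1}(powRr1 (ltW u0)) -powRD ?(gt_eqF u0) ?implybT//.
rewrite -[1 - p]opprB; near: u; apply: near_powRN_le => //.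
  by rewrite subr_gt0.
exact: enorm_moment_ge0.
Unshelve. all: by end_near. Qed.

Lemma pr_norm_gt i v : pr P [set w | v < `|Z i w : 'rV[R]_d|] <= V v.
Proof.
have mB : measurable ([set x : 'rV[R]_d | v < `|x|] : set BX).
  apply: open_borel.
  have /continuousP := @norm_continuous R 'rV[R]_d.
  by move=> /(_ _ (@open_gt R v)).
rewrite (pr_iid Z_iid i mB); apply: le_pr => //.
- exact: (@measurable_event _ _ _ _ (Z 0%N)).
- exact: measurable_tail.
- by move=> w /= h; rewrite (lt_le_trans h)// norm_le_enorm.
Qed.

Lemma pr_indep2 i k (B C : set 'rV[R]_d) : i != k ->
  measurable (B : set BX) -> measurable (C : set BX) ->
  pr P [set w | B (Z k w) /\ C (Z i w)] =
    pr P [set w | B (Z 0%N w)] * pr P [set w | C (Z i w)].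
Proof.
move=> ik mB mC; have [indZ _] := Z_iid.
have := indZ [:: k; i] (fun j => if j == k then B else C).
rewrite /= inE eq_sym ik => /(_ isT) H.
have {}H := H (fun j => ltac:(by case: ifP)).
apply: EFin_inj; rewrite EFinM -(pr_iid Z_iid k mB).
rewrite -!prE; first last.
- by apply: measurableI; exact: (@measurable_event _ _ _ _ (Z _)).
- exact: (@measurable_event _ _ _ _ (Z k)).
- exact: (@measurable_event _ _ _ _ (Z i)).
move: H; rewrite big_cons big_cons big_nil mule1 eqxx (negPf ik) => <-.
congr (P _); apply/seteqP; split => w /=.
  move=> [Bk Ci] j /=; rewrite !inE => /orP[/eqP ->|/eqP ->].
    by rewrite /preimage/= eqxx.
  by rewrite /preimage/= (negPf ik).
move=> h; split.
  by have := h k; rewrite /= !inE eqxx /preimage/= => /(_ isT).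
by have := h i; rewrite /= !inE eqxx orbT /preimage/= (negPf ik) => /(_ isT).
Qed.

(** For n < k nothing is removed, so on undisturbed events the whole walk before time k is small as
    well. *)
Definition others (k n : nat) := [seq i <- iota 1 n | i != k].

Lemma others_uniq k n : uniq (others k n).
Proof. by rewrite filter_uniq// iota_uniq. Qed.

Lemma size_others k n : (size (others k n) <= n)%N.
Proof. by rewrite size_filter (leq_trans (count_size _ _))// size_iota. Qed.

Lemma notin_others k n : k \notin others k n.
Proof. by rewrite mem_filter eqxx. Qed.

Lemma others_sub k n N : (n <= N)%N -> {subset others k n <= others k N}.
Proof.
move=> nN i; rewrite !mem_filter !mem_iota => /andP[-> /andP[-> h]]/=.
by rewrite (leq_trans h)// leq_add2l.
Qed.

(* Off this event, Z k is the only possible large step among the first N, and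
   the other steps do not contribute at scale b. *)
Definition disturbed (k N : nat) (v b : R) : set T :=
  [set w | exists2 i, i \in others k N & v < `|Z i w : 'rV[R]_d|] `|`
  [set w | exists2 n, n \in iota 0 N.+1 & b < `|S (others k n) w|].

Lemma measurable_disturbed k N v b : measurable (disturbed k N v b).
Proof.
apply: measurableU; apply: measurable_ex_seq => i.
  exact: (@measurable_norm_gt _ _ _ _ (Z i)).
by apply: measurable_norm_gt; exact: measurable_partial_sum.
Qed.

(** A second large step costs at most N V(th u), of order u V(th u), which tends to 0. Without one,
    each of the N + 1 sums deviates with conditional probability at most V u / u. Independence makes
    both bounds relative to P(Z in B). *)
Lemma disturbed_le (eta M : R) : 0 < eta -> 0 <= M ->
  exists2 th0, 0 < th0 & forall th e, 0 < th <= th0 -> 0 < e ->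
  \forall u \near +oo, forall k N (B : set 'rV[R]_d), N%:R <= M * u ->
    measurable (B : set BX) ->
    pr P ([set w | B (Z k w)] `&` disturbed k N (th * u) (eta * u)) <=
    e * pr P [set w | B (Z 0%N w)].
Proof.
move=> eta0 M0.
have [th0 th00 H] := truncated_deviation Z_iid alpha_gt1 Z_RV Z_mean0 eta0 M0.
exists th0 => // th e th_th0 e0.
have th_gt0 : 0 < th by case/andP: th_th0.
have e2 : 0 < e / 2 by rewrite divr_gt0.
have near1 := H th th_th0.
have near2 := near_pinftyM th_gt0 (near_utail (e := e / 2 * th / (M + 1))
   ltac:(by rewrite !divr_gt0 ?mulr_gt0// ltr_wpDl)).
have near3 := near_utail (e := e / 2 / (M + 1)) ltac:(by rewrite !divr_gt0//
  ltr_wpDl).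
near=> u => k N B NM mB.
have u1 : 1 < u by near: u; exact: near_pinfty_gt.
have u0 : 0 < u by exact: lt_trans u1.
set pB := pr P [set w | B (Z 0%N w)].
have pB0 : 0 <= pB by exact: pr_ge0.
have mZB : measurable [set w | B (Z k w)]
  by exact: (@measurable_event _ _ _ _ (Z k)).
pose F i := [set w | B (Z k w) /\ th * u < `|Z i w : 'rV[R]_d|].
pose G n := [set w | [/\ B (Z k w), forall i, i \in others k n ->
  `|Z i w : 'rV[R]_d| <= th * u &
   eta * u < `|S (others k n) w|]].
have mF i : measurable (F i).
  by apply: measurableI => //; exact: (@measurable_norm_gt _ _ _ _ (Z i)).
have mG n : measurable (G n) by exact: measurable_deviation_event.
have sub : [set w | B (Z k w)] `&` disturbed k N (th * u) (eta * u) `<=`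
  [set w | exists2 i, i \in others k N & F i w] `|`
  [set w | exists2 n, n \in iota 0 N.+1 & G n w].
  move=> w [Bw /= h].
  have [[i iN Zi]|nbig] := pselect (exists2 i,
    i \in others k N & th * u < `|Z i w : 'rV[R]_d|).
    by left; exists i.
  case: h => // -[n nN bn]; right; exists n => //; split => // i iothers.
  rewrite leNgt; apply/negP => Zi; apply: nbig; exists i => //.
  by apply: others_sub iothers; move: nN; rewrite mem_iota.
apply: (le_trans (le_pr P _ _ sub)).
- by apply: measurableI => //; exact: measurable_disturbed.
- by apply: measurableU; exact: measurable_ex_seq.
apply: (le_trans (prU_le P _ _)); try exact: measurable_ex_seq.
have h1 : pr P [set w | exists2 i, i \in others k N & F i w] <= e / 2 * pB.
  apply: (le_trans (pr_bigcup_le P _ mF)).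
  apply: (@le_trans _ _ (\sum_(i <- others k N) pB * V (th * u))).
    rewrite big_seq [leRHS]big_seq; apply: ler_sum => i iN.
    rewrite /F (@pr_indep2 i k B [set x | th * u < `|x|])//.
    - by rewrite ler_wpM2l// pr_norm_gt.
    - by move: iN; rewrite mem_filter => /andP[].
    - apply: open_borel.
      have /continuousP := @norm_continuous R 'rV[R]_d.
      by move=> /(_ _ (@open_gt R (th * u))).
  rewrite big_const_seq count_predT iter_addr addr0 -[leLHS]mulr_natl mulrCA
    mulrC ler_wpM2r//.
  have h2 : th * u * V (th * u) <= e / 2 * th / (M + 1) by near: u.
  have V0 := tail_ge0 (Z 0%N) (th * u).
  apply: (@le_trans _ _ (M * u * V (th * u))).
    by rewrite ler_wpM2r// (le_trans _ NM)// ler_nat size_others.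
  have M1 : 0 < M + 1 by rewrite ltr_wpDl.
  move: h2; rewrite ler_pdivlMr//.
  have -> : th * u * V (th * u) * (M + 1) =
    th * (M * u * V (th * u) + u * V (th * u)) by ring.
  have -> : e / 2 * th = th * (e / 2) by ring.
  rewrite ler_pM2l// => h2; apply: le_trans h2.
  by rewrite lerDl mulr_ge0// ltW.
have h2 : pr P [set w | exists2 n, n \in iota 0 N.+1 & G n w] <= e / 2 * pB.
  apply: (le_trans (pr_bigcup_le P _ mG)).
  apply: (@le_trans _ _ (\sum_(n <- iota 0 N.+1) V u / u * pB)).
    rewrite big_seq [leRHS]big_seq; apply: ler_sum => n;
      rewrite mem_iota add0n ltnS => /andP[_ nN].
    have hu : forall k (s : seq nat) (B : set 'rV[R]_d),
      uniq s -> (size s)%:R <= M * u -> k \notin s -> measurable (B : set BX) ->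
      pr P [set w | [/\ B (Z k w), forall i, i \in s -> `|Z i w : 'rV[R]_d| <=
        th * u &
                    eta * u < `|S s w|]] <=
      V u / u * pr P [set w | B (Z 0%N w)] by near: u.
    apply: hu => //; [exact: others_uniq| |exact: notin_others].
    by apply: le_trans NM; rewrite ler_nat (leq_trans (size_others _ _)).
  rewrite big_const_seq count_predT iter_addr addr0 size_iota -[leLHS]mulr_natl
    mulrA ler_wpM2r//.
  have h3 : u * V u <= e / 2 / (M + 1) by near: u.
  have V0 := tail_ge0 (Z 0%N) u.
  have M1 : 0 < M + 1 by rewrite ltr_wpDl.
  have N1 : N.+1%:R <= (M + 1) * u.
    by rewrite -natr1 mulrDl mul1r lerD// ltW.
  apply: (@le_trans _ _ ((M + 1) * u * (V u / u))).
    by rewrite ler_wpM2r// divr_ge0// ltW.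
  rewrite -mulrA [u * _]mulrC divfK ?gt_eqF// mulrC -ler_pdivlMr//.
  apply: le_trans h3; rewrite ler_peMl// ltW//.
by apply: (le_trans (lerD h1 h2)); rewrite -mulrDl -splitr.
Unshelve. all: by end_near. Qed.

End one_big_jump.

(** * Geometry of the cone *)

Lemma continuous_subr {R : realType} {V : normedModType R} (a : V) :
  continuous (fun z => z - a).
Proof. by move=> z; apply: cvgB; [exact: cvg_id|exact: cvg_cst]. Qed.

Section cone_geometry.
Context {R : realType} {d : nat}.
Implicit Types (x y c : 'rV[R]_d).

Lemma enorm_sqr x : enorm x ^+ 2 = \sum_(i < d) x ord0 i ^+ 2.
Proof. by rewrite sqr_sqrtr// sumr_ge0// => i _; exact: sqr_ge0. Qed.

Lemma enorm_comb (r s : R) x y : enorm (r *: x + s *: y) ^+ 2 =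
  r ^+ 2 * enorm x ^+ 2 + s ^+ 2 * enorm y ^+ 2 +
  2 * r * s * \sum_(i < d) x ord0 i * y ord0 i.
Proof.
rewrite !enorm_sqr !mulr_sumr -!big_split/=; apply: eq_bigr => i _.
by rewrite !mxE; ring.
Qed.

(* If |e + f| >= delta for unit vectors e and f, then
   |r e + s f|^2 >= (r - s)^2 + delta^2 r s. *)
Lemma enorm_unit_comb (r s delta : R) x y : 0 <= r -> 0 <= s -> 0 <= delta ->
  enorm x = 1 -> enorm y = 1 -> delta <= enorm (x + y) ->
  Num.min 1 (delta / 2) * (r + s) <= enorm (r *: x + s *: y).
Proof.
move=> r0 s0 d0 x1 y1 dxy; set m := Num.min _ _.
have m0 : 0 <= m by rewrite le_min ler01 divr_ge0.
rewrite -(@ler_pXn2r _ 2) ?nnegrE ?mulr_ge0 ?addr_ge0 ?enorm_ge0//.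
have := enorm_comb 1 1 x y; have := enorm_comb r s x y.
rewrite !scale1r x1 y1 => -> exy; set p := \sum_(i < d) _ in exy *.
have h : delta ^+ 2 <= 2 + 2 * p.
  have : delta ^+ 2 <= enorm (x + y) ^+ 2 by rewrite lerXn2r ?nnegrE ?enorm_ge0.
  by rewrite exy; lra.
have m1 : m <= 1 by rewrite ge_min lexx.
have md : m <= delta / 2 by rewrite ge_min lexx orbT.
have mm : m ^+ 2 <= 1 by rewrite expr_le1.
have mmd : 4 * m ^+ 2 <= delta ^+ 2.
  have : m ^+ 2 <= (delta / 2) ^+ 2 by rewrite lerXn2r ?nnegrE ?divr_ge0.
  by rewrite expr_div_n; lra.
have rs : 0 <= r * s by exact: mulr_ge0.
have k1 : m ^+ 2 * (r - s) ^+ 2 <= (r - s) ^+ 2 by rewrite ler_piMl ?sqr_ge0.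
have k2 : 4 * m ^+ 2 * (r * s) <= delta ^+ 2 * (r * s) by rewrite ler_wpM2r.
have k3 : delta ^+ 2 * (r * s) <= (2 + 2 * p) * (r * s) by rewrite ler_wpM2r.
by rewrite exprMn; lra.
Qed.

(** Outside the cone the directions of x and c are at distance at least delta from being opposite,
    so [enorm_unit_comb] applies with coefficients |x| and t |c|; the bound then passes to the
    closure by continuity. *)
Lemma cone_lower_bound (c : 'rV[R]_d) (delta : R) (A : set 'rV[R]_d) :
  c != 0 -> 0 < delta -> A `<=` ~` Kcone c delta -> bounded_away A ->
  exists2 kap, 0 < kap & forall x t, closure A x -> 0 <= t ->
    kap * (`|x| + t) <= `|x + t *: c|.
Proof.
move=> c0 delta0 AK aA.
have ec := enorm_gt0 c0.
pose m := Num.min 1 (delta / 2).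
have m0 : 0 < m by rewrite lt_min ltr01 divr_gt0.
have d0 : 0 < Num.sqrt d%:R :> R.
  rewrite sqrtr_gt0 ltr0n lt0n; apply/eqP => d0; move: c0 => /eqP; apply.
  by apply/rowP => i; exfalso; move: (ltn_ord i); rewrite [X in (_ < X)%N]d0.
(* [Num.min 1 (enorm c)] replaces t |c| by t, and the square root of d converts the Euclidean norm
   into the sup norm. *)
pose kap := m * Num.min 1 (enorm c) / Num.sqrt d%:R.
have mc0 : 0 < Num.min 1 (enorm c) by rewrite lt_min ltr01.
have kap0 : 0 < kap by rewrite !mulr_gt0 ?invr_gt0.
have HA x t : A x -> 0 <= t -> kap * (`|x| + t) <= `|x + t *: c|.
  move=> Ax t0.
  have x0 : x != 0.
    by apply/eqP => x0; apply: aA; rewrite -x0; exact: subset_closure.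
  have ex := enorm_gt0 x0.
  have := AK x Ax; rewrite /Kcone /= => nK.
  have {nK} : delta <= enorm ((enorm x)^-1 *: x + (enorm c)^-1 *: c).
    by rewrite leNgt; apply/negP => h; apply: nK.
  move=> /(enorm_unit_comb (r := enorm x) (s :=
    t * enorm c) (ltW ex) (mulr_ge0 t0 (ltW ec)) (ltW delta0)).
  rewrite !enormZ !gtr0_norm ?invr_gt0// !mulVf ?gt_eqF// => /(_ erefl erefl).
  rewrite !scalerA divff ?gt_eqF// mulfK ?gt_eqF// scale1r -/m => h.
  rewrite /kap mulrAC ler_pdivrMr// [leRHS]mulrC.
  apply: le_trans (enorm_le_norm _); apply: le_trans h.
  rewrite -mulrA ler_wpM2l ?(ltW m0)// mulrDr.
  apply: lerD.
    apply: (@le_trans _ _ `|x|); last exact: norm_le_enorm.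
    by rewrite ler_piMl// ge_min lexx.
  by rewrite mulrC ler_wpM2l// ge_min lexx orbT.
exists kap => // x t Ax t0.
apply/ler_addgt0Pr => e e0.
(* Moving x by e' changes the left side by at most kap e' and the right side by at most e'. *)
pose e' := e / (1 + kap).
have k1 : 0 < 1 + kap by exact: addr_gt0.
have e'0 : 0 < e' by exact: divr_gt0.
have [z [Az xz]] := Ax _ (nbhsx_ballx x e' e'0).
move: xz; rewrite -ball_normE/= => xz.
have h1 : `|x| <= `|z| + `|x - z| by rewrite -lerBlDl lerB_dist.
have h2 : `|z + t *: c| <= `|x + t *: c| + `|x - z|.
  rewrite distrC -lerBlDl (le_trans (lerB_dist _ _))//.
  by rewrite opprD addrACA subrr addr0.
have h3 : kap * (`|x| + t) <= kap * (`|z| + t) + kap * e'.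
  rewrite -mulrDr ler_wpM2l ?(ltW kap0)// [leRHS]addrAC lerD2r.
  by rewrite (le_trans h1)// lerD2l ltW.
apply: (le_trans h3); apply: (le_trans (lerD (HA _ _ Az t0) (lexx _))).
have -> : e = e' + kap * e' by rewrite /e'; field; rewrite gt_eqF.
rewrite addrA lerD2r (le_trans h2)// lerD2l; exact: ltW.
Qed.

(* The cone bound confines the drift times of a bounded set of points to a
   compact interval, on which the distance to C is minimized. *)
Lemma closed_ray_sum (c : 'rV[R]_d) (C : set 'rV[R]_d) (kap : R) :
  0 < kap -> closed C ->
  (forall x t, C x -> 0 <= t -> kap * (`|x| + t) <= `|x + t *: c|) ->
  closed (ray_sum c C).
Proof.
move=> kap0 cC HC y cy.
have [C0|/set0P/negP/negPn/eqP C0] := pselect (C !=set0); last first.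
  have [_ [[x [t [Cx _ _]]] _]] := cy setT filterT.
  by move: Cx; rewrite C0.
(* A point x + t c within distance 1 of y satisfies kap t <= |y| + 1. *)
pose tau := (`|y| + 1) / kap.
have tau0 : 0 <= tau by rewrite divr_ge0 ?ltW// ltr_wpDl.
pose g (t : R) := reldist C (y - t *: c).
have cg : continuous g.
  move=> t; apply: (@continuous_comp _ _ _ (fun t : R =>
    y - t *: c) (reldist C)).
    by apply: cvgB; [exact: cvg_cst|apply: cvgZr_tmp; exact: cvg_id].
  exact: (reldist_continuous C0).
have [t0 t0tau tmin] := EVT_min tau0 (continuous_subspaceT cg).
move: t0tau; rewrite in_itv/= => /andP[t00 _].
(* Points of the ray set close to y have their times in [0, tau] and make g there arbitrarily small,
   so the minimum is 0 and y - t0 c belongs to the closed set C. *)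
have g0 : g t0 <= 0.
  apply/ler_addgt0Pr => e e0; rewrite add0r.
  pose e' := Num.min e 1; have e'0 : 0 < e' by rewrite lt_min e0 ltr01.
  have [_ [[x [t [Cx t_ge0 ->]]] ye]] := cy _ (nbhsx_ballx y e' e'0).
  move: ye; rewrite -ball_normE/= => ye.
  have yxt : `|y - (x + t *: c)| < 1 by rewrite (lt_le_trans ye)//
    ge_min lexx orbT.
  have ttau : t <= tau.
    rewrite ler_pdivlMr// mulrC.
    apply: (@le_trans _ _ (kap * (`|x| + t))).
      by rewrite ler_wpM2l ?ler_wpDl// ltW.
    apply: (le_trans (HC _ _ Cx t_ge0)).
    have -> : x + t *: c = y - (y - (x + t *: c)) by rewrite opprB addrCA subrr
      addr0.
    by rewrite (le_trans (ler_normB _ _))// lerD2l ltW.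
  apply: (@le_trans _ _ (g t)); first by apply: tmin; rewrite in_itv/= t_ge0.
  apply: (le_trans (reldist_le _ Cx)).
  rewrite ler_pdivrMr ?ltr_pwDl//.
  have -> : y - t *: c - x = y - (x + t *: c) by rewrite opprD addrAC addrA.
  apply: (@le_trans _ _ e').
    exact: ltW.
  by rewrite (@le_trans _ _ e)// ?ge_min ?lexx// ler_peMr ?(ltW e0)// lerDl.
exists (y - t0 *: c), t0; split => //; last by rewrite subrK.
apply: contrapT => nC; have := reldist_gt0 C0 cC nC.
by rewrite ltNge; move: g0; rewrite /g => ->.
Qed.

Definition shift_set (c : 'rV[R]_d) (v : R) (B : set 'rV[R]_d) :=
  [set v *: c + y | y in B].

Lemma shift_setE c v B : shift_set c v B = (fun z => z - v *: c) @^-1` B.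
Proof.
apply/seteqP; split => [_ [y By <-]|z Bz]; first by rewrite /preimage/=
  addrC addKr.
by exists (z - v *: c) => //; rewrite addrC subrK.
Qed.

Lemma closed_shift c v B : closed B -> closed (shift_set c v B).
Proof.
move=> cB; rewrite shift_setE; apply: preimage_closed => // x _.
exact: continuous_subr.
Qed.

Lemma open_shift c v B : open B -> open (shift_set c v B).
Proof.
move=> oB; rewrite shift_setE; apply: open_comp => // x _.
exact: continuous_subr.
Qed.

(** The excess w - v of the shift is absorbed by the ray parameter. This monotonicity lets block
    ends replace the actual times. *)
Lemma shift_ray_sum_decr c v w (B : set 'rV[R]_d) : v <= w ->
  shift_set c w (ray_sum c B) `<=` shift_set c v (ray_sum c B).
Proof.
move=> vw _ [_ [x [t [Bx t0 ->]]] <-].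
exists (x + (t + (w - v)) *: c).
  by exists x, (t + (w - v)); split => //; rewrite addr_ge0// subr_ge0.
by apply/rowP => i; rewrite !mxE; ring.
Qed.

End cone_geometry.

(** * Late hitting times *)

Section far_tail.
Context {R : realType} {d : nat} {dT} {T : measurableType dT}
  {P : probability T R} {Z : nat -> {RV P >-> Borel 'rV[R]_d}} {alpha : R}
  {mu : {measure set (Borel 'rV[\bar R]_d) -> \bar R}}.
Hypothesis Z_iid : iid Z.
Hypothesis alpha_gt1 : 1 < alpha.
Hypothesis Z_RV : regularly_varying (Z 0%N) alpha mu.
Hypothesis Z_mean0 : forall i : 'I_d,
  ('E_P[fun w => (Z 0%N w : 'rV[R]_d) ord0 i] = 0)%E.
Local Notation BX := (Borel 'rV[R]_d).
Local Notation V := (tail (Z 0%N)).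
Local Notation S := (partial_sum (Z := Z)).

Let alpha_gt0 : 0 < alpha. Proof. exact: lt_trans alpha_gt1. Qed.

(** By the cone bound, a hit at time n forces |S_n| >= kap n, so this event contains every hit later
    than M u. *)
Definition far_event (M kap u : R) : set T :=
  [set w | exists2 n : nat, M * u < n%:R & kap * n%:R <= `|S (iota 1 n) w|].

Lemma measurable_far_event M kap u : measurable (far_event M kap u).
Proof.
rewrite (_ : far_event _ _ _ = \bigcup_(n in [set n : nat | M * u < n%:R])
    ~` [set w | `|S (iota 1 n) w| < kap * n%:R]).
  apply: bigcup_measurable => n _; apply: measurableC.
  apply: (@measurable_event _ _ _ _ (S (iota 1 n)) [set x | `|x| < kap * n%:R]).
    exact: measurable_partial_sum.
  apply: open_borel; apply: (@open_sublevel _ _ (fun x : 'rV[R]_d => `|x|)) =>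
    x.
  exact: norm_continuous.
apply/seteqP; split => [w [n Mn /= h]|w [n Mn h]]; exists n => //=.
  by apply/negP; rewrite -leNgt.
by rewrite leNgt; apply/negP.
Qed.

(* The walk does not use Z 0: the vacuous condition on it lets the bounds on
   truncated deviations, stated jointly with an independent step, apply. *)
Definition block_event (kap th u : R) : set T :=
  [set w | exists2 i, i \in iota 1 (Num.trunc (2 * u)) & th * u < `|Z i w :
    'rV[R]_d|] `|`
  [set w | exists2 n, n \in iota 0 (Num.trunc (2 * u)).+1 &
    [/\ setT (Z 0%N w : 'rV[R]_d),
        forall i, i \in iota 1 n -> `|Z i w : 'rV[R]_d| <= th * u &
        kap * u < `|S (iota 1 n) w|]].

Lemma measurable_block_event kap th u : measurable (block_event kap th u).
Proof.
apply: measurableU; apply: measurable_ex_seq => i.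
  exact: (@measurable_norm_gt _ _ _ _ (Z i)).
by apply: (@measurable_deviation_event _ _ _ _ _ Z _ _ 0%N _ setT);
  exact: measurableT.
Qed.

(** The constant is 2 + 3: at most 2 u steps can be large, and at most 2 u + 1 <= 3 u partial sums
    can deviate, each with probability at most V u / u. *)
Lemma block_event_le (kap : R) : 0 < kap ->
  exists2 th, 0 < th & \forall u \near +oo,
    pr P (block_event kap th u) <= 5 * u * V (th * u).
Proof.
move=> kap0.
have [th0 th00 H] := truncated_deviation Z_iid alpha_gt1 Z_RV Z_mean0 kap0
  (ler0n R 2).
pose th := Num.min th0 1.
have th_gt0 : 0 < th by rewrite lt_min th00 ltr01.
have th1 : th <= 1 by rewrite ge_min lexx orbT.
exists th => //.
have near1 := H th ltac:(by rewrite th_gt0 ge_min lexx).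
near=> u.
have u1 : 1 < u by near: u; exact: near_pinfty_gt.
have u0 : 0 < u by exact: lt_trans u1.
set N := Num.trunc (2 * u).
have NM : N%:R <= 2 * u by rewrite /N -truncn_ge_nat// mulr_ge0// ltW.
have VV : V u <= V (th * u) by rewrite tail_le// ler_piMl// ltW.
have V0 := tail_ge0 (Z 0%N) (th * u).
have mF i : measurable [set w | th * u < `|Z i w : 'rV[R]_d|].
  exact: (@measurable_norm_gt _ _ _ _ (Z i)).
pose G n := [set w | [/\ setT (Z 0%N w : 'rV[R]_d),
        forall i, i \in iota 1 n -> `|Z i w : 'rV[R]_d| <= th * u &
        kap * u < `|S (iota 1 n) w|]].
have mG n : measurable (G n).
  by apply: (@measurable_deviation_event _ _ _ _ _ Z _ _ 0%N _ setT);
    exact: measurableT.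
apply: (le_trans (prU_le P _ _)); try exact: measurable_ex_seq.
have h1 : pr P [set w | exists2 i, i \in iota 1 N & th * u < `|Z i w :
  'rV[R]_d|]
    <= 2 * u * V (th * u).
  apply: (le_trans (pr_bigcup_le P _ mF)).
  apply: (@le_trans _ _ (\sum_(i <- iota 1 N) V (th * u))).
    by apply: ler_sum => i _; apply: (pr_norm_gt Z_iid).
  rewrite big_const_seq count_predT iter_addr addr0 size_iota -[leLHS]mulr_natl.
  by rewrite ler_wpM2r.
have h2 : pr P [set w | exists2 n, n \in iota 0 N.+1 & G n w] <=
  3 * u * V (th * u).
  apply: (le_trans (pr_bigcup_le P _ mG)).
  apply: (@le_trans _ _ (\sum_(n <- iota 0 N.+1) V u / u)).
    rewrite big_seq [leRHS]big_seq; apply: ler_sum => n;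
      rewrite mem_iota add0n ltnS => /andP[_ nN].
    have hu : forall k (s : seq nat) (B : set 'rV[R]_d),
      uniq s -> (size s)%:R <= 2 * u -> k \notin s -> measurable (B : set BX) ->
      pr P [set w | [/\ B (Z k w), forall i, i \in s -> `|Z i w : 'rV[R]_d| <=
        th * u &
                    kap * u < `|S s w|]] <=
      V u / u * pr P [set w | B (Z 0%N w)] by near: u.
    apply: (le_trans (hu 0%N (iota 1 n) setT _ _ _ _)).
    - exact: iota_uniq.
    - by rewrite size_iota (le_trans _ NM)// ler_nat.
    - by rewrite mem_iota.
    - exact: measurableT.
    - rewrite ler_piMr ?divr_ge0 ?tail_ge0 ?(ltW u0)//.
      by rewrite (_ : [set w | _] = setT) ?prT//; apply/seteqP.
  rewrite big_const_seq count_predT iter_addr addr0 size_iota -[leLHS]mulr_natl.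
  apply: (@le_trans _ _ (3 * u * (V u / u))).
    rewrite ler_wpM2r ?divr_ge0 ?tail_ge0 ?(ltW u0)//.
    by rewrite -natr1; lra.
  rewrite ler_wpM2l ?mulr_ge0 ?(ltW u0)// ler_pdivrMr// (le_trans VV)//.
  by rewrite ler_peMr// ltW.
by apply: (le_trans (lerD h1 h2)); lra.
Unshelve. all: by end_near. Qed.

(* Dyadic blocks: each has probability O(u V(u)) at its own scale u, and these
   bounds decrease geometrically because alpha > 1. *)
Lemma far_event_le (kap e : R) : 0 < kap -> 0 < e ->
  exists2 M, 0 < M & \forall u \near +oo, pr P (far_event M kap u) <=
    e * (u * V u).
Proof.
move=> kap0 e0; have a1 := alpha_gt1.
have kap20 : 0 < kap / 2 by rewrite divr_gt0.
have [th th0 Hth] := block_event_le kap20.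
have [ub ub0 {}Hth] := near_pinfty_threshold Hth.
pose p := (1 + alpha) / 2.
have p1 : 1 < p by rewrite /p; lra.
have pa : p < alpha by rewrite /p; lra.
have [ut ut0 Ht] := near_pinfty_threshold (tail_double_le alpha_gt0 Z_RV pa).
pose z : R := 2 `^ (- p).
have z0 : 0 < z by exact: powR_gt0.
have zz : 2 * z < 1.
  rewrite -{1}[2](@powRr1 R) ?ler0n// -powRD ?pnatr_eq0 ?implybT//.
  by rewrite /powR pnatr_eq0/= -[ltRHS]expR0 ltr_expR pmulr_llt0 ?ln_gt0
    ?ltr1n//; lra.
have z1 : 0 < 1 - 2 * z by rewrite subr_gt0.
pose C := th `^ (- alpha) + 1.
have C0 : 0 < C by rewrite ltr_wpDl ?powR_ge0.
have nearC : \forall u \near +oo, V (th * u) <= C * V u.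
  by apply: (tail_limsup alpha_gt0 Z_RV) => //; rewrite ltrDl.
(* The geometric series over blocks m, m + 1, ... sums to 5 C (2 z)^m / (1 - 2 z) times u V u; m is
   chosen to make this factor at most e. *)
pose e' := e * (1 - 2 * z) / (5 * C).
have e'0 : 0 < e' by rewrite divr_gt0 ?mulr_gt0.
have [m hm] : exists m, (2 * z) ^+ m <= e'.
  have : (2 * z) ^+ n @[n --> \oo] --> (0 : R).
    by apply: cvg_expr; rewrite ger0_norm// mulr_ge0// ltW.
  by move=> /cvgr_le/(_ _ e'0)[m _ H]; exists m; apply: H => /=.
exists (2 ^+ m); first exact: exprn_gt0.
near=> u.
have u1 : 1 < u by near: u; exact: near_pinfty_gt.
have u0 : 0 < u by exact: lt_trans u1.
have uub : ub <= u by near: u; apply: nbhs_pinfty_ge; exact: num_real.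
have uut : ut / th <= u by near: u; apply: nbhs_pinfty_ge; exact: num_real.
have Vth : V (th * u) <= C * V u by near: u.
pose F j := block_event (kap / 2) th (2 ^+ (m + j) * u).
have uj j : u <= 2 ^+ (m + j) * u by rewrite ler_peMl ?(ltW u0)// exprn_ege1//
  ler1n.
have Fle j : pr P (F j) <= (5 * C * (u * V u) * (2 * z) ^+ m) * (2 * z) ^+ j.
  apply: (le_trans (Hth _ (le_trans uub (uj j)))).
  have -> : th * (2 ^+ (m + j) * u) = 2 ^+ (m + j) * (th * u) by ring.
  apply: (@le_trans _ _ (5 * (2 ^+ (m + j) * u) * (z ^+ (m + j) * (C * V u)))).
    rewrite ler_wpM2l ?mulr_ge0 ?exprn_ge0 ?(ltW u0)//.
    apply: (le_trans (iter_upper ut0 (ltW z0) Ht (m + j) _)).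
      by rewrite mulrC -ler_pdivrMr.
    by rewrite ler_wpM2l ?exprn_ge0// ltW.
  by rewrite !exprD !exprMn le_eqVlt; apply/orP; left; apply/eqP; ring.
have sub : far_event (2 ^+ m) kap u `<=` \bigcup_j F j.
  move=> w [n nM Sn].
  have M0 : 0 < 2 ^+ m * u by rewrite mulr_gt0 ?exprn_gt0.
  have [j] := dyadic_bracket M0 nM.
  rewrite !mulrA -!exprD addSn [(j + m)%N]addnC exprS -!mulrA => /andP[j1 j2].
  exists j => //; rewrite /F.
  have N0 : 0 <= 2 * (2 ^+ (m + j) * u) by rewrite !mulr_ge0 ?exprn_ge0
    ?(ltW u0).
  have nN : (n <= Num.trunc (2 * (2 ^+ (m + j) * u)))%N
    by rewrite truncn_ge_nat.
  have [[i iN Zi]|nbig] := pselect (exists2 i, i \in iota 1 n &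
      th * (2 ^+ (m + j) * u) < `|Z i w : 'rV[R]_d|).
    left; exists i => //; move: iN; rewrite !mem_iota !add1n !ltnS =>
      /andP[-> h] /=.
    exact: leq_trans nN.
  right; exists n; first by rewrite mem_iota add0n ltnS.
  split => //.
    by move=> i iN; rewrite leNgt; apply/negP => h; apply: nbig; exists i.
  apply: lt_le_trans Sn.
  (* Halving kap provides the strict inequality demanded by the block event. *)
  apply: (@lt_le_trans _ _ (kap * (2 ^+ (m + j) * u))).
    rewrite ltr_pM2r ?mulr_gt0 ?exprn_gt0//.
    by rewrite ltr_pdivrMr// mulr_natr mulr2n ltrDl.
  by rewrite ler_wpM2l ?(ltW kap0)// ltW.
have mF j : measurable (F j) by exact: measurable_block_event.
have mfar := measurable_far_event (2 ^+ m) kap u.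
have UV0 : 0 <= u * V u by rewrite mulr_ge0 ?tail_ge0 ?ltW.
rewrite -lee_fin -prE//.
apply: (le_trans (measure_sigma_subadditive P mF mfar sub)).
apply: (@le_trans _ _ ((5 * C * (u * V u) * (2 * z) ^+ m) / (1 - 2 * z))%:E).
  apply: nneseries_geometric_le.
  - apply: mulr_ge0; last by rewrite exprn_ge0// mulr_ge0// ltW.
    by apply: mulr_ge0 => //; apply: mulr_ge0 => //; exact: ltW.
  - by rewrite zz mulr_gt0.
  - by move=> j; exact: measure_ge0.
  - by move=> j /=; rewrite prE// lee_fin.
rewrite lee_fin ler_pdivrMr//.
move: hm; rewrite ler_pdivlMr ?mulr_gt0// => hm.
have -> : 5 * C * (u * V u) * (2 * z) ^+ m =
  ((2 * z) ^+ m * (5 * C)) * (u * V u) by ring.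
have -> : e * (u * V u) * (1 - 2 * z) = (e * (1 - 2 * z)) * (u * V u) by ring.
by rewrite ler_wpM2r.
Unshelve. all: by end_near. Qed.

End far_tail.

(** * Upper bound *)

(** Times start at 1, whence [k.-1]: block j consists of j l + 1, ..., (j + 1) l. *)
Lemma sum_blocks {R : realType} (J l : nat) (f : nat -> R) :
  \sum_(k <- iota 1 (J * l)) f (k.-1 %/ l)%N = l%:R * \sum_(j < J) f j.
Proof.
rewrite -[1%N]addn0 iotaDl big_map big_distrr/=.
have -> : iota 0 (J * l) = index_iota 0 (J * l) by rewrite /index_iota subn0.
rewrite big_nat_mul -(big_mkord xpredT (fun j => l%:R * f j)).
apply: eq_bigr => j _; rewrite mulSnr.
have -> : \sum_(j * l <= k < j * l + l) f ((1 + k).-1 %/ l)%N =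
          \sum_(j * l <= k < j * l + l) f j.
  apply: eq_big_nat => k /andP[k1 k2]; rewrite add1n /=; congr f.
  have l0 : (0 < l)%N by move: (leq_ltn_trans k1 k2);
    rewrite -[X in (X < _)%N]addn0 ltn_add2l.
  apply/eqP; rewrite eqn_leq leq_divRL// k1 andbT.
  by rewrite -ltnS ltn_divLR// mulSnr.
by rewrite sumr_const_nat addKn mulr_natl.
Qed.

Section upper_bound.
Context {R : realType} {d : nat} {dT} {T : measurableType dT}
  {P : probability T R} {Z : nat -> {RV P >-> Borel 'rV[R]_d}} {alpha : R}
  {mu : {measure set (Borel 'rV[\bar R]_d) -> \bar R}}.
Hypothesis Z_iid : iid Z.
Hypothesis alpha_gt1 : 1 < alpha.
Hypothesis Z_RV : regularly_varying (Z 0%N) alpha mu.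
Hypothesis Z_mean0 : forall i : 'I_d,
  ('E_P[fun w => (Z 0%N w : 'rV[R]_d) ord0 i] = 0)%E.
Local Notation BX := (Borel 'rV[R]_d).
Local Notation V := (tail (Z 0%N)).
Local Notation S := (partial_sum (Z := Z)).
Local Notation q := (scaled_prob (Z 0%N)).
Local Notation nu := (limit_mass mu).

Let alpha_gt0 : 0 < alpha. Proof. exact: lt_trans alpha_gt1. Qed.

Lemma walkE n w : walk Z n w = S (iota 1 n) w.
Proof. by rewrite /walk /partial_sum /index_iota subn1. Qed.

Lemma partial_sum_others k n w : (0 < k <= n)%N ->
  S (iota 1 n) w = (Z k w : 'rV[R]_d) + S (others k n) w.
Proof.
move=> /andP[k0 kn]; rewrite /partial_sum (bigD1_seq k) ?iota_uniq//=;
  last first.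
  by rewrite mem_iota k0 add1n ltnS.
by rewrite /others big_filter.
Qed.

Lemma others_iota k n : (n < k)%N -> others k n = iota 1 n.
Proof.
move=> nk; apply/all_filterP/allP => i; rewrite mem_iota add1n ltnS =>
  /andP[_ ni].
by rewrite neq_ltn (leq_ltn_trans ni nk).
Qed.

Definition hit (c : 'rV[R]_d) (A : set 'rV[R]_d) (u : R) (Q : set nat) : set T
  :=
  [set w | exists2 n, Q n & [set u *: x | x in A] (walk Z n w - n%:R *: c)].

Lemma scale_mem (A : set 'rV[R]_d) u y : 0 < u ->
  [set u *: x | x in A] y <-> A (u^-1 *: y).
Proof.
move=> u0; split => [[x Ax <-]|Ay]; first by rewrite scalerA mulVf ?gt_eqF//
  scale1r.
by exists (u^-1 *: y); rewrite // scalerA divff ?gt_eqF// scale1r.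
Qed.

Lemma measurable_hit c A u Q : 0 < u -> measurable (A : set BX) ->
  measurable (hit c A u Q).
Proof.
move=> u0 mA.
rewrite (_ : hit c A u Q = \bigcup_(n in Q)
   [set w | A (u^-1 *: S (iota 1 n) w + u^-1 *: - (n%:R *: c))]).
  apply: bigcup_measurable => n _; apply: measurable_event mA.
  by apply: measurable_scaled; exact: measurable_partial_sum.
by apply/seteqP; split => [w [n Qn /(scale_mem A _ u0)]|w [n Qn h]];
  [rewrite walkE scalerDr => h; exists n|
   exists n => //; apply/(scale_mem A _ u0); rewrite walkE scalerDr].
Qed.

Lemma measurable_scale_preimage u (B : set 'rV[R]_d) : measurable (B : set BX)
  ->
  measurable ([set x | B (u^-1 *: x)] : set BX).
Proof.
move=> mB; apply: (@measurable_event _ _ _ BX (fun x => u^-1 *: x) B) => //.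
under eq_fun do rewrite -[_ *: _]addr0.
exact: (@measurable_scaled _ _ _ BX u^-1 0 id).
Qed.

Lemma pr_scaled k u (B : set 'rV[R]_d) : measurable (B : set BX) ->
  pr P [set w | B (u^-1 *: (Z k w : 'rV[R]_d))] = q u B.
Proof.
move=> mB.
have mB' := measurable_scale_preimage u mB.
exact: (pr_iid Z_iid k mB').
Qed.

(** [D] will be the ray set of the closure of A; the upper bound works with the properties listed
    here. *)
Context {c : 'rV[R]_d} {A D : set 'rV[R]_d} {kap r : R}.
Hypotheses (kap0 : 0 < kap) (r0 : 0 < r).
Hypothesis A_borel : measurable (A : set BX).
Hypothesis A_r : A `<=` [set x | r <= `|x|].
Hypothesis A_cone : forall x t, A x -> 0 <= t -> kap * (`|x| + t) <= `|x +
  t *: c|.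
Hypothesis A_ray : ray_sum c A `<=` D.
Hypothesis D_closed : closed D.
Hypothesis D_mono : forall v w, v <= w -> shift_set c w D `<=` shift_set c v D.
Hypothesis D_away : forall v, 0 <= v -> ~ shift_set c v D 0.

(** At a hit, S_n = u (x + (n / u) c) with x in A; the summands |x| and n / u of the cone bound give
    one inequality each. *)
Lemma hit_norm u n w : 0 < u -> [set u *: x | x in A] (walk Z n w - n%:R *: c)
  ->
  kap * r * u <= `|S (iota 1 n) w| /\ kap * n%:R <= `|S (iota 1 n) w|.
Proof.
move=> u0 [x Ax xE].
have -> : S (iota 1 n) w = u *: (x + (n%:R / u) *: c).
  rewrite -walkE scalerDr xE scalerA mulrCA divff ?gt_eqF// mulr1 subrK//.
have nu0 : 0 <= n%:R / u :> R by rewrite divr_ge0// ltW.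
have h := A_cone Ax nu0; rewrite normrZ gtr0_norm//.
split.
  rewrite mulrC ler_pM2l// (le_trans _ h)// ler_wpM2l ?(ltW kap0)//.
  by rewrite (le_trans (A_r Ax))// lerDl.
rewrite -ler_pdivrMl// mulrCA (le_trans _ h)// ler_wpM2l ?(ltW kap0)//.
by rewrite [_^-1 * _]mulrC lerDr.
Qed.

(** At a hit x + (n / u) c = (k / u) c + (x + ((n - k) / u) c), whose last part is on a ray from A
    because n >= k; Z_k / u differs from this point by the other steps only. *)
Lemma hit_jump u n k w e : 0 < u -> (0 < k <= n)%N ->
  [set u *: x | x in A] (walk Z n w - n%:R *: c) ->
  `|S (others k n) w| < e * u ->
  thicken (shift_set c (k%:R / u) D) e (u^-1 *: (Z k w : 'rV[R]_d)).
Proof.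
move=> u0 /[dup] kn0 /andP[k0 kn] [x Ax xE] Se.
exists (x + (n%:R / u) *: c).
  exists (x + (n%:R / u - k%:R / u) *: c).
    apply: A_ray; exists x, (n%:R / u - k%:R / u); split => //.
    by rewrite -mulrBl divr_ge0 ?subr_ge0 ?ler_nat// ltW.
  by apply/rowP => i; rewrite !mxE; ring.
have -> : u^-1 *: (Z k w : 'rV[R]_d) - (x + (n%:R / u) *: c) =
  - (u^-1 *: S (others k n) w).
  have -> : (Z k w : 'rV[R]_d) = S (iota 1 n) w - S (others k n) w.
    by rewrite (partial_sum_others w kn0) addrK.
  have -> : x + (n%:R / u) *: c = u^-1 *: S (iota 1 n) w.
    have -> : S (iota 1 n) w = u *: x + n%:R *: c by rewrite xE walkE subrK.
    by rewrite scalerDr !scalerA mulVf ?gt_eqF// scale1r mulrC.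
  by rewrite scalerBr addrAC subrr add0r.
by rewrite normrN normrZ gtr0_norm ?invr_gt0// mulrC ltr_pdivrMr.
Qed.

(** A finite number of blocks admits one radius e, which has to be known before eta and the
    truncation level are chosen. *)
Lemma common_thickening (h e' : R) J : 0 < h -> 0 < e' ->
  exists2 e, 0 < e & \forall u \near +oo, forall j, (j < J)%N ->
    q u (thicken (shift_set c (j%:R * h) D) e) <=
      (nu (shift_set c (j%:R * h) D) + e') * V u.
Proof.
move=> h0 e'0; elim: J => [|J [e e0 IH]]; first by exists 1 => //; near=> u.
have [|||eJ eJ0 HJ] := @scaled_prob_thicken_le _ _ _ _ _ _ _ _ alpha_gt0 Z_RV
  (shift_set c (J%:R * h) D) (nu (shift_set c (J%:R * h) D) + e').
- exact: closed_shift.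
- by apply: D_away; rewrite mulr_ge0// ltW.
- by rewrite ltrDl.
exists (Num.min e eJ); first by rewrite lt_min e0.
have mon u (B : set 'rV[R]_d) (a b : R) : a <= b -> q u (thicken B a) <=
  q u (thicken B b).
  move=> ab; apply: le_scaled_prob; try by apply: open_borel;
    exact: open_thicken.
  by move=> x [y By xy]; exists y => //; exact: lt_le_trans ab.
apply: filterS (filterI IH HJ) => u [Hu HuJ] j; rewrite ltnS leq_eqVlt =>
  /orP[/eqP ->|jJ].
  by apply: le_trans HuJ; apply: mon; rewrite ge_min lexx orbT.
by apply: le_trans (Hu _ jJ); apply: mon; rewrite ge_min lexx.
Unshelve. all: by end_near. Qed.

End upper_bound.

(** * Hits at times of order u *)

Section upper_near.
Context {R : realType} {d : nat} {dT} {T : measurableType dT}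
  {P : probability T R} {Z : nat -> {RV P >-> Borel 'rV[R]_d}} {alpha : R}
  {mu : {measure set (Borel 'rV[\bar R]_d) -> \bar R}}.
Hypothesis Z_iid : iid Z.
Hypothesis alpha_gt1 : 1 < alpha.
Hypothesis Z_RV : regularly_varying (Z 0%N) alpha mu.
Hypothesis Z_mean0 : forall i : 'I_d,
  ('E_P[fun w => (Z 0%N w : 'rV[R]_d) ord0 i] = 0)%E.
Local Notation BX := (Borel 'rV[R]_d).
Local Notation V := (tail (Z 0%N)).
Local Notation S := (partial_sum (Z := Z)).
Local Notation q := (scaled_prob (Z 0%N)).
Local Notation nu := (limit_mass mu).

Let alpha_gt0 : 0 < alpha. Proof. exact: lt_trans alpha_gt1. Qed.
Local Notation hits := (hit (Z := Z)).

Context {c : 'rV[R]_d} {A D : set 'rV[R]_d} {kap r : R}.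
Hypotheses (kap0 : 0 < kap) (r0 : 0 < r).
Hypothesis A_borel : measurable (A : set BX).
Hypothesis A_r : A `<=` [set x | r <= `|x|].
Hypothesis A_cone : forall x t, A x -> 0 <= t -> kap * (`|x| + t) <= `|x +
  t *: c|.
Hypothesis A_ray : ray_sum c A `<=` D.
Hypothesis D_closed : closed D.
Hypothesis D_mono : forall v w, v <= w -> shift_set c w D `<=` shift_set c v D.
Hypothesis D_away : forall v, 0 <= v -> ~ shift_set c v D 0.

(** A hit has one of three causes: a deviation of the walk without large steps, a large step
    accompanied by a disturbance, or a large step that by itself carries the walk near the
    target. *)
Lemma hit_decomposition (u th e eta h : R) (N l J : nat) :
  0 < u -> 0 < h -> (0 < l)%N -> u * h <= l%:R -> N = (J * l)%N ->
  eta < e -> eta < kap * r ->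
  hits c A u [set n | (1 <= n)%N /\ (n <= N)%N] `<=`
  [set w | exists2 n, n \in iota 0 N.+1 &
    [/\ setT (Z 0%N w : 'rV[R]_d),
        forall i, i \in iota 1 n -> `|Z i w : 'rV[R]_d| <= th * u &
        kap * r / 2 * u < `|S (iota 1 n) w|]] `|`
  ([set w | exists2 k, k \in iota 1 N &
     ([set w | th * u < `|Z k w : 'rV[R]_d|] `&` disturbed (Z :=
       Z) k N (th * u) (eta * u)) w] `|`
   [set w | exists2 k, k \in iota 1 N &
     thicken (shift_set c ((k.-1 %/ l)%N%:R * h) D) e
       (u^-1 *: (Z k w : 'rV[R]_d))]).
Proof.
move=> u0 h0 l0 uhl NJl etae etakr w [n [n1 nN] hn].
have [Sn _] := hit_norm kap0 A_r A_cone u0 hn.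
have kr0 : 0 < kap * r by exact: mulr_gt0.
have [[k kN Zk]|nojump] := pselect (exists2 k,
  k \in iota 1 N & th * u < `|Z k w : 'rV[R]_d|);
  last first.
  left; exists n; first by rewrite mem_iota add0n ltnS.
  split => //.
    move=> i; rewrite mem_iota add1n ltnS => /andP[i1 i2].
    rewrite leNgt; apply/negP => Zi; apply: nojump; exists i => //.
    by rewrite mem_iota i1 add1n ltnS (leq_trans i2).
  by apply: lt_le_trans Sn; rewrite ltr_pM2r//; lra.
right; have [dist|undist] := pselect (disturbed (Z :=
  Z) k N (th * u) (eta * u) w).
  by left; exists k.
right; exists k => //.
have k0 : (0 < k)%N by move: kN; rewrite mem_iota => /andP[].
have Sk : `|S (others k n) w| <= eta * u.
  rewrite leNgt; apply/negP => h1; apply: undist; right; exists n => //.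
  by rewrite mem_iota add0n ltnS.
(* Otherwise [others k n] would be all of 1, ..., n and the walk at time n too small for a hit. *)
have kn : (k <= n)%N.
  rewrite leqNgt; apply/negP => nk; move: Sk; rewrite others_iota//.
  by rewrite leNgt => /negP; apply; apply: lt_le_trans Sn; rewrite ltr_pM2r.
have Se : `|S (others k n) w| < e * u by rewrite (le_lt_trans Sk)// ltr_pM2r.
have [y Dy yZ] := hit_jump A_ray u0 (introT andP (conj k0 kn)) hn Se.
(* The left end of the block of k does not exceed k / u, as l >= u h; there the target is larger. *)
exists y => //; apply: D_mono Dy.
rewrite ler_pdivlMr// -mulrA [h * u]mulrC.
apply: (@le_trans _ _ ((k.-1 %/ l)%N%:R * l%:R)); first by rewrite ler_wpM2l.
by rewrite -natrM ler_nat (leq_trans (leq_trunc_div _ _))// leq_pred.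
Qed.

Lemma upper_near (h e : R) (J : nat) : 0 < h -> 0 < e ->
  \forall u \near +oo,
    pr P (hits c A u [set n | (1 <= n)%N /\ n%:R <= J%:R * h * u]) <=
    (\sum_(j < J) h * nu (shift_set c (j%:R * h) D) + e) * (u * V u).
Proof.
move=> h0 e0.
(* For u > 1, l <= u h + 1 gives J l <= J (h + 1) u; the last 1 pays for the extra time in N + 1. *)
pose M := J%:R * (h + 1) + 1.
have M0 : 0 < M by rewrite /M ltr_wpDl// mulr_ge0// ltW// addr_gt0.
(* Of e, a third goes to deviations, a third to disturbed jumps, a sixth to the thickening (J h e1
   <= e / 6) and a sixth to rounding l up. *)
pose e1 := e / 6 / M.
have e10 : 0 < e1 by rewrite !divr_gt0.
have [te te0 Hte] := common_thickening alpha_gt1 Z_RV D_closed D_away J h0 e10.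
have kr0 : 0 < kap * r by exact: mulr_gt0.
pose eta := Num.min te (kap * r) / 2.
have mtk : 0 < Num.min te (kap * r) by rewrite lt_min te0.
have eta0 : 0 < eta by rewrite divr_gt0.
have eta1 : eta < te.
  by rewrite /eta ltr_pdivrMr// mulr_natr mulr2n ltr_pwDl// ge_min lexx.
have eta2 : eta < kap * r.
  by rewrite /eta ltr_pdivrMr// mulr_natr mulr2n ltr_pwDl// ge_min lexx orbT.
have [tha tha0 Ha] := truncated_deviation Z_iid alpha_gt1 Z_RV Z_mean0
  (kap := kap * r / 2) ltac:(by rewrite divr_gt0) (ltW M0).
have [thb thb0 Hb] := disturbed_le Z_iid alpha_gt1 Z_RV Z_mean0 eta0 (ltW M0).
pose th := Num.min tha thb.
have th0 : 0 < th by rewrite lt_min tha0.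
have {}Ha := Ha th ltac:(by rewrite th0 ge_min lexx).
pose C := th `^ (- alpha) + 1.
have C0 : 0 < C by rewrite ltr_wpDl ?powR_ge0.
have nearC : \forall u \near +oo, V (th * u) <= C * V u.
  by apply: (tail_limsup alpha_gt0 Z_RV) => //; rewrite ltrDl.
pose e2 := e / 3 / (M * C).
have e20 : 0 < e2 by rewrite !divr_gt0// mulr_gt0.
have {}Hb := Hb th e2 ltac:(by rewrite th0 ge_min lexx orbT) e20.
pose nuj j := nu (shift_set c (j%:R * h) D).
have nuj0 j : 0 <= nuj j by exact: nu_ge0.
near=> u.
have u1 : 1 < u by near: u; exact: near_pinfty_gt.
have u0 : 0 < u by exact: lt_trans u1.
(* Rounded up, so that J blocks cover all times up to J h u. *)
pose l := (Num.trunc (u * h)).+1.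
have uhl : u * h <= l%:R by rewrite ltW// truncnS_gt.
have luh : l%:R <= u * h + 1.
  by rewrite /l -natr1 lerD2r -truncn_ge_nat// mulr_ge0// ltW.
pose N := (J * l)%N.
have NM : N%:R + 1 <= M * u.
  rewrite /N natrM /M mulrDl mul1r lerD ?(ltW u1)// -mulrA ler_wpM2l//.
  apply: (le_trans luh); rewrite mulrDl mul1r mulrC lerD2l; exact: ltW.
have NM' : N%:R <= M * u by apply: le_trans NM; rewrite lerDl.
have V0 := tail_ge0 (Z 0%N) u.
pose Q := [set n | (1 <= n)%N /\ (n <= N)%N].
have sub0 : hits c A u [set n | (1 <= n)%N /\ n%:R <=
  J%:R * h * u] `<=` hits c A u Q.
  move=> w [n [n1 nJ] hn]; exists n => //; split => //.
  rewrite -(ler_nat R) (le_trans nJ)// /N natrM -mulrA ler_wpM2l//.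
  by rewrite mulrC.
have sub1 := hit_decomposition th u0 h0 (ltn0Sn _) uhl (erefl N) eta1 eta2.
have mZgt k : measurable [set w | th * u < `|Z k w : 'rV[R]_d|].
  exact: (@measurable_norm_gt _ _ _ _ (Z k)).
pose Fa n := [set w | [/\ setT (Z 0%N w : 'rV[R]_d),
        forall i, i \in iota 1 n -> `|Z i w : 'rV[R]_d| <= th * u &
        kap * r / 2 * u < `|S (iota 1 n) w|]].
have mFa n : measurable (Fa n).
  by apply: (@measurable_deviation_event _ _ _ _ _ Z _ _ 0%N _ setT);
    exact: measurableT.
pose Fb k := [set w | th * u < `|Z k w : 'rV[R]_d|] `&` disturbed (Z :=
  Z) k N (th * u) (eta * u).
have mFb k : measurable (Fb k) by apply: measurableI => //;
  exact: measurable_disturbed.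
pose Fc k := [set w | thicken (shift_set c ((k.-1 %/ l)%N%:R * h) D) te
  (u^-1 *: (Z k w : 'rV[R]_d))].
have mFc k : measurable (Fc k).
  by apply: measurable_scaled_event; apply: open_borel; exact: open_thicken.
have mBgt : measurable ([set x : 'rV[R]_d | th * u < `|x|] : set BX).
  apply: open_borel.
  have /continuousP := @norm_continuous R 'rV[R]_d.
  by move=> /(_ _ (@open_gt R (th * u))).
apply: (le_trans (le_pr P _ _ (subset_trans sub0 sub1))).
- exact: measurable_hit.
- by apply: measurableU; [|apply: measurableU]; exact: measurable_ex_seq.
apply: (le_trans (prU_le P _ _)).
- exact: measurable_ex_seq.
- by apply: measurableU; exact: measurable_ex_seq.
have ha : pr P [set w | exists2 n, n \in iota 0 N.+1 & Fa n w] <=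
  e / 3 * (u * V u).
  apply: (le_trans (pr_bigcup_le P _ mFa)).
  apply: (@le_trans _ _ (\sum_(n <- iota 0 N.+1) V u / u)).
    rewrite big_seq [leRHS]big_seq; apply: ler_sum => n;
      rewrite mem_iota add0n ltnS => /andP[_ nN].
    have hu : forall k (s : seq nat) (B : set 'rV[R]_d),
      uniq s -> (size s)%:R <= M * u -> k \notin s -> measurable (B : set BX) ->
      pr P [set w | [/\ B (Z k w), forall i, i \in s -> `|Z i w : 'rV[R]_d| <=
        th * u &
                    kap * r / 2 * u < `|S s w|]] <=
      V u / u * pr P [set w | B (Z 0%N w)] by near: u.
    apply: (le_trans (hu 0%N (iota 1 n) setT _ _ _ _)).
    - exact: iota_uniq.
    - by rewrite size_iota (le_trans _ NM')// ler_nat.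
    - by rewrite mem_iota.
    - exact: measurableT.
    - rewrite ler_piMr ?divr_ge0 ?tail_ge0 ?(ltW u0)//.
      by rewrite (_ : [set w | _] = setT) ?prT//; apply/seteqP.
  rewrite big_const_seq count_predT iter_addr addr0 size_iota -[leLHS]mulr_natl.
  apply: (@le_trans _ _ (M * u * (V u / u))).
    by rewrite ler_wpM2r ?divr_ge0 ?(ltW u0)// -natr1.
  rewrite -mulrA [u * (V u / _)]mulrC divfK ?gt_eqF// [leRHS]mulrA ler_wpM2r//.
  rewrite -ler_pdivrMl ?divr_gt0//.
have hb : pr P [set w | exists2 k, k \in iota 1 N & Fb k w] <=
  e / 3 * (u * V u).
  apply: (le_trans (pr_bigcup_le P _ mFb)).
  have hu : forall k N (B : set 'rV[R]_d), N%:R <= M * u ->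
    measurable (B : set BX) ->
    pr P ([set w | B (Z k w)] `&` disturbed (Z := Z) k N (th * u) (eta * u)) <=
    e2 * pr P [set w | B (Z 0%N w)] by near: u.
  apply: (@le_trans _ _ (\sum_(k <- iota 1 N) e2 * V (th * u))).
    apply: ler_sum => k _; apply: (le_trans (hu k N _ NM' mBgt)).
    by rewrite ler_wpM2l ?(ltW e20)//; apply: (pr_norm_gt Z_iid).
  rewrite big_const_seq count_predT iter_addr addr0 size_iota -[leLHS]mulr_natl.
  have VC : V (th * u) <= C * V u by near: u.
  apply: (@le_trans _ _ (M * u * (e2 * (C * V u)))).
    apply: ler_pM => //; first by rewrite mulr_ge0 ?tail_ge0 ?ltW.
    by rewrite ler_wpM2l ?(ltW e20).
  by rewrite /e2 le_eqVlt; apply/orP; left; apply/eqP; field; rewrite !gt_eqF.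
have hc : pr P [set w | exists2 k, k \in iota 1 N & Fc k w] <=
    (\sum_(j < J) h * nuj j + e / 3) * (u * V u).
  apply: (le_trans (pr_bigcup_le P _ mFc)).
  have hu : forall j, (j < J)%N ->
    q u (thicken (shift_set c (j%:R * h) D) te) <=
      (nuj j + e1) * V u by near: u.
  apply: (@le_trans _ _ (\sum_(k <- iota 1 N) (nuj (k.-1 %/ l)%N + e1) * V u)).
    rewrite big_seq [leRHS]big_seq; apply: ler_sum => k.
    rewrite mem_iota add1n ltnS => /andP[k1 kN].
    have kJ : (k.-1 %/ l < J)%N by rewrite ltn_divLR// prednK.
    apply: le_trans (hu _ kJ); rewrite /Fc (pr_scaled Z_iid)//.
    by apply: open_borel; exact: open_thicken.
  rewrite -mulr_suml (sum_blocks J l (fun j => nuj j + e1)) mulrA ler_wpM2r//.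
  have s0 : 0 <= \sum_(j < J) (nuj j + e1).
    by apply: sumr_ge0 => j _; rewrite addr_ge0// ltW.
  (* The rounding adds at most one time to each block, hence a bounded sum, negligible against u. *)
  have su : \sum_(j < J) (nuj j + e1) <= e / 6 * u.
    by rewrite -ler_pdivrMl ?divr_gt0.
  apply: (@le_trans _ _ ((u * h + 1) * \sum_(j < J) (nuj j + e1))).
    by rewrite ler_wpM2r.
  have hs : h * \sum_(j < J) (nuj j + e1) <= \sum_(j < J) h * nuj j + e / 6.
    rewrite big_split/= sumr_const card_ord mulrDr mulr_sumr lerD2l.
    have -> : h * (e1 *+ J) = (J%:R * h / M) * (e / 6).
      by rewrite /e1 -mulr_natr; field; rewrite gt_eqF.
    rewrite ler_piMl//; first by rewrite divr_ge0// ltW.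
    by rewrite ler_pdivrMr// mul1r /M mulrDr mulr1 -addrA lerDl addr_ge0.
  rewrite mulrDl mul1r -mulrA.
  apply: (le_trans (lerD (ler_wpM2l (ltW u0) hs) su)).
  by rewrite le_eqVlt; apply/orP; left; apply/eqP; field.
by apply: (le_trans (lerD ha (le_trans (prU_le P (measurable_ex_seq _ mFb)
  (measurable_ex_seq _ mFc)) (lerD hb hc)))); lra.
Unshelve. all: by end_near. Qed.

End upper_near.

(** * Lower bound *)

Lemma pr_bigcup_disjoint {R : realType} {dT} {T : measurableType dT}
  (P : probability T R)
    (I : eqType) (s : seq I) (F : I -> set T) :
  uniq s -> (forall i, measurable (F i)) ->
  (forall i j, i \in s -> j \in s -> i != j -> F i `&` F j = set0) ->
  pr P [set w | exists2 i, i \in s & F i w] = \sum_(i <- s) pr P (F i).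
Proof.
move=> us mF; elim: s us => [|i s IH] /=.
  move=> _ _; rewrite big_nil (_ : [set w | _] = set0) ?pr0//.
  by apply/seteqP; split => // w [].
move=> /andP[nis us] dF.
have -> : [set w | exists2 j, j \in i :: s & F j w] =
    F i `|` [set w | exists2 j, j \in s & F j w].
  apply/seteqP; split => w.
    by move=> [j]; rewrite inE => /orP[/eqP->|js] Fj; [left|right; exists j].
  move=> [Fi|[j js Fj]]; first by exists i; rewrite // mem_head.
  by exists j => //; rewrite inE js orbT.
have ms := measurable_ex_seq s mF.
rewrite big_cons -IH//; last first.
  by move=> j k js ks; apply: dF; rewrite inE ?js ?ks orbT.
rewrite /pr measureU// ?fineD ?fin_num_measure//.
apply/seteqP; split => // w [Fi [j js Fj]].
have : (F i `&` F j) w by [].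
rewrite dF ?mem_head//; first by rewrite inE js orbT.
by apply/eqP => ij; rewrite ij js in nis.
Qed.

Section inner_approximation.
Context {R : realType} {d : nat}.
Implicit Types (c : 'rV[R]_d) (G : set 'rV[R]_d).

(* These open sets increase to ray_sum c G, but their points reach G in bounded
   time and with a margin, which absorbs the fluctuations of the walk. *)
Definition inner_ray c G (m : nat) : set 'rV[R]_d :=
  [set z | exists t e, [/\ 0 <= t <= m%:R,
    m.+1%:R^-1 < e & ball (z - t *: c) e `<=` G]].

Lemma open_inner_ray c G m : open (inner_ray c G m).
Proof.
rewrite openE => z [t [e [tm me eG]]].
have em : 0 < e - m.+1%:R^-1 by rewrite subr_gt0.
apply/nbhs_ballP; exists (e - m.+1%:R^-1) => //= z' zz'.
exists t, (e - `|z - z'|); split => //.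
  by move: zz'; rewrite -ball_normE/= ltrBrDl -ltrBrDr.
move=> x; rewrite -!ball_normE/= => xz'; apply: eG; rewrite -ball_normE/=.
have -> : z - t *: c - x = (z - z') + (z' - t *: c - x).
  by apply/rowP => i; rewrite !mxE; ring.
by rewrite (le_lt_trans (ler_normD _ _))// -ltrBrDl.
Qed.

Lemma inner_ray_sub c G m : inner_ray c G m `<=` ray_sum c G.
Proof.
move=> z [t [e [/andP[t0 _] me eG]]]; exists (z - t *: c), t; split => //;
  last by rewrite subrK.
by apply: eG; apply: ballxx; apply: lt_trans me; rewrite invr_gt0.
Qed.

Lemma inner_ray_mono c G m n : (m <= n)%N ->
  inner_ray c G m `<=` inner_ray c G n.
Proof.
move=> mn z [t [e [/andP[t0 tm] me eG]]]; exists t, e; split => //.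
  by rewrite t0 (le_trans tm)// ler_nat.
by apply: le_lt_trans me; rewrite lef_pV2 ?posrE// ler_nat ltnS.
Qed.

Lemma inner_ray_cup c G : open G -> \bigcup_m inner_ray c G m = ray_sum c G.
Proof.
move=> oG; apply/seteqP; split => [z [m _]|z [x [t [Gx t0 ->]]]].
  exact: inner_ray_sub.
have /nbhs_ballP[e /= e0 eG] : nbhs x G by exact: open_nbhs_nbhs.
have [n] := ltr_add_invr (y := 0) e0; rewrite add0r => ne.
exists (maxn n (Num.trunc t).+1) => //; exists t, e; split.
- rewrite t0/= (le_trans (ltW (truncnS_gt t)))// ler_nat leq_maxr//.
- by apply: le_lt_trans ne; rewrite lef_pV2 ?posrE// ler_nat ltnS leq_maxl.
- by rewrite addrK.
Qed.

Lemma shift_bigcup c v (F : nat -> set 'rV[R]_d) :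
  shift_set c v (\bigcup_m F m) = \bigcup_m shift_set c v (F m).
Proof. by rewrite /shift_set image_bigcup. Qed.

End inner_approximation.

Section lower_near.
Context {R : realType} {d : nat} {dT} {T : measurableType dT}
  {P : probability T R} {Z : nat -> {RV P >-> Borel 'rV[R]_d}} {alpha : R}
  {mu : {measure set (Borel 'rV[\bar R]_d) -> \bar R}}.
Hypothesis Z_iid : iid Z.
Hypothesis alpha_gt1 : 1 < alpha.
Hypothesis Z_RV : regularly_varying (Z 0%N) alpha mu.
Hypothesis Z_mean0 : forall i : 'I_d,
  ('E_P[fun w => (Z 0%N w : 'rV[R]_d) ord0 i] = 0)%E.
Local Notation BX := (Borel 'rV[R]_d).
Local Notation V := (tail (Z 0%N)).
Local Notation S := (partial_sum (Z := Z)).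
Local Notation q := (scaled_prob (Z 0%N)).
Local Notation nu := (limit_mass mu).

Let alpha_gt0 : 0 < alpha. Proof. exact: lt_trans alpha_gt1. Qed.
Local Notation hits := (hit (Z := Z)).
Local Notation E := (@embed R d).

Context {c : 'rV[R]_d} {A G : set 'rV[R]_d} {kap r : R}.
Hypotheses (kap0 : 0 < kap) (r0 : 0 < r).
Hypothesis A_borel : measurable (A : set BX).
Hypothesis G_open : open G.
Hypothesis G_A : G `<=` A.
Hypothesis A_r : A `<=` [set x | r <= `|x|].
Hypothesis A_cone : forall x t, A x -> 0 <= t -> kap * (`|x| + t) <= `|x +
  t *: c|.

Lemma shift_ray_norm v : 0 <= v ->
  shift_set c v (ray_sum c G) `<=` [set x | kap * r <= `|x|].
Proof.
move=> v0 _ [_ [x [t [/G_A Ax t0 ->]]] <-] /=.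
have -> : v *: c + (x + t *: c) = x + (t + v) *: c.
  by apply/rowP => i; rewrite !mxE; ring.
apply: le_trans (A_cone Ax (addr_ge0 t0 v0)).
rewrite ler_wpM2l ?(ltW kap0)// (le_trans (A_r Ax))// lerDl addr_ge0//.
Qed.

Lemma shift_ray_away v : 0 <= v -> bounded_away (shift_set c v (ray_sum c G)).
Proof.
move=> v0; have kr0 : 0 < kap * r by exact: mulr_gt0.
move=> /(_ _ (nbhsx_ballx 0 _ kr0)) [x [Sx]].
rewrite -ball_normE/= sub0r normrN ltNge => /negP; apply.
exact: (shift_ray_norm v0).
Qed.

Lemma open_shift_inner v m : open (shift_set c v (inner_ray c G m)).
Proof. by apply: open_shift; exact: open_inner_ray. Qed.

Lemma open_shift_ray v : open (shift_set c v (ray_sum c G)).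
Proof.
apply: open_shift; rewrite -inner_ray_cup//; apply: bigcup_open => m _.
exact: open_inner_ray.
Qed.

Lemma nu_inner_ray v e : 0 <= v -> 0 < e ->
  exists m, nu (shift_set c v (ray_sum c G)) - e < nu
    (shift_set c v (inner_ray c G m)).
Proof.
move=> v0 e0; have aw := shift_ray_away v0.
have mS := open_borel (@open_shift_ray v).
have mI m := open_borel (@open_shift_inner v m).
have : (mu \o (fun m => E @` shift_set c v (inner_ray c G m))) m @[m -->
  \oo] -->
    mu (\bigcup_m (E @` shift_set c v (inner_ray c G m))).
  apply: nondecreasing_cvg_mu.
  - by move=> m; exact: measurable_embed.
  - by apply: bigcupT_measurable => m; exact: measurable_embed.
  - move=> m n mn; apply/subsetPset; apply: image_subset; apply: image_subset.
    exact: inner_ray_mono.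
rewrite -image_bigcup -shift_bigcup inner_ray_cup// (nuE Z_RV)//.
move=> /fine_cvgP[_] /cvgr_gt/(_ (nu (shift_set c v (ray_sum c G)) - e)).
rewrite ltrBlDr ltrDl => /(_ e0)[m _ /(_ m)] H.
by exists m; apply: H => /=.
Qed.

(** Right block ends appear because there the target is smallest. One m serves the finitely many
    blocks. *)
Lemma common_inner_ray (h e' : R) J : 0 < h -> 0 < e' ->
  exists m, \forall u \near +oo, forall j, (j < J)%N ->
    (nu (shift_set c (j.+1%:R * h) (ray_sum c G)) - e') * V u <=
    q u (shift_set c (j.+1%:R * h) (inner_ray c G m)).
Proof.
move=> h0 e'0; elim: J => [|J [m IH]]; first by exists 0%N; near=> u.
have v0 : 0 <= J.+1%:R * h by rewrite mulr_ge0// ltW.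
have [mJ HmJ] := nu_inner_ray v0 e'0.
have aw m' : bounded_away (shift_set c (J.+1%:R * h) (inner_ray c G m')).
  apply: (bounded_away_sub _ (shift_ray_away v0)).
  by apply: image_subset; exact: inner_ray_sub.
have HJ := scaled_prob_open_ge alpha_gt0 Z_RV (@open_shift_inner _ mJ) (aw mJ)
  HmJ.
have mon u v m1 m2 : (m1 <= m2)%N ->
    q u (shift_set c v (inner_ray c G m1)) <=
      q u (shift_set c v (inner_ray c G m2)).
  move=> m12; apply: le_scaled_prob; try by apply: open_borel;
    exact: open_shift_inner.
  by apply: image_subset; exact: inner_ray_mono.
exists (maxn m mJ); apply: filterS (filterI IH HJ) => u [Hu HuJ] j.
rewrite ltnS leq_eqVlt => /orP[/eqP ->|jJ].
  by apply: (le_trans HuJ); apply: mon; exact: leq_maxr.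
by apply: (le_trans (Hu _ jJ)); apply: mon; exact: leq_maxl.
Unshelve. all: by end_near. Qed.

(** If Z_k / u = (j h) c + y, the drift accumulated up to time u (j h + t) leaves y - t c, a point
    of G with margin above 1/(m+1). Rounding that time shifts it by at most |c| / u and the other
    steps by at most eta. *)
Lemma inner_jump_hits (u h th eta : R) (m l J N k : nat) w :
  0 < u -> 0 < h -> (0 < l)%N -> l%:R <= u * h -> N =
    Num.trunc (u * (J%:R * h + m%:R)) ->
  `|c| / u + eta <= m.+1%:R^-1 -> k \in iota 1 (J * l) ->
  shift_set c ((k.-1 %/ l).+1%:R * h) (inner_ray c G m)
    (u^-1 *: (Z k w : 'rV[R]_d)) ->
  ~ disturbed (Z := Z) k N th (eta * u) w ->
  hits c A u [set n | (1 <= n)%N] w.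
Proof.
move=> u0 h0 l0 luh NE ceta; rewrite mem_iota add1n ltnS => /andP[k1 kJl].
set j := (k.-1 %/ l).+1 => -[y [t [e [/andP[t0 tm] me eG]]] yZ] undist.
have jJ : (j <= J)%N by rewrite /j ltn_divLR// prednK.
have kj : (k <= j * l)%N.
  by rewrite /j -{1}(prednK k1) -ltn_divLR.
have jt0 : 0 <= u * (j%:R * h + t) by rewrite mulr_ge0 ?(ltW u0)// addr_ge0//
  mulr_ge0// ltW.
pose n := Num.trunc (u * (j%:R * h + t)).
have /andP[n1 n2] := truncn_itv jt0.
rewrite -/n in n1 n2.
have nN : (n <= N)%N.
  rewrite NE /n le_truncn// ler_wpM2l ?(ltW u0)// lerD// ler_wpM2r ?(ltW h0)//.
  by rewrite ler_nat.
(* Since l <= u h, block j ends no later than time u j h: the jump has occurred by time n. *)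
have kn : (k <= n)%N.
  rewrite /n truncn_ge_nat// (@le_trans _ _ (j * l)%:R)// ?ler_nat//.
  rewrite natrM mulrDr (@le_trans _ _ (j%:R * (u * h)))//;
    first by rewrite ler_wpM2l.
  by rewrite mulrCA lerDl mulr_ge0// ltW.
exists n; first exact: leq_trans kn.
apply/scale_mem => //; apply: G_A; apply: eG; rewrite -ball_normE/=.
apply: le_lt_trans me; apply: le_trans ceta.
have Sk : `|S (others k n) w| <= eta * u.
  rewrite leNgt; apply/negP => h1; apply: undist; right; exists n => //.
  by rewrite mem_iota add0n ltnS.
have Zu : (Z k w : 'rV[R]_d) = u *: ((j%:R * h) *: c + y).
  by rewrite yZ scalerA divff ?gt_eqF// scale1r.
have -> : y - t *: c - u^-1 *: (walk Z n w - n%:R *: c) =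
    - ((((u * (j%:R * h + t) - n%:R) / u) *: c) + u^-1 *: S (others k n) w).
  rewrite walkE (partial_sum_others _ (k := k)) ?k1// Zu.
  by apply/rowP => i; rewrite !mxE; field; rewrite gt_eqF.
rewrite normrN (le_trans (ler_normD _ _))// lerD//.
  rewrite normrZ mulrC ler_wpM2l// ger0_norm ?divr_ge0 ?subr_ge0 ?(ltW u0)//.
  rewrite ler_pdivrMr// mulVf ?gt_eqF//.
  by rewrite lerBlDl natr1 ltW.
by rewrite normrZ gtr0_norm ?invr_gt0// mulrC ler_pdivrMr.
Qed.

(** Restricted to undisturbed configurations, the jump events for different k are disjoint, so their
    probabilities add up; each restriction costs only a fraction e2. *)
Lemma lower_near (h e : R) (J : nat) : 0 < h -> 0 < e ->
  \forall u \near +oo,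
    (\sum_(j < J) h * nu (shift_set c (j.+1%:R * h) (ray_sum c G)) - e) *
      (u * V u) <=
    pr P (hits c A u [set n | (1 <= n)%N]).
Proof.
move=> h0 e0.
pose nuj j := nu (shift_set c (j.+1%:R * h) (ray_sum c G)).
pose e1 := e / 3 / (J%:R * h + 1).
have Jh1 : 0 < J%:R * h + 1 by rewrite ltr_wpDl// mulr_ge0// ltW.
have e10 : 0 < e1 by rewrite !divr_gt0.
have [m Hm] := common_inner_ray J h0 e10.
(* Truncation at 0 keeps the summands nonnegative, as the factor 1 - e2 and the rounding of l
   require. *)
pose b j := Num.max 0 (nuj j - e1).
pose B := \sum_(j < J) b j.
have B0 : 0 <= B by apply: sumr_ge0 => j _; rewrite le_max lexx.
have hB0 : 0 < h * B + 1 by rewrite ltr_wpDl// mulr_ge0// ltW.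
(* Then e2 h B <= e / 3, and 1 - e2 is nonnegative. The other two thirds of e pay for e1 and for the
   rounding of l. *)
pose e2 := Num.min 1 (e / 3 / (h * B + 1)).
have e20 : 0 < e2 by rewrite lt_min ltr01 !divr_gt0.
have e21 : e2 <= 1 by rewrite ge_min lexx.
pose eta := m.+1%:R^-1 / 2 : R.
have eta0 : 0 < eta by rewrite divr_gt0// invr_gt0.
pose M := J%:R * h + m%:R.
have M0 : 0 <= M by rewrite addr_ge0// mulr_ge0// ltW.
have [tha tha0 Ha] := disturbed_le Z_iid alpha_gt1 Z_RV Z_mean0 eta0 M0.
have kr0 : 0 < kap * r by exact: mulr_gt0.
(* Below kap r, a lower bound for the norm of all targets: a second jump into a target then counts
   as a disturbance, which yields disjointness. *)
pose th := Num.min tha (kap * r / 2).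
have th0 : 0 < th by rewrite lt_min tha0 divr_gt0.
have thkr : th < kap * r.
  by apply: (@le_lt_trans _ _ (kap * r / 2)); [rewrite ge_min lexx orbT|lra].
have {}Ha := Ha th e2 ltac:(by rewrite th0 ge_min lexx) e20.
near=> u.
have u1 : 1 < u by near: u; exact: near_pinfty_gt.
have u0 : 0 < u by exact: lt_trans u1.
have hu1 : h^-1 < u by near: u; exact: near_pinfty_gt.
have uh1 : 1 < u * h by rewrite -ltr_pdivrMr// mul1r.
(* Rounded down here, so that block j is over by time u j h. *)
pose l := Num.trunc (u * h).
have uh0 : 0 <= u * h by rewrite mulr_ge0 ?ltW.
have l0 : (0 < l)%N by rewrite truncn_gt0 ltW.
have luh : l%:R <= u * h by rewrite truncn_le.
have uhl : u * h - 1 <= l%:R by rewrite lerBlDr natr1 ltW// truncnS_gt.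
pose N := Num.trunc (u * M).
have NM : N%:R <= M * u by rewrite mulrC truncn_le mulr_ge0// ltW.
have V0 := tail_ge0 (Z 0%N) u.
pose C k := shift_set c ((k.-1 %/ l).+1%:R * h) (inner_ray c G m).
have mC k : measurable (C k : set BX) by apply: open_borel;
  exact: open_shift_inner.
pose H k := [set w | C k (u^-1 *: (Z k w : 'rV[R]_d))].
have mH k : measurable (H k) by exact: measurable_scaled_event.
pose D k := disturbed (Z := Z) k N (th * u) (eta * u).
have mD k : measurable (D k) by exact: measurable_disturbed.
have mHD k : measurable (H k `\` D k) by exact: measurableD.
have JlN : (J * l <= N)%N.
  rewrite truncn_ge_nat ?mulr_ge0 ?(ltW u0)// natrM.
  rewrite (@le_trans _ _ (J%:R * (u * h)))//; first by rewrite ler_wpM2l.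
  by rewrite mulrCA ler_wpM2l ?(ltW u0)// lerDl.
have sub : [set w | exists2 k, k \in iota 1 (J * l) & (H k `\` D k) w] `<=`
    hits c A u [set n | (1 <= n)%N].
  move=> w [k kJl [Hk nDk]].
  apply: (@inner_jump_hits u h (th * u) eta m l J N k w) => //.
  have cu : `|c| / eta <= u by near: u; apply: nbhs_pinfty_ge; exact: num_real.
  rewrite [leRHS]splitr lerD2r ler_pdivrMr// mulrC -ler_pdivrMr//.
have disj i j : i \in iota 1 (J * l) -> j \in iota 1 (J * l) -> i != j ->
    (H i `\` D i) `&` (H j `\` D j) = set0.
  move=> iJ jJ ij; apply/seteqP; split => // w [[Hi nDi] [Hj nDj]].
  apply: nDi; left; exists j.
    move: jJ; rewrite mem_filter eq_sym ij/= !mem_iota => /andP[-> h1]/=.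
    by rewrite (leq_trans h1)// leq_add2l.
  have vj : 0 <= (j.-1 %/ l).+1%:R * h by rewrite mulr_ge0// ltW.
  have /(shift_ray_norm vj) /= : shift_set c ((j.-1 %/ l).+1%:R * h)
    (ray_sum c G)
      (u^-1 *: (Z j w : 'rV[R]_d)).
    by move: Hj; apply: image_subset; exact: inner_ray_sub.
  rewrite normrZ gtr0_norm ?invr_gt0// [_^-1 * _]mulrC ler_pdivlMr//.
  by apply: lt_le_trans; rewrite ltr_pM2r.
apply: le_trans (le_pr P (measurable_ex_seq _ mHD)
  (measurable_hit _ _ u0 A_borel) sub).
rewrite pr_bigcup_disjoint ?iota_uniq//.
have HD k : (1 - e2) * q u (C k) <= pr P (H k `\` D k).
  have hu : forall k N (B : set 'rV[R]_d), N%:R <= M * u ->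
    measurable (B : set BX) ->
    pr P ([set w | B (Z k w)] `&` disturbed (Z := Z) k N (th * u) (eta * u)) <=
    e2 * pr P [set w | B (Z 0%N w)] by near: u.
  have mC' : measurable ([set x | C k (u^-1 *: x)] : set BX).
    exact: measurable_scale_preimage.
  have := hu k N [set x | C k (u^-1 *: x)] NM mC'.
  rewrite prD// -[pr P (H k)]/(pr P [set w | C k (u^-1 *: (Z k w : 'rV[R]_d))]).
  rewrite (pr_scaled Z_iid)// mulrBl mul1r lerD2l lerN2.
  exact.
apply: (@le_trans _ _ (\sum_(k <- iota 1 (J * l)) (1 - e2) * V u * b
  (k.-1 %/ l)%N)).
  rewrite -mulr_sumr (sum_blocks J l b) -/B.
  have hB : \sum_(j < J) h * nuj j - e / 3 <= h * B.
    rewrite /B mulr_sumr lerBlDr.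
    apply: (@le_trans _ _ (\sum_(j < J) (h * b j + h * e1))).
      apply: ler_sum => j _; rewrite -mulrDr ler_wpM2l ?(ltW h0)//.
      by rewrite -lerBlDr le_max lexx orbT.
    rewrite big_split/= lerD2l sumr_const card_ord.
    have -> : (h * e1) *+ J = (J%:R * h / (J%:R * h + 1)) * (e / 3).
      by rewrite /e1 -mulr_natr; field; rewrite gt_eqF.
    rewrite ler_piMl//; first by rewrite divr_ge0// ltW.
    by rewrite ler_pdivrMr// mul1r lerDl.
  have Bu : B <= e / 3 * u.
    by rewrite -ler_pdivrMl ?divr_gt0.
  have e2B : e2 * (h * B) <= e / 3.
    apply: (@le_trans _ _ (e / 3 / (h * B + 1) * (h * B))).
      by rewrite ler_wpM2r ?mulr_ge0 ?(ltW h0)// ge_min lexx orbT.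
    rewrite mulrAC ler_pdivrMr// ler_wpM2l ?divr_ge0 ?(ltW e0)//.
    by rewrite lerDl.
  have lB : (u * h - 1) * B <= l%:R * B by rewrite ler_wpM2r.
  have k1 : (1 - e2) * ((u * h - 1) * B) <= (1 - e2) * (l%:R * B).
    by rewrite ler_wpM2l// subr_ge0.
  have k2 : (\sum_(j < J) h * nuj j - e) * u <= (1 - e2) * ((u * h - 1) * B).
    have e2B0 : 0 <= e2 * B by rewrite mulr_ge0// ltW.
    have k3 : u * (\sum_(j < J) h * nuj j - e / 3) <= u * (h * B).
      by rewrite ler_wpM2l// ltW.
    have k4 : u * (e2 * (h * B)) <= u * (e / 3) by rewrite ler_wpM2l// ltW.
    have -> : (1 - e2) * ((u * h - 1) * B) =
      u * (h * B) - B - u * (e2 * (h * B)) + e2 * B.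
      by ring.
    by lra.
  rewrite mulrA -[leRHS]mulrA [V u * _]mulrC [leRHS]mulrA ler_wpM2r//.
  exact: le_trans k1.
rewrite big_seq [leRHS]big_seq; apply: ler_sum => k.
rewrite mem_iota add1n ltnS => /andP[k1 kN].
have kJ : (k.-1 %/ l < J)%N by rewrite ltn_divLR// prednK.
apply: le_trans (HD k); rewrite -mulrA ler_wpM2l ?subr_ge0//.
have hu : forall j, (j < J)%N ->
    (nu (shift_set c (j.+1%:R * h) (ray_sum c G)) - e1) * V u <=
    q u (shift_set c (j.+1%:R * h) (inner_ray c G m)) by near: u.
rewrite /b mulrC; have [h1|h1] := leP (nuj (k.-1 %/ l)%N - e1) 0.
  by rewrite mul0r pr_ge0.
exact: hu.
Unshelve. all: by end_near. Qed.

End lower_near.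

(** * Riemann sums and conclusion *)

Section limf.
Context {R : realType}.
Implicit Types (f : R -> \bar R) (a : \bar R).

Lemma limf_esup_le f a : (\forall u \near +oo, (f u <= a)%E) ->
  (limf_esup f +oo%R <= a)%E.
Proof.
move=> fa; rewrite limf_esupE.
apply: (@le_trans _ _ (ereal_sup [set f x | x in [set u | (f u <= a)%E]])).
  by apply: ereal_inf_lbound; exists [set u | (f u <= a)%E].
by apply: ge_ereal_sup => _ [x /= xa <-].
Qed.

Lemma limf_einf_ge f a : (\forall u \near +oo, (a <= f u)%E) ->
  (a <= limf_einf f +oo%R)%E.
Proof.
move=> fa; rewrite limf_einfE.
apply: (@le_trans _ _ (ereal_inf [set f x | x in [set u | (a <= f u)%E]])).
  by apply/ereal_infP => _ [x /= xa <-].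
by apply: ereal_sup_ubound; exists [set u | (a <= f u)%E].
Qed.

Lemma limf_einf_le_esup f : (limf_einf f +oo%R <= limf_esup f +oo%R)%E.
Proof.
rewrite limf_einfE limf_esupE.
apply: ge_ereal_sup => _ [V FV <-]; apply/ereal_infP => _ [W FW <-].
have [x [Vx Wx]] := filter_ex (filterI FV FW).
apply: (@le_trans _ _ (f x)).
  by apply: ereal_inf_lbound; exists x.
by apply: ereal_sup_ubound; exists x.
Qed.

End limf.

(** * Riemann sums of a nonincreasing function *)

Section monotone_integral.
Context {R : realType} (phi : R -> R).
Hypothesis phi0 : forall v, 0 <= phi v.
Hypothesis phi_decr : forall v w, v <= w -> phi w <= phi v.
Local Notation leb := (@lebesgue_measure R).

Let mphi (D : set R) : measurable D -> measurable_fun D (EFin \o phi).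
Proof. by move=> mD; apply/measurable_EFinP; apply: nonincreasing_measurable =>
  // v w; exact: phi_decr. Qed.

Let int_cell (h : R) (j : nat) : 0 < h ->
  ((h * phi (j.+1%:R * h))%:E <= \int[leb]_(v in `[(j%:R * h)%R,
    (j.+1%:R * h)%R[) (phi v)%:E)%E /\
  (\int[leb]_(v in `[(j%:R * h)%R, (j.+1%:R * h)%R[) (phi v)%:E <=
    (h * phi (j%:R * h))%:E)%E.
Proof.
move=> h0.
have len : leb `[j%:R * h, j.+1%:R * h[%classic = h%:E.
  rewrite lebesgue_measure_itv/= lte_fin ltr_pM2r// ltr_nat ltnSn -EFinB.
  by congr EFin; rewrite -natr1; ring.
split.
  rewrite mulrC EFinM -len -integral_cst//; apply: ge0_le_integral => //.
  - by move=> v _; rewrite lee_fin.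
  - exact: mphi.
  - move=> v /=; rewrite in_itv/= => /andP[_ vj]; rewrite lee_fin.
    by apply: phi_decr; exact: ltW.
rewrite [h * phi _]mulrC EFinM -len -integral_cst//; apply: ge0_le_integral =>
  //.
- by move=> v _; rewrite lee_fin.
- exact: mphi.
- by move=> v /=; rewrite in_itv/= => /andP[vj _]; rewrite lee_fin;
  exact: phi_decr.
Qed.

Let int_cells (h : R) (J : nat) : 0 < h ->
  ((\sum_(j < J) h * phi (j.+1%:R * h))%:E <=
    \int[leb]_(v in `[0%R, (J%:R * h)%R[) (phi v)%:E)%E /\
  (\int[leb]_(v in `[0%R, (J%:R * h)%R[) (phi v)%:E <=
    (\sum_(j < J) h * phi (j%:R * h))%:E)%E.
Proof.
move=> h0; elim: J => [|J [IH1 IH2]].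
  by rewrite !big_ord0 mul0r set_itv_ge ?integral_set0//= bnd_simp ltxx.
have Jh0 : 0 <= J%:R * h by rewrite mulr_ge0// ltW.
have JJ : J%:R * h <= J.+1%:R * h by rewrite ler_wpM2r ?(ltW h0)// ler_nat.
have split_itv : `[0, J.+1%:R * h[%classic =
    `[0, J%:R * h[%classic `|` `[J%:R * h, J.+1%:R * h[%classic.
  apply/seteqP; split => v /=; rewrite !in_itv/=.
    move=> /andP[v0 vJ]; have [h1|h1] := ltP v (J%:R * h).
      by left; rewrite v0.
    by right; rewrite vJ.
  move=> [/andP[-> h1]|/andP[h1 ->]].
    by rewrite (lt_le_trans h1).
  by rewrite (le_trans Jh0).
rewrite split_itv ge0_integral_setU//=; last 3 first.
- by rewrite -split_itv; exact: mphi.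
- by move=> v _; rewrite lee_fin.
- apply/disj_setPS => v /= []; rewrite !in_itv/= => /andP[_ h1] /andP[h2 _].
  by have := lt_le_trans h1 h2; rewrite ltxx.
have [c1 c2] := int_cell J h0.
by rewrite !big_ord_recr/= !EFinD; split; exact: leeD.
Qed.

Lemma riemann_sum_le_integral (h : R) (J : nat) : 0 < h ->
  ((\sum_(j < J) h * phi (j.+1%:R * h))%:E <=
    \int[leb]_(v in `[0%R, +oo[) (phi v)%:E)%E.
Proof.
move=> h0; have [c1 _] := int_cells J h0; apply: (le_trans c1).
apply: ge0_subset_integral => //.
- exact: mphi.
- by move=> v _; rewrite lee_fin.
- by move=> v /=; rewrite !in_itv/= andbT => /andP[].
Qed.

Lemma integral_le_riemann_sum (h : R) (b : \bar R) : 0 < h ->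
  (forall J : nat, (\sum_(j < J) h * phi (j%:R * h))%:E <= b)%E ->
  (\int[leb]_(v in `[0%R, +oo[) (phi v)%:E <= b)%E.
Proof.
move=> h0 Hb.
have cup : `[0, +oo[%classic = \bigcup_J `[0, J%:R * h[%classic.
  apply/seteqP; split => v /=; rewrite ?in_itv/= ?andbT.
    move=> v0; exists (Num.trunc (v / h)).+1 => //=; rewrite in_itv/= v0/=.
    by rewrite -ltr_pdivrMr// truncnS_gt.
  by move=> [J _ /=]; rewrite in_itv/= => /andP[].
rewrite cup.
have cv : (\int[leb]_(v in `[0%R, (J%:R * h)%R[) (phi v)%:E)%E @[J --> \oo] -->
    (\int[leb]_(v in \bigcup_J `[0%R, (J%:R * h)%R[%classic) (phi v)%:E)%E.
  apply: ge0_nondecreasing_set_cvg_integral => //.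
  - move=> m n mn; apply/subsetPset => v /=; rewrite !in_itv/= =>
    /andP[-> h1]/=.
    by rewrite (lt_le_trans h1)// ler_wpM2r ?(ltW h0)// ler_nat.
  - by move=> J; exact: mphi.
  - by move=> J v _; rewrite lee_fin.
rewrite -(cvg_lim _ cv)//; apply: lime_le; first by apply/cvg_ex; eexists;
  exact: cv.
by near=> J; apply: le_trans (Hb J); have [_ c2] := int_cells J h0.
Unshelve. all: by end_near. Qed.

(** Left and right sums telescope to within h phi 0, uniformly in J, so letting h tend to 0
    suffices. *)
Lemma shift_riemann_sum (h : R) (J : nat) : 0 < h ->
  \sum_(j < J) h * phi (j%:R * h) <= h * phi 0 +
    \sum_(j < J) h * phi (j.+1%:R * h).
Proof.
move=> h0; case: J => [|J]; first by rewrite !big_ord0 addr0 mulr_ge0// ltW.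
rewrite big_ord_recl/= mul0r lerD2l big_ord_recr/= lerDl.
by rewrite mulr_ge0// ltW.
Qed.

End monotone_integral.

(** * The two asymptotic bounds *)

Section ruin_asymptotics.
Context {R : realType} {d : nat} {dT} {T : measurableType dT}
  {P : probability T R} {Z : nat -> {RV P >-> Borel 'rV[R]_d}} {alpha : R}
  {mu : {measure set (Borel 'rV[\bar R]_d) -> \bar R}}.
Hypothesis Z_iid : iid Z.
Hypothesis alpha_gt1 : 1 < alpha.
Hypothesis Z_RV : regularly_varying (Z 0%N) alpha mu.
Hypothesis Z_mean0 : forall i : 'I_d,
  ('E_P[fun w => (Z 0%N w : 'rV[R]_d) ord0 i] = 0)%E.
Local Notation BX := (Borel 'rV[R]_d).
Local Notation V := (tail (Z 0%N)).
Local Notation S := (partial_sum (Z := Z)).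
Local Notation q := (scaled_prob (Z 0%N)).
Local Notation nu := (limit_mass mu).

Let alpha_gt0 : 0 < alpha. Proof. exact: lt_trans alpha_gt1. Qed.
Local Notation hits := (hit (Z := Z)).
Local Notation E := (@embed R d).

Context {c : 'rV[R]_d} {A : set 'rV[R]_d} {kap r : R}.
Hypotheses (kap0 : 0 < kap) (r0 : 0 < r).
Hypothesis A_borel : measurable (A : set BX).
Hypothesis A_r : A `<=` [set x | r <= `|x|].
Hypothesis A_cone : forall x t, closure A x -> 0 <= t ->
  kap * (`|x| + t) <= `|x + t *: c|.

Definition ruin_ratio (u : R) : \bar R :=
  (psi Z c A u / (u%:E * P [set w | (u < enorm (Z 0%N w))%R]))%E.

Lemma ruin_ratioE u : 0 < u ->
  ruin_ratio u = (pr P (hits c A u [set n | (1 <= n)%N]) / (u * V u))%:E.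
Proof.
move=> u0; have uV : 0 < u * V u by rewrite mulr_gt0// (tail_gt0 Z_RV).
rewrite /ruin_ratio; have -> : psi Z c A u =
  (pr P (hits c A u [set n | (1 <= n)%N]))%:E.
  by apply: (prE P); exact: measurable_hit.
have -> : P [set w | u < enorm (Z 0%N w)] = (V u)%:E.
  by apply: (prE P); exact: measurable_tail.
by rewrite -EFinM inver gt_eqF// -EFinM.
Qed.

(* Truncating the drift at 0 makes the integrand of mustar monotone on R. *)
Definition ray_mass (B : set 'rV[R]_d) (v : R) : R :=
  nu (shift_set c (Num.max 0 v) (ray_sum c B)).

Lemma ray_mass_ge0 B v : 0 <= ray_mass B v. Proof. exact: nu_ge0. Qed.

Lemma ray_massE B v : 0 <= v -> ray_mass B v = nu (shift_set c v (ray_sum c B)).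
Proof. by move=> v0; rewrite /ray_mass max_r. Qed.

Lemma ray_mass_decr B :
  (forall v, 0 <= v -> measurable (shift_set c v (ray_sum c B) : set BX)) ->
  (forall v, 0 <= v -> bounded_away (shift_set c v (ray_sum c B))) ->
  forall v w, v <= w -> ray_mass B w <= ray_mass B v.
Proof.
move=> mB aB v w vw.
have m0 (x : R) : 0 <= Num.max 0 x by rewrite le_max lexx.
apply: (le_nu Z_RV); [exact: mB|exact: mB|exact: aB|].
by apply: shift_ray_sum_decr; rewrite ge_max !le_max lexx vw orbT.
Qed.

(** On Borel sets the outer measure in [mustar] agrees with [mu]; for B open, or the closure of A,
    the shifted ray sets are Borel. *)
Lemma mustarE B :
  (forall v, 0 <= v -> measurable (shift_set c v (ray_sum c B) : set BX)) ->
  (forall v, 0 <= v -> bounded_away (shift_set c v (ray_sum c B))) ->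
  mustar mu c B = (\int[lebesgue_measure]_(v in `[0%R,
    +oo[) (ray_mass B v)%:E)%E.
Proof.
move=> mB aB; apply: eq_integral => v; rewrite inE/= in_itv/= andbT => v0.
rewrite ray_massE// -(nuE Z_RV (mB v v0) (aB v v0)).
by apply: measurable_mu_extE; apply: measurable_embed; exact: mB.
Qed.

Lemma closed_shift_ray v : closed (shift_set c v (ray_sum c (closure A))).
Proof.
apply: closed_shift; apply: (closed_ray_sum kap0) => //; exact: closed_closure.
Qed.

Lemma shift_ray_not0 v : ~ closure A 0 -> 0 <= v ->
  ~ shift_set c v (ray_sum c (closure A)) 0.
Proof.
move=> A0 v0 [_ [x [t [Ax t0 ->]]] xv].
have xE : x + (t + v) *: c = 0.
  by rewrite -xv; apply/rowP => i; rewrite !mxE; ring.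
have := A_cone Ax (addr_ge0 t0 v0); rewrite xE normr0 pmulr_rle0//.
move=> h; apply: A0; suff <- : x = 0 by [].
apply/eqP; rewrite -normr_le0; apply: le_trans h.
by rewrite lerDl addr_ge0.
Qed.

Let A_cone' x t : A x -> 0 <= t -> kap * (`|x| + t) <= `|x + t *: c|.
Proof. by move=> Ax; apply: A_cone; exact: subset_closure. Qed.

Lemma ruin_limsup : ~ closure A 0 ->
  (limf_esup ruin_ratio +oo%R <= mustar mu c (closure A))%E.
Proof.
move=> A0; have aw v : 0 <= v -> bounded_away
  (shift_set c v (ray_sum c (closure A))).
  move=> v0; rewrite /bounded_away -(closure_id _).1;
    last exact: closed_shift_ray.
  exact: shift_ray_not0.
have mS v : 0 <= v -> measurable (shift_set c v (ray_sum c (closure A)) : set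
  BX).
  by move=> _; apply: closed_borel; exact: closed_shift_ray.
have decr := ray_mass_decr mS aw.
rewrite mustarE//; apply/lee_addgt0Pr => e e0.
have e40 : 0 < e / 4 by rewrite divr_gt0.
have [M M0 HM] := far_event_le Z_iid alpha_gt1 Z_RV Z_mean0 kap0 e40.
pose phi := ray_mass (closure A).
have phi0 v : 0 <= phi v by exact: ray_mass_ge0.
(* Exchanging left for right sums then costs h phi 0 <= e / 4; adding 1 avoids a division by 0. *)
pose h := e / 4 / (phi 0 + 1).
have p1 : 0 < phi 0 + 1 by rewrite ltr_wpDl.
have h0 : 0 < h by rewrite divr_gt0.
(* The blocks reach beyond M u, where [far_event] takes over. *)
pose J := (Num.trunc (M / h)).+1.
have JM : M <= J%:R * h by rewrite -ler_pdivrMr// ltW// truncnS_gt.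
have cD : closed (ray_sum c (closure A)).
  by apply: (closed_ray_sum kap0) => //; exact: closed_closure.
have rayD : ray_sum c A `<=` ray_sum c (closure A).
  by move=> _ [x [t [Ax t0 ->]]]; exists x, t; split => //;
    exact: subset_closure.
have near1 := upper_near Z_iid alpha_gt1 Z_RV Z_mean0 kap0 r0 A_borel A_r
  A_cone' rayD
  cD (fun v w vw => shift_ray_sum_decr (c := c) (B := closure A) vw)
  (fun v v0 => @shift_ray_not0 v A0 v0) J h0 e40.
apply: (@le_trans _ _ ((\sum_(j < J) h * phi (j%:R * h) + e / 4 + e / 4)%:E));
  last first.
  apply: (@le_trans _ _ ((h * phi 0 + e / 4 + e / 4)%:E +
      (\sum_(j < J) h * phi (j.+1%:R * h))%:E)%E).
    rewrite -EFinD lee_fin; have := shift_riemann_sum phi0 J h0; lra.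
  rewrite addeC; apply: leeD; first exact: riemann_sum_le_integral.
  have hp : h * phi 0 <= e / 4.
    by rewrite /h mulrAC ler_pdivrMr// ler_wpM2l ?(ltW e40)// lerDl.
  by rewrite lee_fin; lra.
apply: limf_esup_le; near=> u.
have u0 : 0 < u by near: u; exact: near_pinfty_gt.
have uV : 0 < u * V u by rewrite mulr_gt0// (tail_gt0 Z_RV).
rewrite ruin_ratioE// lee_fin ler_pdivrMr//.
have n1 : pr P (hits c A u [set n | (1 <= n)%N /\ n%:R <= J%:R * h * u]) <=
    (\sum_(j < J) h * nu (shift_set c (j%:R * h) (ray_sum c (closure A))) +
      e / 4) * (u * V u).
  by near: u.
have n2 : pr P (far_event (Z := Z) M kap u) <= e / 4 * (u * V u) by near: u.
have sub : hits c A u [set n | (1 <= n)%N] `<=`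
    hits c A u [set n | (1 <= n)%N /\ n%:R <= J%:R * h * u] `|` far_event (Z :=
      Z) M kap u.
  move=> w [n n1' hn]; have [le|gt] := leP n%:R (J%:R * h * u); first by left;
    exists n.
  right; exists n; first by apply: le_lt_trans gt; rewrite ler_wpM2r// ltW.
  by have [] := hit_norm kap0 A_r A_cone' u0 hn.
have m1 Q : measurable (hits c A u Q) by exact: measurable_hit.
have m2 := measurable_far_event (Z := Z) M kap u.
apply: (le_trans (le_pr P (m1 _) (measurableU _ _ (m1 _) m2) sub)).
apply: (le_trans (prU_le P (m1 _) m2)).
apply: (le_trans (lerD n1 n2)); rewrite -mulrDl ler_wpM2r ?(ltW uV)//.
rewrite lerD2r lerD2r; apply: ler_sum => j _.
by rewrite /phi ray_massE// mulr_ge0// ltW.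
Unshelve. all: by end_near. Qed.

(** Right sums over any number J of blocks stay below the liminf, so late times are simply dropped;
    the integral is recovered from left sums as J grows, by monotone convergence. *)
Lemma ruin_liminf : (mustar mu c (interior A) <= limf_einf ruin_ratio +oo%R)%E.
Proof.
have oG : open (interior A) by exact: open_interior.
have GA : interior A `<=` A by exact: interior_subset.
have aw v : 0 <= v -> bounded_away (shift_set c v (ray_sum c (interior A))).
  exact: (shift_ray_away kap0 r0 GA A_r A_cone').
have mS v : 0 <= v -> measurable (shift_set c v (ray_sum c (interior A)) : set
  BX).
  by move=> _; apply: open_borel; exact: open_shift_ray.
have decr := ray_mass_decr mS aw.
rewrite mustarE//.
pose phi := ray_mass (interior A).
have phi0 v : 0 <= phi v by exact: ray_mass_ge0.
have sums h J : 0 < h ->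
    ((\sum_(j < J) h * phi (j.+1%:R * h))%:E <= limf_einf ruin_ratio +oo%R)%E.
  move=> h0; apply/lee_addgt0Pr => e e0; rewrite -leeBlDr// -EFinB.
  apply: limf_einf_ge.
  have near1 := lower_near Z_iid alpha_gt1 Z_RV Z_mean0 kap0 r0 A_borel oG GA
    A_r A_cone' J h0 e0.
  near=> u.
  have u0 : 0 < u by near: u; exact: near_pinfty_gt.
  have uV : 0 < u * V u by rewrite mulr_gt0// (tail_gt0 Z_RV).
  rewrite ruin_ratioE// lee_fin ler_pdivlMr//.
  have -> : \sum_(j < J) h * phi (j.+1%:R * h) =
    \sum_(j < J) h * nu (shift_set c (j.+1%:R * h) (ray_sum c (interior A))).
    by apply: eq_bigr => j _; rewrite /phi ray_massE// mulr_ge0// ltW.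
  by near: u.
apply/lee_addgt0Pr => e e0.
pose h := e / (phi 0 + 1).
have p1 : 0 < phi 0 + 1 by rewrite ltr_wpDl.
have h0 : 0 < h by rewrite divr_gt0.
apply: (integral_le_riemann_sum _ _ h0) => // J.
apply: (@le_trans _ _ ((\sum_(j < J) h * phi (j.+1%:R * h))%:E +
  (h * phi 0)%:E)%E).
  by rewrite -EFinD lee_fin addrC; exact: shift_riemann_sum.
apply: leeD; first exact: sums.
by rewrite lee_fin /h mulrAC ler_pdivrMr// ler_wpM2l ?(ltW e0)// lerDl.
Unshelve. all: by end_near. Qed.

End ruin_asymptotics.

Theorem theorem3p1 (R : realType) (d : nat)
    (dT : measure_display) (T : measurableType dT) (P : probability T R)
    (Z : nat -> {RV P >-> Borel 'rV[R]_d}) (alpha : R)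
    (mu : {measure set (Borel 'rV[\bar R]_d) -> \bar R})
    (c : 'rV[R]_d) (delta : R)
    (Z_iid : iid Z)
    (alpha_gt1 : 1 < alpha)
    (Z_RV : regularly_varying (Z 0%N) alpha mu)
    (Z_mean0 : forall i : 'I_d,
       ('E_P[fun w => (Z 0%N w : 'rV[R]_d) ord0 i] = 0)%E)
    (c_neq0 : c != 0)
    (delta_gt0 : 0 < delta)
    (mu_bdK : mu (@embed R d @` (boundary (Kcone c delta) `\ 0)) = 0%E)
    (A : set 'rV[R]_d)
    (A_borel : measurable (A : set (Borel 'rV[R]_d)))
    (A_notK : A `<=` ~` Kcone c delta)
    (A_away : bounded_away A) :
  let ratio (u : R) : \bar R :=
    (psi Z c A u / (u%:E * P [set w | (u < enorm (Z 0%N w))%R]))%E in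
  [/\ (mustar mu c (interior A) <= limf_einf ratio +oo%R)%E,
      (limf_einf ratio +oo%R <= limf_esup ratio +oo%R)%E
    & (limf_esup ratio +oo%R <= mustar mu c (closure A))%E].
Proof.
have [kap kap0 A_cone] := cone_lower_bound c_neq0 delta_gt0 A_notK A_away.
have [r r0 A_r] := bounded_away_enorm A_away.
split.
- exact: (ruin_liminf Z_iid alpha_gt1 Z_RV Z_mean0 kap0 r0 A_borel A_r A_cone).
- exact: limf_einf_le_esup.
- exact: (ruin_limsup Z_iid alpha_gt1 Z_RV Z_mean0 kap0 r0 A_borel A_r A_cone A_away).
Qed.
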